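(* Let $k$ be algebraically closed of characteristic zero and $q\in k^\times$ not a root of unity. Every symplectic (resp. orthogonal) $D_q$-module $(V,\Phi,\langle\,,\rangle)$ over $k((t))$ admits a decomposition $V=\bigoplus_jU_j$ into mutually orthogonal nondegenerate $D_q$-submodules. Each $U_j$ (with the restricted form) is of one of the following types: (i) $U_j=A\oplus B$ with $A\cong J_d\otimes V_{r,s}(\lambda)$ and $B\cong J_d\otimes V_{-r,s}(\lambda^{-1})$, where $\bar\lambda\notin E_q[2]$ or $r\neq0$. Here $A$ and $B$ are isotropic, and the form induces an isomorphism $B\cong A^\vee$. (ii) $U_j=A\oplus B$ with $A\cong B\cong J_d\otimes V_{0,1}(\lambda)$, where $\bar\lambda\in E_q[2]$ and $d$ is odd in the symplectic case (resp. even in the orthogonal case). Here $A$ and $B$ are isotropic, and the form induces $B\cong A^\vee$. (iii) $U_j\cong J_d\otimes V_{0,1}(\lambda)$, where $\bar\lambda\in E_q[2]$ and $d$ is even in the symplectic case (resp. odd in the orthogonal case).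
   Context: $\sigma_q(a(t))=a(qt)$. A symplectic (resp. orthogonal) $D_q$-module over $k((t))$ is a triple $(V,\Phi,\langle\,,\rangle)$ consisting of: - a finite-dimensional $k((t))$-space $V$; - a bijective additive $\Phi$ with $\Phi(av)=\sigma_q(a)\Phi(v)$; - a nondegenerate symplectic (resp. symmetric) $k((t))$-bilinear form with $\langle\Phi v,\Phi w\rangle=\sigma_q\langle v,w\rangle$. $k((t))_q[T]$ is the skew polynomial ring with $Ta=\sigma_q(a)T$. We use the following modules, each with $\Phi$ given by left multiplication by $T$: - $V_{r,s}(\lambda)=k((t))_q[T]/k((t))_q[T](T^s-\lambda t^r)$, with $r,s\in\mathbb Z$, $s\ge1$, $\gcd(r,s)=1$ and $\lambda\in k^\times$; - $J_d=k((t))_q[T]/k((t))_q[T](T-1)^d$. The tensor product is $V\otimes W$ with $\Phi_V\otimes\Phi_W$. $\bar\lambda$ is the class of $\lambda$ in $k^\times/q^{\mathbb Z}$. $E_q[2]=\{\bar\lambda:\lambda^2\in q^{\mathbb Z}\}$, the $2$-torsion of $k^\times/q^{\mathbb Z}$. $A^\vee=\mathrm{Hom}_{k((t))}(A,k((t)))$, and ''$B\cong A^\vee$ via the form'' means that $b\mapsto\langle b,\cdot\rangle|_A$ is an isomorphism. *)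

(* Defs.v *)
From HB Require Import structures.
From mathcomp Require Import all_boot all_order all_algebra.
From Stdlib Require Import ClassicalEpsilon FunctionalExtensionality Lia.
Set Implicit Arguments. Unset Strict Implicit. Unset Printing Implicit Defensive.
Import GRing.Theory.
Local Open Scope ring_scope.


Section PowerSeries.
Variable k : idomainType.

Record pseries := PSeries { pscoef : nat -> k }.

Lemma pseries_ext (f g : pseries) : (forall n, pscoef f n = pscoef g n) -> f = g.
Proof.
case: f g => f [g] /= H; congr PSeries; exact: functional_extensionality.
Qed.

Definition pseries_eqb (f g : pseries) : bool :=
  if excluded_middle_informative (f = g) then true else false.

Lemma pseries_eqP : Equality.axiom pseries_eqb.
Proof.
move=> f g; rewrite /pseries_eqb.
by case: excluded_middle_informative => H; constructor.
Qed.

HB.instance Definition _ := hasDecEq.Build pseries pseries_eqP.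

Definition pseries_find (P : pred pseries) (n : nat) : option pseries :=
  match excluded_middle_informative (exists x, P x) with
  | left H => Some (proj1_sig (constructive_indefinite_description _ H))
  | right _ => None
  end.

Lemma pseries_find_correct P n x : pseries_find P n = Some x -> P x.
Proof.
rewrite /pseries_find; case: excluded_middle_informative => // H [<-].
exact: proj2_sig (constructive_indefinite_description _ H).
Qed.

Lemma pseries_find_complete (P : pred pseries) :
  (exists x, P x) -> exists n, pseries_find P n.
Proof.
move=> H; exists 0%N; rewrite /pseries_find.
by case: excluded_middle_informative.
Qed.

Lemma pseries_find_ext (P Q : pred pseries) :
  P =1 Q -> pseries_find P =1 pseries_find Q.
Proof. by move=> /functional_extensionality ->. Qed.

HB.instance Definition _ := hasChoice.Build pseries
  pseries_find_correct pseries_find_complete pseries_find_ext.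

Definition ps0 := PSeries (fun _ => 0).
Definition psadd f g := PSeries (fun n => pscoef f n + pscoef g n).
Definition psopp f := PSeries (fun n => - pscoef f n).

Lemma psaddA : associative psadd.
Proof. by move=> f g h; apply: pseries_ext => n /=; rewrite addrA. Qed.
Lemma psaddC : commutative psadd.
Proof. by move=> f g; apply: pseries_ext => n /=; rewrite addrC. Qed.
Lemma psadd0 : left_id ps0 psadd.
Proof. by move=> f; apply: pseries_ext => n /=; rewrite add0r. Qed.
Lemma psaddN : left_inverse ps0 psopp psadd.
Proof. by move=> f; apply: pseries_ext => n /=; rewrite addNr. Qed.

HB.instance Definition _ := GRing.isZmodule.Build pseries
  psaddA psaddC psadd0 psaddN.

Definition ps1 := PSeries (fun n => (n == 0%N)%:R).
Definition psmul f g :=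
  PSeries (fun n => \sum_(i < n.+1) pscoef f i * pscoef g (n - i)).

Definition trunc (f : pseries) n : {poly k} := \poly_(i < n.+1) pscoef f i.

Lemma coef_trunc f n m : (m <= n)%N -> (trunc f n)`_m = pscoef f m.
Proof. by move=> h; rewrite coef_poly ltnS h. Qed.

Lemma coefM_low (A B C D : {poly k}) n :
  (forall j, (j <= n)%N -> A`_j = B`_j) ->
  (forall j, (j <= n)%N -> C`_j = D`_j) -> (A * C)`_n = (B * D)`_n.
Proof.
move=> hAB hCD; rewrite !coefM; apply: eq_bigr => j _.
by rewrite hAB ?hCD ?leq_subr // -ltnS.
Qed.

Lemma psmulE f g n m : (m <= n)%N ->
  pscoef (psmul f g) m = (trunc f n * trunc g n)`_m.
Proof.
move=> hmn; rewrite coefM /=; apply: eq_bigr => j _.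
have hj : (j <= m)%N by rewrite -ltnS.
rewrite !coef_trunc //; first exact: leq_trans (leq_subr _ _) hmn.
exact: leq_trans hj hmn.
Qed.

Lemma trunc_mul f g n j : (j <= n)%N ->
  (trunc (psmul f g) n)`_j = (trunc f n * trunc g n)`_j.
Proof. by move=> h; rewrite coef_trunc // (psmulE _ _ h). Qed.

Lemma psmulA : associative psmul.
Proof.
move=> f g h; apply: pseries_ext => n.
rewrite (psmulE _ _ (leqnn n)) [RHS](psmulE _ _ (leqnn n)).
transitivity ((trunc f n * (trunc g n * trunc h n))`_n).
  apply: coefM_low => // j hj; exact: trunc_mul.
rewrite mulrA; apply: coefM_low => // j hj; by rewrite trunc_mul.
Qed.

Lemma psmulC : commutative psmul.
Proof.
move=> f g; apply: pseries_ext => n.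
by rewrite !(psmulE _ _ (leqnn n)) mulrC.
Qed.

Lemma psmul1 : left_id ps1 psmul.
Proof.
move=> f; apply: pseries_ext => n.
rewrite (psmulE _ _ (leqnn n)) (@coefM_low _ 1 _ (trunc f n)) //.
  by rewrite mul1r coef_trunc.
by move=> j hj; rewrite coef_trunc // coef1.
Qed.

Lemma psmulDl : left_distributive psmul psadd.
Proof.
move=> f g h; apply: pseries_ext => n.
transitivity (pscoef (psmul f h) n + pscoef (psmul g h) n); last by [].
rewrite !(psmulE _ _ (leqnn n)).
rewrite -coefD -mulrDl; apply: coefM_low => // j hj.
by rewrite coefD !coef_trunc.
Qed.

Lemma ps1_neq0 : ps1 != 0.
Proof.
apply/eqP => /(congr1 (fun f => pscoef f 0)) /= /eqP.
by rewrite oner_eq0.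
Qed.

HB.instance Definition _ := GRing.Zmodule_isComNzRing.Build pseries
  psmulA psmulC psmul1 psmulDl ps1_neq0.

Definition psunit : {pred pseries} := fun f =>
  if excluded_middle_informative (exists g, g * f = 1) then true else false.

Definition psinv (f : pseries) : pseries :=
  match excluded_middle_informative (exists g, g * f = 1) with
  | left H => proj1_sig (constructive_indefinite_description _ H)
  | right _ => f
  end.

Lemma psmulV : {in psunit, left_inverse 1 psinv *%R}.
Proof.
move=> f; rewrite unfold_in /psunit /psinv.
case: excluded_middle_informative => // H _.
exact: proj2_sig (constructive_indefinite_description _ H).
Qed.

Lemma psunitPl (f g : pseries) : g * f = 1 -> psunit f.
Proof.
by move=> H; rewrite /psunit; case: excluded_middle_informative => // -[]; exists g.
Qed.

Lemma psinv_out : {in [predC psunit], psinv =1 id}.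
Proof.
move=> f; rewrite inE /= unfold_in /psunit /psinv.
by case: excluded_middle_informative.
Qed.

HB.instance Definition _ := GRing.ComNzRing_hasMulInverse.Build pseries
  psmulV psunitPl psinv_out.

Lemma ps_neq0 (f : pseries) : f != 0 -> exists n, pscoef f n != 0.
Proof.
move=> hf.
case: (excluded_middle_informative (exists n, pscoef f n != 0)) => // H.
exfalso; move/eqP: hf; apply; apply: pseries_ext => n /=.
apply/eqP/negPn/negP => hn; apply: H; exists n; exact: hn.
Qed.

Lemma ps_idomain : GRing.integral_domain_axiom pseries.
Proof.
move=> f g fg0; apply/norP => -[/ps_neq0 hf /ps_neq0 hg].
case: (ex_minnP hf) => i hi imin; case: (ex_minnP hg) => j hj jmin.
have := congr1 (fun h => pscoef h (i + j)) fg0 => /= H.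
have hii : (i < (i + j).+1)%N by rewrite ltnS leq_addr.
rewrite (bigD1 (Ordinal hii)) //= big1 ?addr0 in H; last first.
  move=> l hl; case: (ltngtP l i) => [lt|gt|eq].
  - have : pscoef f l == 0.
      by apply: contraTT lt => /imin; rewrite -leqNgt.
    by move/eqP ->; rewrite mul0r.
  - have hlt : (i + j - l < j)%N.
      have hl' : (l <= i + j)%N by rewrite -ltnS ltn_ord.
      by rewrite ltn_subLR // ltn_add2r.
    have : pscoef g (i + j - l) == 0.
      by apply: contraTT hlt => /jmin; rewrite -leqNgt.
    by move/eqP ->; rewrite mulr0.
  - by move: hl; rewrite -val_eqE /= eq eqxx.
by move: H; rewrite addKn => /eqP; rewrite mulf_eq0 (negbTE hi) (negbTE hj).
Qed.

HB.instance Definition _ := GRing.ComUnitRing_isIntegral.Build pseries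
  ps_idomain.
End PowerSeries.


Notation laurent k := {fraction pseries k}.

Section Laurent.
Variable k : idomainType.

Definition ps_sigma (q : k) (f : pseries k) : pseries k :=
  PSeries (fun n => q ^+ n * pscoef f n).

Definition sigma_q (q : k) (x : laurent k) : laurent k :=
  let r := repr x in
  FracField.tofrac (ps_sigma q \n_r) / FracField.tofrac (ps_sigma q \d_r).

Definition ps_t : pseries k := PSeries (fun n => (n == 1%N)%:R).
Definition ps_const (a : k) : pseries k :=
  PSeries (fun n => if n == 0%N then a else 0).
Definition tL : laurent k := FracField.tofrac ps_t.
Definition constL (a : k) : laurent k := FracField.tofrac (ps_const a).

Definition in_Eq2 (q lam : k) : Prop := exists z : int, lam ^+ 2 = q ^ z.

(* J_d = k((t))_q[T]/(T-1)^d has k((t))-basis x_a = (T-1)^a, a < d, with     *)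
(*   Phi x_a = x_a + x_(a+1)  (a < d-1),  Phi x_(d-1) = x_(d-1).             *)
(* V_{r,s}(lambda) = k((t))_q[T]/(T^s - lambda t^r) has basis y_b = T^b,     *)
(*   b < s, with Phi y_b = y_(b+1) (b < s-1), Phi y_(s-1) = lambda t^r y_0.  *)
(* In both cases Phi(sum c_i e_i) = sum sigma_q(c_i) Phi(e_i); row i of the  *)
(* matrices below lists the coordinates of Phi(e_i).                         *)
(* J_d (x) V_{r,s}(lambda), with Phi (x) Phi, is represented on d x s        *)
(* coordinate matrices X (X a b = coefficient of x_a (x) y_b).               *)

Definition Jmx (d : nat) : 'M[laurent k]_d :=
  \matrix_(i, j) ((j == i :> nat) || (j == i.+1 :> nat))%:R.

Definition Vmx (r : int) (s : nat) (lam : k) : 'M[laurent k]_s :=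
  \matrix_(i, j)
    if i.+1 == s then (if j == 0%N :> nat then constL lam * tL ^ r else 0)
    else (j == i.+1 :> nat)%:R.

Definition PhiModel (q : k) (d s : nat) (r : int) (lam : k)
    (X : 'M[laurent k]_(d, s)) : 'M[laurent k]_(d, s) :=
  (Jmx d)^T *m map_mx (sigma_q q) X *m Vmx r s lam.

Arguments PhiModel q d s r lam X : clear implicits.

Variable V : vectType (laurent k).

Definition Dq_structure (q : k) (Phi : V -> V) : Prop :=
  [/\ forall u v, Phi (u + v) = Phi u + Phi v,
      forall (a : laurent k) v, Phi (a *: v) = sigma_q q a *: Phi v
    & bijective Phi].

Definition bilinear_form (b : V -> V -> laurent k) : Prop :=
  (forall a u v w, b (a *: u + v) w = a * b u w + b v w) /\
  (forall a u v w, b u (a *: v + w) = a * b u v + b u w).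

Definition nondegenerate (b : V -> V -> laurent k) : Prop :=
  forall u, (forall w, b u w = 0) -> u = 0.

Definition form_kind (symp : bool) (b : V -> V -> laurent k) : Prop :=
  if symp then forall v, b v v = 0 else forall u w, b u w = b w u.

Definition Dq_form (q : k) (symp : bool) (Phi : V -> V)
    (b : V -> V -> laurent k) : Prop :=
  [/\ Dq_structure q Phi, bilinear_form b, nondegenerate b, form_kind symp b
    & forall u w, b (Phi u) (Phi w) = sigma_q q (b u w)].

Definition Dq_submodule (Phi : V -> V) (U : {vspace V}) : Prop :=
  (forall u, u \in U -> Phi u \in U) /\
  (forall u, u \in U -> exists2 w, w \in U & Phi w = u).

Definition nondeg_on (b : V -> V -> laurent k) (U : {vspace V}) : Prop :=
  forall u, u \in U -> (forall w, w \in U -> b u w = 0) -> u = 0.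

Definition isotropic (b : V -> V -> laurent k) (U : {vspace V}) : Prop :=
  forall u w, u \in U -> w \in U -> b u w = 0.

Definition Dq_iso_model (q : k) (Phi : V -> V) (U : {vspace V})
    (d s : nat) (r : int) (lam : k) : Prop :=
  exists f : 'M[laurent k]_(d, s) -> V,
    [/\ linear f, injective f,
        forall v, v \in U <-> (exists X, f X = v)
      & forall X, f (PhiModel q d s r lam X) = Phi (f X)].

Definition form_dual (b : V -> V -> laurent k) (A B : {vspace V}) : Prop :=
  forall phi : 'Hom(subvs_of A, (laurent k)^o),
    exists! w, w \in B /\ forall a : subvs_of A, b w (vsval a) = phi a.

Definition type_i (q : k) (Phi : V -> V) (b : V -> V -> laurent k)
    (U : {vspace V}) : Prop :=
  exists (d s : nat) (r : int) (lam : k) (A B : {vspace V}),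
    [/\ (0 < d)%N, (0 < s)%N, coprime `|r| s, lam != 0
      & (~ in_Eq2 q lam \/ r != 0)] /\
    [/\ (A + B)%VS = U, directv (A + B), Dq_submodule Phi A & Dq_submodule Phi B] /\
    (isotropic b A /\ isotropic b B) /\
    [/\ Dq_iso_model q Phi A d s r lam, Dq_iso_model q Phi B d s (- r) lam^-1
      & form_dual b A B].

Definition type_ii (q : k) (symp : bool) (Phi : V -> V)
    (b : V -> V -> laurent k) (U : {vspace V}) : Prop :=
  exists (d : nat) (lam : k) (A B : {vspace V}),
    [/\ (0 < d)%N, lam != 0, in_Eq2 q lam
      & (if symp then odd d else ~~ odd d)] /\
    [/\ (A + B)%VS = U, directv (A + B), Dq_submodule Phi A & Dq_submodule Phi B] /\
    (isotropic b A /\ isotropic b B) /\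
    [/\ Dq_iso_model q Phi A d 1 0 lam, Dq_iso_model q Phi B d 1 0 lam
      & form_dual b A B].

Definition type_iii (q : k) (symp : bool) (Phi : V -> V)
    (U : {vspace V}) : Prop :=
  exists (d : nat) (lam : k),
    [/\ (0 < d)%N, lam != 0, in_Eq2 q lam
      & (if symp then ~~ odd d else odd d)] /\
    Dq_iso_model q Phi U d 1 0 lam.

End Laurent.

Arguments PhiModel {k} q d s r lam X.

(* Main.v *)
(* Proof idea.  Fix (r, s, lambda) with gcd(r, s) = 1 and let N = lambda^-1 t^-r Phi^s - 1, a
   k-linear operator.  A slope argument gives, in every nonzero quotient of D_q-modules, a vector
   killed by such an N; and N decomposes every D_q-module X as X = N X + ker N^oo, so that these
   eigenvectors lift to generalized eigenvectors.  Two generalized eigenvectors, of types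
   (r, s, lambda) and (r', s', lambda'), pair to zero unless s = s', r' = -r and lambda lambda' is
   in q^(s Z); for lambda' = lambda^-1 the pairing is k-valued and invariant under
   (1 + N) x (1 + N').  Hence a longest chain w, N w, ..., N^(d-1) w has a dual chain w', N' w', ...
   with antitriangular Gram matrix; the two chains span models A and B of J_d (x) V_{r,s}(lambda)
   and of its dual.  If r <> 0 or lambda^2 is not in q^Z, they are isotropic: type (i).  Otherwise
   multiplication by a power of t identifies N' with N, and <N^(d-1) w, w'> is a symmetric or an
   alternating form on the chains according to the parity of d.  If it is symmetric, some chain is
   dual to itself: type (iii); if it is alternating, both chains can be corrected to isotropic ones:
   type (ii).  Splitting off the orthogonal complement concludes by induction. *)
Require Import Defs.
From HB Require Import structures.
From mathcomp Require Import all_boot all_order all_algebra.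
From mathcomp Require Import generic_quotient zify ring.
From Stdlib Require Import Classical ClassicalEpsilon.
Set Implicit Arguments. Unset Strict Implicit. Unset Printing Implicit Defensive.
Import Order.TTheory GRing.Theory Num.Theory.
Local Open Scope ring_scope.

(** * Laurent series and their coefficients *)

(** No classification of D_q-modules is presupposed. The main obstacle is that N is linear over k
    only, while every nonzero module is infinite-dimensional over k. So neither a Fitting
    decomposition nor a bound on the length of chains is automatic. The decomposition is checked
    along a filtration by eigenvectors, where it reduces to scalar q-difference equations; the bound
    comes from pairing a chain with a dual chain, which makes it free over k((t)). A chain of N is
    not yet a basis of the model. On J_d (x) V_{r,s}(lambda), Phi is (1 + p) (x) T with p = T - 1 on
    J_d, and so 1 + N acts as (1 + p)^s. The basis vectors are therefore obtained from w by
    polynomials in N built from an s-th root of 1 + N, followed by powers of Phi. Characteristic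
    zero enters where s has to be inverted (this root, and an average over s' iterates in the
    decomposition) and where 2 is inverted for self-dual chains. *)

Lemma strong_recursion (A : nmodType) (F : nat -> (nat -> A) -> A) :
  (forall p g h, (forall i, (i < p)%N -> g i = h i) -> F p g = F p h) ->
  exists g, forall p, g p = F p g.
Proof.
move=> HF.
(* [ap n] tabulates the first n values and is 0 beyond them; value n is computed from this table. *)
pose ap := fix ap n : nat -> A :=
  if n is m.+1 then (fun i => if i == m then F m (ap m) else ap m i)
  else (fun=> 0).
pose g n := ap n.+1 n.
have Hg m i : (i < m)%N -> ap m i = g i.
  elim: m => // m IH; rewrite ltnS leq_eqVlt /= => /orP[/eqP <-|lt].
    by rewrite eqxx /g /= eqxx.
  by rewrite (ltn_eqF lt) IH.
exists g => p; rewrite {1}/g /= eqxx; apply: HF => i lt; exact: Hg.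
Qed.

Section Coefficients.
Variable k : closedFieldType.
Implicit Types (f g : pseries k) (x y : laurent k) (c : k) (n : nat) (m z : int).
Local Notation "f %:F" := (FracField.tofrac f).

Lemma pscoefM f g n :
  pscoef (f * g) n = \sum_(i < n.+1) pscoef f i * pscoef g (n - i).
Proof. by []. Qed.

Lemma ps_constM c f n : pscoef (ps_const c * f) n = c * pscoef f n.
Proof.
rewrite pscoefM big_ord_recl /= subn0 big1 ?addr0 // => i _.
by rewrite /= mul0r.
Qed.

Lemma ps_tM f n : pscoef (ps_t k * f) n = if n is m.+1 then pscoef f m else 0.
Proof.
rewrite pscoefM; case: n => [|n].
  by rewrite big_ord_recl big_ord0 /= mul0r addr0.
rewrite big_ord_recl /= mul0r add0r big_ord_recl /= mul1r big1 ?addr0 ?subn1 //.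
by move=> i _ /=; rewrite mul0r.
Qed.

Lemma ps_tXM f j n :
  pscoef (ps_t k ^+ j * f) n = if (n < j)%N then 0 else pscoef f (n - j).
Proof.
elim: j n => [|j IH] n; first by rewrite expr0 mul1r subn0.
rewrite exprS -mulrA ps_tM; case: n => [|n] //; by rewrite IH ltnS subSS.
Qed.

Lemma ps_t_neq0 : ps_t k != 0.
Proof. by apply/eqP => /(congr1 (fun f => pscoef f 1)) /= /eqP; rewrite oner_eq0. Qed.

Lemma ps_inverse f : pscoef f 0 != 0 -> exists g, g * f = 1.
Proof.
move=> f0.
pose F p (u : nat -> k) :=
  ((p == 0%N)%:R - \sum_(i < p) u i * pscoef f (p - i)) / pscoef f 0.
have [|u Hu] := strong_recursion (F := F).
  move=> p u v H; rewrite /F; congr ((_ - _) / _).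
  by apply: eq_bigr => i _; rewrite H.
exists (PSeries u); apply: pseries_ext => n.
rewrite pscoefM big_ord_recr /= subnn Hu /F divfK //.
by rewrite addrC subrK.
Qed.

Lemma ps_factor f : f != 0 ->
  exists j g, f = ps_t k ^+ j * g /\ pscoef g 0 != 0.
Proof.
move=> /ps_neq0 H; case: (ex_minnP H) => j Hj jmin.
exists j, (PSeries (fun n => pscoef f (n + j))); split; last by rewrite /= add0n.
apply: pseries_ext => n; rewrite ps_tXM /=; case: ltnP => [lt|le]; last by rewrite subnK.
by apply/eqP; apply: contraTT lt => /jmin; rewrite -leqNgt.
Qed.

(** [sigma_q] is defined through the chosen representative of x, so this quotient is the entry point
    to all its properties. *)
Lemma frac_reprE x : x = (\n_(repr x))%:F / (\d_(repr x))%:F.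
Proof.
have H : (\d_(repr x))%:F != 0 by rewrite tofrac_eq0 denom_ratioP.
apply: (mulIf H); rewrite divfK //.
rewrite -[in X in X * _](reprK x); move: (repr x) => r.
unlock FracField.tofrac; rewrite -[LHS]FracField.pi_mul; apply/eqmodP => /=.
rewrite FracField.equivfE /FracField.mulf.
rewrite !numden_Ratio ?oner_neq0 ?mulr1 ?denom_ratioP ?mulf_neq0 ?oner_neq0 ?denom_ratioP //.
by rewrite mulrC.
Qed.

Lemma tL_neq0 : tL k != 0.
Proof. by rewrite /tL tofrac_eq0 ps_t_neq0. Qed.

(** Up to units, every nonzero power series is a power of t, so only powers of t are needed as
    denominators. *)
Lemma laurent_repr x : exists j f, x = f%:F / tL k ^+ j.
Proof.
rewrite (frac_reprE x); set a := \n_(_); set b := \d_(_).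
have [j [g [-> /ps_inverse [h Hh]]]] : exists j g, b = ps_t k ^+ j * g /\ pscoef g 0 != 0.
  by apply: ps_factor; rewrite denom_ratioP.
exists j, (a * h).
have hg : h%:F * g%:F = 1 :> laurent k by rewrite -rmorphM Hh rmorph1.
have g0 : g%:F != 0 :> laurent k.
  by apply/eqP => E; move/eqP: hg; rewrite E mulr0 eq_sym oner_eq0.
have hE : h%:F = (g%:F)^-1 :> laurent k by rewrite -[RHS]mul1r -hg mulfK.
by rewrite !rmorphM rmorphXn /= hE invfM mulrA mulrAC.
Qed.

(** Integer indices, with value 0 below 0, turn multiplication by t into a shift without boundary
    cases. *)
Definition pscoefz f m : k := if m is Posz n then pscoef f n else 0.

Lemma pscoefz_tM f m : pscoefz (ps_t k * f) m = pscoefz f (m - 1).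
Proof.
case: m => [[|n]|n]; rewrite /pscoefz ?ps_tM //.
by rewrite intS addrC addKr.
Qed.

Lemma pscoefz_tXM f j m : pscoefz (ps_t k ^+ j * f) m = pscoefz f (m - j%:Z).
Proof.
elim: j m => [|j IH] m; first by rewrite mul1r subr0.
by rewrite exprS -mulrA pscoefz_tM IH intS opprD addrA.
Qed.

Lemma pscoefzD f g m : pscoefz (f + g) m = pscoefz f m + pscoefz g m.
Proof. by case: m => n //=; rewrite addr0. Qed.

Lemma pscoefz_constM c f m : pscoefz (ps_const c * f) m = c * pscoefz f m.
Proof. by case: m => n; rewrite /pscoefz ?ps_constM ?mulr0. Qed.

Lemma pscoefz_sigma q f m :
  q != 0 -> pscoefz (ps_sigma q f) m = q ^ m * pscoefz f m.
Proof. by case: m => n //=; rewrite mulr0. Qed.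

Lemma pscoefz_ext f g : pscoefz f =1 pscoefz g -> f = g.
Proof. by move=> H; apply: pseries_ext => n; apply: (H n%:Z). Qed.

(** The presentation x = f / t^j is not unique; [lcoefE] shows that the choice does not matter. *)
Definition lcoef x m : k :=
  let P := fun jf : nat * pseries k => x = jf.2%:F / tL k ^+ jf.1 in
  let jf := epsilon (inhabits (0%N, 0)) P in
  pscoefz jf.2 (m + jf.1%:Z).

Lemma tLX_neq0 n : tL k ^+ n != 0.
Proof. by rewrite expf_neq0 ?tL_neq0. Qed.

Lemma tofrac_tX n : (ps_t k ^+ n)%:F = tL k ^+ n.
Proof. by rewrite rmorphXn. Qed.

Lemma lcoefE x j f m : x = f%:F / tL k ^+ j -> lcoef x m = pscoefz f (m + j%:Z).
Proof.
move=> E; rewrite /lcoef.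
set P := fun jf : nat * pseries k => _.
have /(epsilon_spec (inhabits (0%N, 0))) : exists jf, P jf by exists (j, f).
case: (epsilon _ _) => j' f' /=; rewrite /P E /= => /eqP.
rewrite eqr_div ?tLX_neq0 // -!tofrac_tX -!rmorphM /= tofrac_eq => /eqP Ef.
rewrite -[m + j%:Z](addrK j'%:Z) -pscoefz_tXM mulrC Ef mulrC pscoefz_tXM.
by congr pscoefz; rewrite addrAC addrK.
Qed.

Lemma lcoef_tofrac f m : lcoef f%:F m = pscoefz f m.
Proof. by rewrite (@lcoefE _ 0 f) ?addr0 // expr0 divr1. Qed.

Lemma lcoefD x y m : lcoef (x + y) m = lcoef x m + lcoef y m.
Proof.
have [j [f Ef]] := laurent_repr x; have [i [g Eg]] := laurent_repr y.
rewrite (lcoefE _ Ef) (lcoefE _ Eg).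
rewrite (@lcoefE _ (i + j) (ps_t k ^+ i * f + ps_t k ^+ j * g)).
  rewrite pscoefzD !pscoefz_tXM.
  by congr (_ + _); congr pscoefz; rewrite PoszD; ring.
rewrite Ef Eg rmorphD !rmorphM /= !tofrac_tX addf_div ?tLX_neq0 //.
by rewrite -exprD addnC; congr (_ / _); congr (_ + _); apply: mulrC.
Qed.

Lemma lcoef_ext x y : lcoef x =1 lcoef y -> x = y.
Proof.
have [j [f Ef]] := laurent_repr x; have [i [g Eg]] := laurent_repr y => H.
rewrite Ef Eg; apply/eqP; rewrite eqr_div ?tLX_neq0 //.
rewrite -!tofrac_tX -!rmorphM /= tofrac_eq; apply/eqP/pscoefz_ext => m.
rewrite ![_ * ps_t k ^+ _]mulrC !pscoefz_tXM.
have:= H (m - i%:Z - j%:Z); rewrite (lcoefE _ Ef) (lcoefE _ Eg) subrK.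
by rewrite addrAC subrK.
Qed.

Lemma lcoef_constM c x m : lcoef (constL c * x) m = c * lcoef x m.
Proof.
have [j [f Ef]] := laurent_repr x; rewrite (lcoefE _ Ef).
rewrite (@lcoefE _ j (ps_const c * f)) ?pscoefz_constM //.
by rewrite rmorphM Ef mulrA.
Qed.

Lemma lcoef_tM x m : lcoef (tL k * x) m = lcoef x (m - 1).
Proof.
have [j [f Ef]] := laurent_repr x; rewrite (lcoefE _ Ef).
rewrite (@lcoefE _ j (ps_t k * f)) ?pscoefz_tM; last by rewrite rmorphM Ef mulrA.
by congr pscoefz; rewrite addrAC.
Qed.

Lemma lcoef_tzM x z m : lcoef (tL k ^ z * x) m = lcoef x (m - z).
Proof.
have H (n : nat) y l : lcoef (tL k ^+ n * y) l = lcoef y (l - n%:Z).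
  elim: n l => [|n IH] l; first by rewrite mul1r subr0.
  by rewrite exprS -mulrA lcoef_tM IH intS opprD addrA.
case: z => n; first exact: H.
rewrite -{2}[x](@mulVKf _ (tL k ^+ n.+1)) ?tLX_neq0 // H NegzE opprK addrK.
by rewrite -exprnN.
Qed.

Lemma ps_sigmaM q f g : ps_sigma q (f * g) = ps_sigma q f * ps_sigma q g.
Proof.
apply: pseries_ext => n; rewrite pscoefM /= mulr_sumr; apply: eq_bigr => i _.
by rewrite mulrACA -exprD subnKC // -ltnS.
Qed.

Lemma ps_sigma_eq0 q f : q != 0 -> (ps_sigma q f == 0) = (f == 0).
Proof.
move=> q0; apply/eqP/eqP => [H|->]; last first.
  by apply: pseries_ext => n; rewrite /= mulr0.
apply: pseries_ext => n; have /= /eqP := congr1 (fun h => pscoef h n) H.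
by rewrite mulf_eq0 expf_eq0 (negbTE q0) andbF => /eqP.
Qed.

(** Independence of [sigma_q] from the representative: equal cross products stay equal under the
    multiplicative map [ps_sigma]. *)
Lemma sigma_frac q f g : q != 0 -> g != 0 ->
  sigma_q q (f%:F / g%:F) = (ps_sigma q f)%:F / (ps_sigma q g)%:F.
Proof.
move=> q0 g0; rewrite /sigma_q; set r := repr _.
have := frac_reprE (f%:F / g%:F); rewrite -/r => /eqP.
have d0 : \d_r != 0 by exact: denom_ratioP.
rewrite eqr_div ?tofrac_eq0 // -!rmorphM /= tofrac_eq => /eqP E.
apply/eqP; rewrite eqr_div ?tofrac_eq0 ?ps_sigma_eq0 // -!rmorphM /= tofrac_eq.
by rewrite -!ps_sigmaM E.
Qed.

Lemma ps_sigma_tX q n : ps_sigma q (ps_t k ^+ n) = ps_const (q ^+ n) * ps_t k ^+ n.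
Proof.
apply: pseries_ext => m; rewrite ps_constM /= -[ps_t k ^+ n]mulr1 ps_tXM.
case: ltnP => [_|le]; first by rewrite !mulr0.
by rewrite /= subn_eq0; case: (ltngtP m n) le => // [_|->]; rewrite ?mulr0.
Qed.

Lemma constL_is_zmod_morphism : zmod_morphism (@constL k).
Proof.
move=> a c; rewrite /constL -rmorphB; congr _%:F; apply: pseries_ext => n /=.
by case: eqP => _; rewrite ?subr0.
Qed.

Lemma constL_is_monoid_morphism : monoid_morphism (@constL k).
Proof.
split=> [|a c]; rewrite /constL.
  by rewrite -tofrac1; congr _%:F; apply: pseries_ext => n /=; case: eqP.
rewrite -rmorphM; congr _%:F; apply: pseries_ext => n; rewrite ps_constM /=.
by case: eqP => _; rewrite ?mulr0.
Qed.

HB.instance Definition _ := GRing.isZmodMorphism.Build k (laurent k) (@constL k)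
  constL_is_zmod_morphism.
HB.instance Definition _ := GRing.isMonoidMorphism.Build k (laurent k) (@constL k)
  constL_is_monoid_morphism.

Lemma lcoef_sigma q x m : q != 0 -> lcoef (sigma_q q x) m = q ^ m * lcoef x m.
Proof.
move=> q0; have [j [f Ef]] := laurent_repr x; rewrite (lcoefE _ Ef) Ef.
rewrite -tofrac_tX sigma_frac // ?expf_neq0 ?ps_t_neq0 // ps_sigma_tX.
rewrite rmorphM /= tofrac_tX -/(constL _) invfM mulrCA -fmorphV lcoef_constM.
rewrite (@lcoefE _ j (ps_sigma q f)) // pscoefz_sigma // mulrA exprnN -expfzDr //.
by rewrite addrC addrK.
Qed.

Lemma lcoef_lb x : exists z, forall m, m < z -> lcoef x m = 0.
Proof.
have [j [f Ef]] := laurent_repr x; exists (- j%:Z) => m lt.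
rewrite (lcoefE _ Ef).
by move: lt; rewrite -subr_lt0 opprK; case: (m + _).
Qed.

Lemma lcoef_mk (u : int -> k) z : (forall m, m < z -> u m = 0) ->
  exists x, lcoef x =1 u.
Proof.
move=> H; exists (tL k ^ z * (PSeries (fun n => u (n%:Z + z)))%:F) => m.
rewrite lcoef_tzM lcoef_tofrac; case E: (m - z) => [n|n] /=.
  by rewrite -E subrK.
by rewrite H // -subr_lt0 E.
Qed.
End Coefficients.

Section LaurentTheory.
Variable k : closedFieldType.
Implicit Types (f g : pseries k) (x y : laurent k) (c : k) (n : nat) (m z : int).
Local Notation "f %:F" := (FracField.tofrac f).

Lemma lcoef0 m : lcoef (0 : laurent k) m = 0.
Proof. by apply: (addrI (lcoef (0 : laurent k) m)); rewrite -lcoefD !addr0. Qed.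

Lemma lcoefN x m : lcoef (- x) m = - lcoef x m.
Proof. by apply: (addrI (lcoef x m)); rewrite -lcoefD !subrr lcoef0. Qed.

Lemma lcoefB x y m : lcoef (x - y) m = lcoef x m - lcoef y m.
Proof. by rewrite lcoefD lcoefN. Qed.

Lemma lcoef_sum I (r : seq I) (P : pred I) (F : I -> laurent k) m :
  lcoef (\sum_(i <- r | P i) F i) m = \sum_(i <- r | P i) lcoef (F i) m.
Proof. exact: (big_morph _ (fun x y => lcoefD x y m) (lcoef0 m)). Qed.

Lemma lcoef_const c m : lcoef (constL c) m = if m == 0 then c else 0.
Proof. by rewrite /constL lcoef_tofrac; case: m => [[|n]|n]. Qed.

Lemma tLz_neq0 z : tL k ^ z != 0.
Proof. by rewrite expfz_neq0 ?tL_neq0. Qed.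

Lemma constL_eq0 c : (constL c == 0) = (c == 0).
Proof. exact: fmorph_eq0. Qed.

Lemma constLM c c' : constL (c * c') = constL c * constL c'.
Proof. exact: rmorphM. Qed.

Lemma constL1 : constL (1 : k) = 1.
Proof. exact: rmorph1. Qed.

Lemma lcoef_monom c z m : lcoef (constL c * tL k ^ z) m = if m == z then c else 0.
Proof. by rewrite mulrC lcoef_tzM lcoef_const subr_eq0. Qed.

Lemma monomM c c' z z' :
  (constL c * tL k ^ z) * (constL c' * tL k ^ z') = constL (c * c') * tL k ^ (z + z').
Proof. by rewrite constLM (expfzDr _ _ (tL_neq0 k)) mulrACA. Qed.

(** The t-adic valuation of x is at least z, with infinite valuation for x = 0. *)
Definition lge x z := forall m, m < z -> lcoef x m = 0.

Lemma lge_repr x z : lge x z ->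
  x = tL k ^ z * (PSeries (fun n => lcoef x (z + n%:Z)))%:F.
Proof.
move=> H; apply: lcoef_ext => m; rewrite lcoef_tzM lcoef_tofrac.
case E: (m - z) => [n|n] /=; first by rewrite -E addrC subrK.
by rewrite H // -subr_lt0 E.
Qed.

Lemma lcoefM x y z z' n : lge x z -> lge y z' ->
  lcoef (x * y) (z + z' + n%:Z) =
  \sum_(i < n.+1) lcoef x (z + i%:Z) * lcoef y (z' + (n - i)%N%:Z).
Proof.
move=> Hx Hy; rewrite {1}(lge_repr Hx) {1}(lge_repr Hy) mulrACA.
rewrite -expfzDr ?tL_neq0 // lcoef_tzM -rmorphM lcoef_tofrac.
by rewrite addrC addKr.
Qed.

Lemma lgeM x y z z' : lge x z -> lge y z' -> lge (x * y) (z + z').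
Proof.
move=> Hx Hy m lt; rewrite {1}(lge_repr Hx) {1}(lge_repr Hy) mulrACA.
rewrite -expfzDr ?tL_neq0 // lcoef_tzM -rmorphM lcoef_tofrac.
by move: lt; rewrite -subr_lt0; case: (m - _).
Qed.

Lemma lge_ex x : exists z, lge x z.
Proof. exact: lcoef_lb. Qed.

Lemma lge_le x z z' : z' <= z -> lge x z -> lge x z'.
Proof. by move=> le H m lt; apply: H; apply: lt_le_trans lt le. Qed.

Lemma lval_ex x : x != 0 -> exists z, lge x z /\ lcoef x z != 0.
Proof.
move=> x0; have [z Hz] := lge_ex x.
have [n Hn] : exists n, lcoef x (z + n%:Z) != 0.
  apply: NNPP => H; move/eqP: x0; apply; apply: lcoef_ext => m.
  rewrite lcoef0; case: (ltP m z) => [/Hz //|le].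
  apply/eqP/negPn/negP => m0; apply: H; exists `|m - z|%N.
  by rewrite gez0_abs ?subr_ge0 // subrKC.
have : exists n, lcoef x (z + n%:Z) != 0 by exists n.
move=> /ex_minnP [i Hi imin]; exists (z + i%:Z); split=> // m lt.
case: (ltP m z) => [/Hz //|le]; apply/eqP; apply: contraTT lt => m0.
rewrite -leNgt -lerBrDl; have := imin `|m - z|%N.
rewrite gez0_abs ?subr_ge0 // subrKC => /(_ m0).
by rewrite -lez_nat gez0_abs ?subr_ge0.
Qed.

(** Meaningful only for coefficient families that vanish below some index, as in [lcoef_mkL]. *)
Definition mkL (u : int -> k) : laurent k :=
  epsilon (inhabits 0) (fun x => lcoef x =1 u).

Lemma lcoef_mkL (u : int -> k) z : (forall m, m < z -> u m = 0) -> lcoef (mkL u) =1 u.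
Proof.
by move=> H; have := epsilon_spec (inhabits 0) _ (lcoef_mk H).
Qed.

Section Sigma.
Variable q : k.
Hypothesis q_neq0 : q != 0.
Local Notation sg := (sigma_q q).

Lemma sigmaD : {morph sg : x y / x + y}.
Proof.
by move=> x y; apply: lcoef_ext => m; rewrite !(lcoefD, lcoef_sigma) // mulrDr.
Qed.

Lemma sigma0 : sg 0 = 0.
Proof. by apply: lcoef_ext => m; rewrite lcoef_sigma // lcoef0 mulr0. Qed.

Lemma sigmaM : {morph sg : x y / x * y}.
Proof.
move=> x y; have [j [f ->]] := laurent_repr x; have [i [g ->]] := laurent_repr y.
rewrite mulf_div -!tofrac_tX -!rmorphM /= !sigma_frac ?mulf_neq0 ?expf_neq0 ?ps_t_neq0 //.
by rewrite !ps_sigmaM !rmorphM mulf_div.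
Qed.

Lemma sigma_constM c x : sg (constL c * x) = constL c * sg x.
Proof.
apply: lcoef_ext => m; rewrite lcoef_sigma // !lcoef_constM lcoef_sigma //.
by rewrite mulrCA.
Qed.

Lemma sigma_const c : sg (constL c) = constL c.
Proof.
apply: lcoef_ext => m; rewrite lcoef_sigma // lcoef_const.
by case: eqP => [->|_]; rewrite ?mul1r ?mulr0.
Qed.

Lemma sigma_tz z : sg (tL k ^ z) = constL (q ^ z) * tL k ^ z.
Proof.
apply: lcoef_ext => m; rewrite lcoef_sigma // lcoef_monom.
rewrite -[tL k ^ z]mul1r -(rmorph1 (constL (k := k))) lcoef_monom.
by case: eqP => [->|_]; rewrite ?mulr1 ?mulr0.
Qed.

Lemma sigma_inj : injective sg.
Proof.
move=> x y H; apply: lcoef_ext => m; have := congr1 (fun w => lcoef w m) H.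
by rewrite !lcoef_sigma //; apply: mulfI; rewrite expfz_neq0.
Qed.

Lemma sigma_comp q' x : q' != 0 -> sg (sigma_q q' x) = sigma_q (q * q') x.
Proof.
move=> q'0; apply: lcoef_ext => m.
by rewrite !lcoef_sigma ?mulf_neq0 // mulrA expfzMl.
Qed.

Lemma iter_sigma n x : iter n sg x = sigma_q (q ^+ n) x.
Proof.
apply: lcoef_ext => m; elim: n => [|n IH].
  by rewrite lcoef_sigma ?oner_neq0 // exp1rz mul1r.
by rewrite iterS !lcoef_sigma ?expf_neq0 // IH lcoef_sigma ?expf_neq0 // mulrA exprS expfzMl.
Qed.

Lemma lge_sigma x z : lge x z -> lge (sg x) z.
Proof. by move=> H m lt; rewrite lcoef_sigma // H ?mulr0. Qed.
End Sigma.

Lemma sigmaVK q x : q != 0 -> sigma_q q (sigma_q q^-1 x) = x.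
Proof.
move=> q0; apply: lcoef_ext => m.
by rewrite !lcoef_sigma ?invr_neq0 // mulrA -expfzMl mulfV // exp1rz mul1r.
Qed.

Lemma sigma_id x : sigma_q 1 x = x.
Proof. by apply: lcoef_ext => m; rewrite lcoef_sigma ?oner_neq0 // exp1rz mul1r. Qed.

End LaurentTheory.

(** * Ramified coverings *)

Section Ramification.
Variable k : closedFieldType.
Variable s : nat.
Hypothesis s_gt0 : (0 < s)%N.
Implicit Types (x y : laurent k) (c : k) (j m z : int).

(* [ramify] is k((t)) -> k((tau)), t |-> tau^s; both fields are [laurent k]. *)
Definition ramify x : laurent k :=
  mkL (fun m => if (m %% s)%Z == 0 then lcoef x (m %/ s)%Z else 0).

(* The k((t))-linear coordinate of tau^j in k((tau)), for all integers j. *)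
Definition rproj j x : laurent k := mkL (fun m => lcoef x (j + s%:Z * m)).

Lemma lcoef_ramify x m :
  lcoef (ramify x) m = if (m %% s)%Z == 0 then lcoef x (m %/ s)%Z else 0.
Proof.
have [z Hz] := lge_ex x; rewrite (lcoef_mkL (z := z * s%:Z)) // => {}m lt.
case: eqP => // _; apply: Hz; nia.
Qed.

Lemma lcoef_rproj j x m : lcoef (rproj j x) m = lcoef x (j + s%:Z * m).
Proof.
have [z Hz] := lge_ex x; rewrite (lcoef_mkL (z := - `|z| - `|j|)) // => {}m lt.
apply: Hz; nia.
Qed.

Lemma ramifyD : {morph ramify : x y / x + y}.
Proof.
move=> x y; apply: lcoef_ext => m; rewrite lcoefD !lcoef_ramify lcoefD.
by case: eqP; rewrite ?addr0.
Qed.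

Lemma ramify_monom c z : ramify (constL c * tL k ^ z) = constL c * tL k ^ (s%:Z * z).
Proof.
apply: lcoef_ext => m; rewrite lcoef_ramify !lcoef_monom.
have s0 : s%:Z != 0 by rewrite eqz_nat -lt0n.
case: (eqVneq m (s%:Z * z)) => [->|ne].
  by rewrite mulrC modzMl eqxx mulzK // eqxx.
case: eqP => // Hm; case: eqP => // Hz; case/eqP: ne.
by rewrite (divz_eq m s) Hm addr0 Hz mulrC.
Qed.

Lemma lge_ramify x z : lge x z -> lge (ramify x) (s%:Z * z).
Proof.
move=> H m lt; rewrite lcoef_ramify; case: eqP => // Hm; apply: H; nia.
Qed.

Lemma rprojD j : {morph rproj j : x y / x + y}.
Proof. by move=> x y; apply: lcoef_ext => m; rewrite lcoefD !lcoef_rproj lcoefD. Qed.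

Lemma rproj_constM j c x : rproj j (constL c * x) = constL c * rproj j x.
Proof.
by apply: lcoef_ext => m; rewrite lcoef_constM !lcoef_rproj lcoef_constM.
Qed.

Lemma rproj_tzM j z x : rproj j (tL k ^ z * x) = rproj (j - z) x.
Proof.
by apply: lcoef_ext => m; rewrite !lcoef_rproj lcoef_tzM addrAC.
Qed.

Lemma rproj_period j z x : rproj (j - s%:Z * z) x = tL k ^ z * rproj j x.
Proof.
apply: lcoef_ext => m; rewrite lcoef_tzM !lcoef_rproj; congr lcoef.
by rewrite mulrBr addrA addrAC.
Qed.

Lemma rproj_sigma q' j x : q' != 0 ->
  rproj j (sigma_q q' x) = constL (q' ^ j) * sigma_q (q' ^+ s) (rproj j x).
Proof.
move=> q'0; apply: lcoef_ext => m; rewrite lcoef_constM lcoef_sigma ?expf_neq0 //.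
rewrite !lcoef_rproj lcoef_sigma // mulrA expfzDr //; congr (_ * _ * _).
by rewrite -exprz_exp -exprnP.
Qed.

(** Coefficient m sees only finitely many terms of a: both sides vanish there once the valuation of
    a is large, and before that the lowest monomial of a is split off, for which the claim is the
    periodicity t = tau^s. *)
Lemma rproj_ramifyM j a y : rproj j (ramify a * y) = a * rproj j y.
Proof.
apply: lcoef_ext => m; have [b Hb] := lge_ex y.
pose b' : int := - `|b| - `|j|.
have Hp : lge (rproj j y) b'.
  by move=> i lt; rewrite lcoef_rproj; apply: Hb; rewrite /b' in lt; nia.
have [l0 Hl0] := lge_ex a.
have [N HN] : exists N : nat, lge a (m + 1 - b' - N%:Z).
  by exists (absz (m + 1 - b' - l0)%R); apply: lge_le Hl0; lia.
elim: N a HN {l0 Hl0} => [|N IH] a HN.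
  rewrite lcoef_rproj (lgeM (lge_ramify HN) Hb); last by rewrite /b'; nia.
  by rewrite (lgeM HN Hp) //; lia.
pose l := m + 1 - b' - N.+1%:Z.
pose mo := constL (lcoef a l) * tL k ^ l.
have [a1 Ea] : exists a1, a = a1 + mo by exists (a - mo); rewrite subrK.
have Ha1 : lge a1 (m + 1 - b' - N%:Z).
  move=> i lt; have := congr1 (fun w => lcoef w i) Ea.
  rewrite lcoefD lcoef_monom; case: eqP => [->|ne].
    by move=> /eqP; rewrite -subr_eq subrr => /eqP <-.
  by rewrite addr0 => <-; apply: HN; rewrite /l in ne; lia.
rewrite Ea ramifyD (mulrDl (ramify a1)) (mulrDl a1) rprojD 2!lcoefD (IH _ Ha1).
congr (_ + _); rewrite /mo ramify_monom -2!mulrA rproj_constM rproj_tzM.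
by rewrite 2!lcoef_constM rproj_period.
Qed.

End Ramification.

(** * Scalar q-difference equations *)

(** As n > 0, the operator y |-> c t^n sigma_Q y raises valuations, so each coefficient of y is
    determined by lower ones. *)
Lemma scalar_solve_pos (k : closedFieldType) (Q c : k) (n : nat) (x : laurent k) :
  Q != 0 -> c != 0 -> (0 < n)%N ->
  exists y, constL c * tL k ^ n * sigma_q Q y - y = x.
Proof.
move=> Q0 c0 n0; have [z Hz] := lge_ex x.
pose F p (u : nat -> k) :=
  (if (p < n)%N then 0 else c * (Q ^ (z + (p - n)%N%:Z) * u (p - n)%N)) - lcoef x (z + p%:Z).
have [|u Hu] := strong_recursion (F := F).
  move=> p u v H; rewrite /F; case: ltnP => // le; rewrite H //; lia.
pose U m := if m - z is Posz p then u p else 0.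
have HU m : m < z -> U m = 0 by rewrite -subr_lt0 /U; case: (m - z).
exists (mkL U); apply: lcoef_ext => m.
rewrite lcoefB -mulrA lcoef_constM lcoef_tzM (lcoef_sigma _ _ Q0) !(lcoef_mkL HU).
case: (ltP m z) => [lt|le].
  by rewrite !HU ?(Hz m) //; [rewrite !mulr0 subr0|lia].
have [p Ep] : exists p : nat, m = z + p%:Z by exists `|m - z|%N; lia.
have UE (j : nat) : U (z + j%:Z) = u j by rewrite /U addrC addKr.
rewrite Ep UE Hu /F; case: ltnP => lt.
  by rewrite HU ?mulr0; [rewrite sub0r add0r opprK|lia].
have -> : z + p%:Z - n%:Z = z + (p - n)%N%:Z by lia.
by rewrite UE opprB addrC subrK.
Qed.

Section ScalarEquations.
Variable k : closedFieldType.
Variable Q : k.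
Hypotheses (Q_neq0 : Q != 0) (Q_nroot : forall n : nat, (0 < n)%N -> Q ^+ n != 1).
Implicit Types (x y : laurent k) (c : k) (m z : int).

Lemma expfz_eq1 m : (Q ^ m == 1) = (m == 0).
Proof.
apply/idP/idP => [|/eqP ->]; last by rewrite expr0z.
case: m => [[|n]|n] //; first by move=> H; have := @Q_nroot n.+1 isT; rewrite (H : Q ^+ n.+1 == 1).
by rewrite NegzE -exprnN invr_eq1 => H; have := @Q_nroot n.+1 isT; rewrite H.
Qed.

Lemma expfz_inj m z : Q ^ m = Q ^ z -> m = z.
Proof.
move=> E; apply/eqP; rewrite -subr_eq0 -expfz_eq1 expfzDr // E -expfzDr //.
by rewrite subrr expr0z.
Qed.

Lemma nroot_exp s : (0 < s)%N -> forall n : nat, (0 < n)%N -> (Q ^+ s) ^+ n != 1.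
Proof. by move=> s0 n n0; rewrite -exprM Q_nroot // muln_gt0 s0. Qed.

(** Compare lowest terms: sigma_Q preserves the valuation and t^m shifts it by m; for m = 0 the
    lowest coefficient, in degree j, is multiplied by c Q^j. *)
Lemma scalar_fixed (c : k) m y : y != 0 -> c != 0 ->
  y = constL c * tL k ^ m * sigma_q Q y -> m = 0 /\ exists j : int, c * Q ^ j = 1.
Proof.
move=> y0 c0 E; have [z [Hz yz]] := lval_ex y0.
have H j : lcoef y j = c * (Q ^ (j - m) * lcoef y (j - m)).
  by rewrite {1}E -mulrA lcoef_constM lcoef_tzM lcoef_sigma.
have m0 : m = 0.
  have [lt|gt|//] := ltgtP m 0.
    move: (H (z + m)); rewrite addrK Hz ?gtrDl // => /esym/eqP.
    by rewrite !mulf_eq0 (negbTE c0) (negbTE yz) expfz_eq0 (negbTE Q_neq0) andbF.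
  move: (H z); rewrite [X in _ * (_ * X)]Hz ?gtrBl // !mulr0 => /eqP.
  by rewrite (negbTE yz).
split=> //; exists z; move: (H z); rewrite m0 subr0 mulrA => /eqP.
by rewrite -{1}[lcoef y z]mul1r -subr_eq0 -mulrBl mulf_eq0 (negbTE yz) orbF subr_eq0 => /eqP <-.
Qed.

(** The rank-one case of the decomposition under N. For m = 0 the operator is diagonal on
    coefficients, and g collects those on which its eigenvalue c Q^j is 1. For m different from 0
    the equation is solvable with g = 0, for m < 0 by passing to the inverse operator. *)
Lemma scalar_split (c : k) m x : c != 0 -> exists y g,
  x = (constL c * tL k ^ m * sigma_q Q y - y) + g /\
  constL c * tL k ^ m * sigma_q Q g = g.
Proof.
move=> c0; case: (ltgtP m 0) => [lt|gt|->]; last first.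
- have [z Hz] := lge_ex x.
  pose U (j : int) := lcoef x j / (c * Q ^ j - 1).
  have HU j : j < z -> U j = 0 by move=> lt; rewrite /U Hz // mul0r.
  pose G (j : int) := if c * Q ^ j == 1 then lcoef x j else 0.
  have HG j : j < z -> G j = 0 by move=> lt; rewrite /G Hz // if_same.
  exists (mkL U), (mkL G); rewrite mulr1; split; apply: lcoef_ext => j.
    rewrite lcoefD lcoefB lcoef_constM lcoef_sigma // (lcoef_mkL HU) (lcoef_mkL HG).
    rewrite mulrA -[X in _ - X + _]mul1r -mulrBl /U /G; case: eqP => [->|/eqP ne].
      by rewrite subrr mul0r add0r.
    by rewrite addr0 mulrC divfK // subr_eq0.
  rewrite lcoef_constM lcoef_sigma // (lcoef_mkL HG) mulrA /G.
  by case: eqP => [->|_]; rewrite ?mul1r ?mulr0.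
- have [n En] : exists n : nat, m = n%:Z by exists `|m|%N; lia.
  have n0 : (0 < n)%N by lia.
  have [y Hy] := scalar_solve_pos x Q_neq0 c0 n0.
  by exists y, 0; rewrite En Hy addr0 sigma0 // mulr0.
have [n En] : exists n : nat, m = - n%:Z by exists `|m|%N; lia.
have n0 : (0 < n)%N by lia.
(* The inverse of L = c t^(-n) sigma_Q is c' t^n sigma_(1/Q). If L^-1 w - w = -x, then y = L^-1 w
   satisfies L y - y = x. *)
pose c' := (c * Q ^ n%:Z)^-1.
have c'0 : c' != 0 by rewrite invr_neq0 // mulf_neq0 ?expfz_neq0.
have [w Hw] := scalar_solve_pos (- x) (invr_neq0 Q_neq0) c'0 n0.
exists (constL c' * tL k ^ n * sigma_q Q^-1 w), 0; split; last first.
  by rewrite sigma0 // mulr0.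
rewrite addr0 -[x]opprK -Hw opprB; congr (_ - _).
apply: lcoef_ext => j; rewrite En -mulrA lcoef_constM lcoef_tzM lcoef_sigma //.
rewrite -mulrA lcoef_constM lcoef_tzM lcoef_sigma ?invr_neq0 // opprK addrK.
rewrite exprz_inv expfzDr // /c' invfM; move: (lcoef w j) => wj.
have Qj : Q ^ j != 0 by rewrite expfz_neq0.
have Qn : Q ^ n != 0 by rewrite expfz_neq0.
rewrite -invr_expz. field; by rewrite c0 Qj Qn.
Qed.

End ScalarEquations.

Section ScalarEquation.
Variable k : closedFieldType.
Variable Q : k.
Hypotheses (Q_neq0 : Q != 0) (Q_nroot : forall n : nat, (0 < n)%N -> Q ^+ n != 1).

(** The points y0 Q^p are pairwise distinct because Q is not a root of unity, so only finitely many
    of them are roots, and a last one exists. *)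
Lemma last_root (P : {poly k}) : (1 < size P)%N -> P.[0] != 0 ->
  exists y, [/\ y != 0, P.[y] = 0 & forall p, (0 < p)%N -> P.[y * Q ^+ p] != 0].
Proof.
move=> sP P0; have /closed_rootP[y0 ry] : size P != 1%N by rewrite gtn_eqF.
have y00 : y0 != 0 by apply: contraNneq P0 => y00; move: ry; rewrite y00.
have Pn0 : P != 0 by rewrite -size_poly_gt0 ltnW.
have [rs HP] := closed_field_poly_normal P.
have rootE y : (P.[y] == 0) = (y \in rs).
  by rewrite -/(root P y) HP rootZ ?lead_coef_eq0 // root_prod_XsubC.
(* [ex] recovers p from the root y0 Q^p, which bounds p by a maximum over the list of roots. *)
pose ex r := epsilon (inhabits 0%N) (fun p => y0 * Q ^+ p = r).
have Hb p : P.[y0 * Q ^+ p] == 0 -> (p <= \max_(r <- rs) ex r)%N.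
  rewrite rootE => H; have <- : ex (y0 * Q ^+ p) = p.
    have := epsilon_spec (inhabits 0%N) (fun p' => y0 * Q ^+ p' = y0 * Q ^+ p).
    rewrite -/(ex _) => /(_ (ex_intro _ p erefl)) /(mulfI y00).
    move=> E; apply/eqP; rewrite -eqz_nat; apply/eqP.
    exact: (expfz_inj Q_neq0 Q_nroot).
  exact: (@leq_bigmax_seq _ _ xpredT).
have Hex : exists p, P.[y0 * Q ^+ p] == 0 by exists 0%N; rewrite mulr1.
case: (ex_maxnP Hex Hb) => p /eqP Hp pmax; exists (y0 * Q ^+ p); split=> //.
  by rewrite mulf_neq0 // expf_neq0.
move=> i i0; apply/negP; rewrite -mulrA -exprD => /pmax; lia.
Qed.

(* Let P(X) = 1 - sum_i D_i(0) X^(n-i).  The coefficient of t^p of the equation reads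
   [P(y Q^p) g_p = S_p(g_0, ..., g_(p-1))]: it is solvable recursively when y is the last root of P among the y Q^p. *)
Lemma scalar_equation (n : nat) (D : nat -> laurent k) :
  (forall i, (i < n)%N -> lge (D i) 0) ->
  (exists2 i, (i < n)%N & lcoef (D i) 0 != 0) ->
  exists (y : k) (g : laurent k), [/\ y != 0, g != 0 &
    g = \sum_(i < n) constL (y ^+ (n - i)) * D i * sigma_q (Q ^+ (n - i)) g].
Proof.
move=> HD [i0 i0n Di0].
pose P : {poly k} := 1 - \sum_(i < n) lcoef (D i) 0 *: 'X^(n - i).
have PE y : P.[y] = 1 - \sum_(i < n) lcoef (D i) 0 * y ^+ (n - i).
  rewrite /P hornerD hornerN hornerC horner_sum; congr (_ - _).
  by apply: eq_bigr => i _; rewrite hornerZ hornerXn.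
have P0 : P.[0] != 0.
  rewrite PE big1 ?subr0 ?oner_neq0 // => i _.
  by rewrite expr0n subn_eq0 leqNgt ltn_ord mulr0.
have sP : (1 < size P)%N.
  rewrite ltnNge; apply/negP => /leq_sizeP/(_ (n - i0)%N); rewrite subn_gt0 => /(_ i0n).
  rewrite /P coefB coef1 coef_sum (bigD1 (Ordinal i0n)) //= big1 => [|i ne].
    rewrite coefZ coefXn eqxx mulr1 addr0 subn_eq0 leqNgt i0n sub0r => /eqP.
    by rewrite oppr_eq0 (negbTE Di0).
  rewrite coefZ coefXn; case: eqP => [E|]; rewrite ?mulr0 //.
  case/eqP: ne; apply: val_inj => /=; have := ltn_ord i; lia.
have [y [y0 Py Pp]] := last_root sP P0.
pose S p (u : nat -> k) := \sum_(i < n) y ^+ (n - i) *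
  \sum_(j < p) lcoef (D i) j.+1%:Z * ((Q ^+ (n - i)) ^+ (p - j.+1) * u (p - j.+1)%N).
(* For p = 0 the equation reads P(y) g_0 = 0, so g_0 is free; the value 1 makes g nonzero. *)
pose F p (u : nat -> k) := if p == 0%N then 1 else S p u / P.[y * Q ^+ p].
have [|u Hu] := strong_recursion (F := F).
  move=> p v w H; rewrite /F; case: eqP => // p0; congr (_ / _).
  apply: eq_bigr => i _; congr (_ * _); apply: eq_bigr => j _.
  by rewrite H //; have := ltn_ord j; lia.
pose U (m : int) := if m is Posz p then u p else 0.
have HU m : m < 0 -> U m = 0 by case: m.
have Hg : lge (mkL U) 0 by move=> m lt; rewrite (lcoef_mkL HU) HU.
exists y, (mkL U); split=> //.
  apply/eqP => /(congr1 (fun x => lcoef x 0)).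
  rewrite (lcoef_mkL HU) lcoef0 /= Hu /F /= => /eqP; by rewrite oner_eq0.
have Q0 i : Q ^+ i != 0 by rewrite expf_neq0.
apply: lcoef_ext => m; rewrite (lcoef_mkL HU) lcoef_sum.
case: m => [p|p]; last first.
  rewrite big1 // => i _; rewrite -mulrA lcoef_constM.
  by rewrite (lgeM (HD _ (ltn_ord i)) (lge_sigma (Q0 _) Hg)) ?mulr0.
have E (i : 'I_n) : lcoef (constL (y ^+ (n - i)) * D i * sigma_q (Q ^+ (n - i)) (mkL U)) p
   = lcoef (D i) 0 * (y * Q ^+ p) ^+ (n - i) * u p + y ^+ (n - i) *
  \sum_(j < p) lcoef (D i) j.+1%:Z * ((Q ^+ (n - i)) ^+ (p - j.+1) * u (p - j.+1)%N).
  rewrite -mulrA lcoef_constM.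
  have := lcoefM p (HD _ (ltn_ord i)) (lge_sigma (Q0 (n - i)%N) Hg).
  rewrite !add0r => ->; rewrite big_ord_recl mulrDr; congr (_ + _).
    rewrite lcoef_sigma // (lcoef_mkL HU) !add0r subn0 /=.
    by rewrite exprMn -exprnP -!exprM mulnC; ring.
  congr (_ * _); apply: eq_bigr => j _.
  by rewrite lcoef_sigma // (lcoef_mkL HU) !add0r.
rewrite (eq_bigr _ (fun i _ => E i)) big_split /= -mulr_suml -/(S p u).
have -> : \sum_(i < n) lcoef (D i) 0 * (y * Q ^+ p) ^+ (n - i) = 1 - P.[y * Q ^+ p].
  by rewrite PE opprB addrC subrK.
case: (posnP p) => [->|p0].
  rewrite mulr1 Py subr0 mul1r /S big1 ?addr0 // => i _.
  by rewrite big_ord0 mulr0.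
have -> : S p u = u p * P.[y * Q ^+ p] by rewrite Hu /F gtn_eqF // divfK // Pp.
by rewrite mulrBl mul1r [P.[_] * _]mulrC subrK.
Qed.

End ScalarEquation.

(** * Semilinear maps *)

Section Semilinear.
Variables (k : closedFieldType) (V : vectType (laurent k)).
Implicit Types (u v w : V) (e lam : k) (a c : laurent k) (f : V -> V).

Definition semilin e f :=
  (forall u v, f (u + v) = f u + f v) /\
  (forall a v, f (a *: v) = sigma_q e a *: f v).

Section Basics.
Variables (e : k) (f : V -> V).
Hypotheses (e0 : e != 0) (Hf : semilin e f).

Lemma semilinD u v : f (u + v) = f u + f v. Proof. exact: Hf.1. Qed.
Lemma semilinZ a v : f (a *: v) = sigma_q e a *: f v. Proof. exact: Hf.2. Qed.
Lemma semilin0 : f 0 = 0.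
Proof. by apply: (addrI (f 0)); rewrite -semilinD !addr0. Qed.
Lemma semilinN u : f (- u) = - f u.
Proof. by apply: (addrI (f u)); rewrite -semilinD !subrr semilin0. Qed.
Lemma semilinB u v : f (u - v) = f u - f v.
Proof. by rewrite semilinD semilinN. Qed.
Lemma semilin_sum I (r : seq I) (P : pred I) (F : I -> V) :
  f (\sum_(i <- r | P i) F i) = \sum_(i <- r | P i) f (F i).
Proof. exact: (big_morph _ semilinD semilin0). Qed.
Lemma semilin_const lam v : f (constL lam *: v) = constL lam *: f v.
Proof. by rewrite semilinZ sigma_const. Qed.

Lemma semilin_iter n : semilin (e ^+ n) (iter n f).
Proof.
elim: n => [|n [ID IZ]]; first by split=> // a v; rewrite sigma_id.
split=> [u v|a v]; first by rewrite /= ID semilinD.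
by rewrite /= IZ semilinZ sigma_comp ?expf_neq0 // exprS.
Qed.

Lemma semilin_scale c : semilin e (fun v => c *: f v).
Proof.
by split=> [u v|a v]; rewrite ?semilinD ?scalerDr // semilinZ !scalerA mulrC.
Qed.
End Basics.

Lemma free_semilin e f n (X : n.-tuple V) : e != 0 -> semilin e f -> injective f ->
  free X -> free (map f X).
Proof.
move=> e0 Hf finj /freeP freeX; rewrite -[map f X]/(tval (map_tuple f X)).
apply/freeP => c Hc i; pose c' j := sigma_q e^-1 (c j).
have Hc' j : sigma_q e (c' j) = c j by rewrite sigmaVK.
rewrite -Hc' (freeX c') ?sigma0 //; apply: finj.
rewrite (semilin0 Hf) -[RHS]Hc (semilin_sum Hf); apply: eq_bigr => j _.
by rewrite (semilinZ Hf) Hc' (nth_map 0) // size_tuple.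
Qed.

(** An injective semilinear map sends a basis of U to a free family of the same length in U, hence
    to a basis. *)
Lemma semilin_surj_on e f (U : {vspace V}) : e != 0 -> semilin e f -> injective f ->
  (forall u, u \in U -> f u \in U) -> forall u, u \in U -> exists2 w, w \in U & f w = u.
Proof.
move=> e0 Hf finj HU u Uu; pose X := map_tuple f (vbasis U).
have bX : basis_of U X.
  rewrite basisEfree (free_semilin e0 Hf finj (basis_free (vbasisP U))) size_tuple.
  rewrite leqnn andbT; apply/span_subvP => _ /mapP[w Hw ->].
  exact/HU/vbasis_mem.
exists (\sum_i sigma_q e^-1 (coord X i u) *: (vbasis U)`_i).
  by apply: memv_suml => i _; apply/memvZ/vbasis_mem/mem_nth; rewrite size_tuple.
rewrite [RHS](coord_basis bX Uu) (semilin_sum Hf); apply: eq_bigr => i _.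
by rewrite (semilinZ Hf) sigmaVK // (nth_map 0) // size_tuple.
Qed.

Lemma iter_mem (T : {vspace V}) f n u :
  (forall w, w \in T -> f w \in T) -> u \in T -> iter n f u \in T.
Proof. by move=> H Tu; elim: n => //= n; apply: H. Qed.

End Semilinear.

(** * Eigenvectors of quotient modules *)

Section CyclicQuotient.
Variables (k : closedFieldType) (q : k) (V : vectType (laurent k)) (Phi : V -> V).
Hypotheses (q_neq0 : q != 0) (Phi_lin : semilin q Phi) (Phi_inj : injective Phi).
Implicit Types (u v w : V) (X : {vspace V}).

Definition stable X := forall u, u \in X -> Phi u \in X.

Lemma stable_back X u : stable X -> Phi u \in X -> u \in X.
Proof.
by move=> sX /(semilin_surj_on q_neq0 Phi_lin Phi_inj sX)[w Xw /Phi_inj <-].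
Qed.

Lemma memv_add_lines (X : {vspace V}) n (x : nat -> V) z :
  z \in (X + \sum_(i < n) <[x i]>)%VS ->
  exists c : nat -> laurent k, z - \sum_(i < n) c i *: x i \in X.
Proof.
case/memv_addP => y Xy [_ /memv_sumP[w Hw ->] ->].
have Hc (i : 'I_n) : exists c, w i = c *: x i by apply/vlineP/Hw.
pose c (i : nat) := if insub i is Some j then epsilon (inhabits 0) (fun c => w j = c *: x j) else 0.
exists c; rewrite (eq_bigr (fun i : 'I_n => c i *: x i)) ?addrK // => i _.
by rewrite /c valK; apply: (epsilon_spec (inhabits 0) _ (Hc i)).
Qed.

(** The first Phi^(n+1) v that depends on its predecessors modulo X. The a_i cannot all vanish: Phi
    is onto X, so Phi^(n+1) v in X would already put Phi^n v in X, against minimality. *)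
Lemma cyclic_relation (X : {vspace V}) v : stable X -> v \notin X ->
  exists (n : nat) (a : nat -> laurent k), [/\
    iter n.+1 Phi v - \sum_(i < n.+1) a i *: iter i Phi v \in X,
    forall c : nat -> laurent k, \sum_(i < n.+1) c i *: iter i Phi v \in X ->
      forall i, (i <= n)%N -> c i = 0
    & exists2 i, (i <= n)%N & a i != 0].
Proof.
move=> sX Xv.
pose S n := (X + \sum_(i < n) <[iter i Phi v]>)%VS.
have SS n : S n.+1 = (S n + <[iter n Phi v]>)%VS by rewrite /S big_ord_recr addvA.
have [N HN] : exists n, iter n Phi v \in S n.
  apply: NNPP => H.
  have dimS n : (n <= \dim (S n))%N.
    elim: n => // n IH; rewrite ltnNge; apply/negP => le; apply: H; exists n.
    rewrite memvE; have /eqP -> : S n == S n.+1; last by rewrite SS addvSr.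
    by rewrite eqEdim SS addvSl /= -SS (leq_trans le).
  by have := leq_trans (dimS (\dim {:V}).+1) (dimvS (subvf _)); rewrite ltnn.
have : exists n, iter n Phi v \in S n by exists N.
move=> /ex_minnP [[|n] Hn nmin].
  by move: Hn; rewrite /S big_ord0 addv0 (negbTE Xv).
have notin i : (i <= n)%N -> iter i Phi v \notin S i.
  by move=> le; apply/negP => /nmin; rewrite ltnNge le.
have [a Ha] := memv_add_lines Hn; exists n, a; split=> //.
  move=> c Hc i le; suff H j : (j <= n.+1)%N ->
      \sum_(i < j) c i *: iter i Phi v \in X -> forall i, (i < j)%N -> c i = 0.
    exact: (H n.+1).
  elim: j => // j IH ltj; rewrite big_ord_recr /= => Hj.
  have cj : c j = 0.
    apply/eqP/negPn/negP => cj; move/negP: (notin j ltj); apply.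
    rewrite -[iter j Phi v](scalerK cj) memvZ // -memvN.
    have -> : - (c j *: iter j Phi v) = - (\sum_(i < j) c i *: iter i Phi v + c j *: iter j Phi v)
        + \sum_(i < j) c i *: iter i Phi v by rewrite opprD addrAC addNr add0r.
    rewrite /S memv_add ?memvN //; apply: memv_suml => l _.
    by rewrite memvZ // memvE (sumv_sup l).
  move: Hj; rewrite cj scale0r addr0 => /(IH (ltnW ltj)) {}IH l.
  by rewrite ltnS leq_eqVlt => /orP[/eqP ->|/IH].
apply: NNPP => H; suff : iter n Phi v \in S n by rewrite (negbTE (notin n _)).
rewrite (subvP (addvSl _ _)) // (stable_back sX) //.
move: Ha; rewrite big1 ?subr0 // => i _.
have [->|ai] := eqVneq (a i) 0; first by rewrite scale0r.
by case: H; exists (nat_of_ord i); [rewrite -ltnS ltn_ord|].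
Qed.

End CyclicQuotient.

Section Slope.
Variable k : closedFieldType.

(** r/s is the least slope val(a_i)/(n - i) of the Newton polygon of T^n - sum_i a_i T^i, in lowest
    terms; the inequality and the case of equality are stated with denominators cleared. *)
Lemma least_slope (n : nat) (a : nat -> laurent k) :
  (exists2 i, (i < n)%N & a i != 0) ->
  exists (r : int) (s : nat), [/\ (0 < s)%N, coprime `|r| s,
    forall i, (i < n)%N -> forall m, m * s%:Z < r * (n - i)%N%:Z -> lcoef (a i) m = 0
    & exists i m, [/\ (i < n)%N, m * s%:Z = r * (n - i)%N%:Z & lcoef (a i) m != 0]].
Proof.
move=> [i0 i0n ai0].
pose vv i := epsilon (inhabits 0) (fun z => lge (a i) z /\ lcoef (a i) z != 0).
have vvP i : a i != 0 -> lge (a i) (vv i) /\ lcoef (a i) (vv i) != 0.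
  by move=> /lval_ex; apply: epsilon_spec.
pose sl (i : 'I_n) : rat := (vv i)%:~R / (n - i)%N%:R.
have [j aj jmin] : exists2 j : 'I_n, a j != 0 & forall i : 'I_n, a i != 0 -> sl j <= sl i.
  have ai0' : a (Ordinal i0n) != 0 by [].
  by case: (@arg_minP _ _ _ (Ordinal i0n) (fun i => a i != 0) sl ai0') => j aj H; exists j.
have pos (i : 'I_n) : 0 < (n - i)%N%:R :> rat by rewrite ltr0n subn_gt0.
have sl_eq : (vv j)%:~R * (denq (sl j))%:~R = (numq (sl j))%:~R * (n - j)%N%:R :> rat.
  rewrite [X in X * _ = _](_ : _ = sl j * (n - j)%N%:R); last by rewrite divfK // gt_eqF.
  by rewrite numqE mulrAC.
have den : (`|denq (sl j)|%N)%:Z = denq (sl j) by rewrite absz_denq.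
exists (numq (sl j)), `|denq (sl j)|%N; split.
- by rewrite absz_gt0 denq_neq0.
- exact: coprime_num_den.
- move=> i ltin m; rewrite den => lt.
  have [->|ai] := eqVneq (a i) 0; first exact: lcoef0.
  apply: (vvP i ai).1; rewrite ltNge; apply/negP => le.
  have := jmin (Ordinal ltin) ai; rewrite -(divq_num_den (sl j)) /sl /=.
  rewrite ler_pdivlMr ?(pos (Ordinal ltin)) // mulrAC.
  rewrite ler_pdivrMr ?ltr0z ?denq_gt0 //.
  rewrite [(n - i)%N%:R]pmulrn -!intrM ler_int leNgt => /negP; apply.
  apply: le_lt_trans lt; rewrite ler_pM2r //; exact: denq_gt0.
exists (nat_of_ord j), (vv j); rewrite den; split=> //; last exact: (vvP j aj).2.
by apply: (@intr_inj rat); rewrite !intrM sl_eq.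
Qed.

End Slope.

Section Eigenvector.
Variables (k : closedFieldType) (q : k) (V : vectType (laurent k)) (Phi : V -> V).
Hypotheses (q_neq0 : q != 0) (q_nroot : forall n : nat, (0 < n)%N -> q ^+ n != 1).
Hypotheses (Phi_lin : semilin q Phi) (Phi_inj : injective Phi).
Implicit Types (u v w : V) (X : {vspace V}) (r : int) (s : nat) (lam : k).

(* [Nhat] fixes the class of 1 in V_{r,s}(lam); the chains of [Nop] over it give J_d (x) V_{r,s}(lam). *)
Definition Nhat r s lam v := (constL lam^-1 * tL k ^ (- r)) *: iter s Phi v.
Definition Nop r s lam v := Nhat r s lam v - v.

(* Write [Phi^n v = sum_(i < n) a_i Phi^i v] mod X' and let r/s be the least val(a_i)/(n - i).
   Over k((tau)), tau^s = t, the equation [Phi w = y^-1 tau^r w] for [w = sum_i g_i Phi^i v] reduces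
   to a scalar equation for the last coordinate [gam]; the coordinates of w along the powers of tau
   are then eigenvectors of t^-r Phi^s over k((t)). *)
Lemma quotient_eigenvector (X' X : {vspace V}) :
  stable Phi X' -> stable Phi X -> (X' <= X)%VS -> X' != X ->
  exists r s lam v, [/\ (0 < s)%N, coprime `|r| s & lam != 0] /\
    [/\ v \in X, v \notin X' & Nop r s lam v \in X'].
Proof.
move=> sX' sX leX neX.
have [v Xv X'v] : exists2 v, v \in X & v \notin X'.
  apply: NNPP => H; case/eqP: neX; apply/eqP; rewrite eqEsubv leX /=.
  by apply/subvP => v Xv; apply/negPn/negP => X'v; apply: H; exists v.
have [n' [a [Ha Hind [ie ie1 ie2]]]] := cyclic_relation q_neq0 Phi_lin Phi_inj sX' X'v.
pose n := n'.+1.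
have [|r [s [s0 cop slope [i0 [m0 [i0n m0E m0N]]]]]] := @least_slope k n a.
  by exists ie; rewrite ?ltnS.
(* [sigma_q] extends to k((tau)) by tau |-> q' tau. *)
have [q' q's] : exists q', q' ^+ s = q.
  have /closed_rootP[q' Hq'] : size ('X^s - q%:P : {poly k}) != 1%N.
    by rewrite size_XnsubC // eqSS -lt0n.
  by exists q'; move: Hq'; rewrite rootE !hornerE subr_eq0 => /eqP.
have q'0 : q' != 0 by apply: contraNneq q_neq0 => E; rewrite -q's E expr0n gtn_eqF.
have q'n i : (0 < i)%N -> q' ^+ i != 1.
  move=> i0'; apply: contra (q_nroot i0') => /eqP E.
  by rewrite -q's -exprM mulnC exprM E expr1n.
pose sg' := sigma_q q'.
pose T (x : laurent k) := tL k ^ (- r) * sg' x.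
have TM i x y : iter i T (x * y) = iter i T x * iter i sg' y.
  elim: i => // i IH; rewrite !iterS IH /T /sg' sigmaM //; exact: mulrA.
have TD i x y : iter i T (x + y) = iter i T x + iter i T y.
  by elim: i => // i IH; rewrite !iterS IH /T /sg' sigmaD // mulrDr.
have Tlge i x z : lge x z -> lge (iter i T x) (z - r * i%:Z) /\
    (lcoef x z != 0 -> lcoef (iter i T x) (z - r * i%:Z) != 0).
  move=> Hx; elim: i => [|i [IH1 IH2]]; first by rewrite mulr0 subr0.
  have E m : lcoef (iter i.+1 T x) m = q' ^ (m + r) * lcoef (iter i T x) (m + r).
    by rewrite iterS /T lcoef_tzM opprK lcoef_sigma.
  have Ez : z - r * i.+1%:Z + r = z - r * i%:Z by rewrite intS mulrDr mulr1; ring.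
  split=> [m lt|x0]; rewrite E.
    by rewrite IH1 ?mulr0 // -Ez ltrD2r.
  by rewrite Ez mulf_neq0 ?IH2 // expfz_neq0.
pose al i := ramify s (a i).
have al_lge i : (i < n)%N -> lge (al i) (r * (n - i)%N%:Z).
  move=> lt m ltm; rewrite lcoef_ramify //; case: eqP => // Hm.
  by apply: slope lt _ _; rewrite [(_ * s%:Z)](_ : _ = m) // {2}(divz_eq m s) Hm addr0.
(* The coefficients are normalized to slope 0: the valuation of [al i] is at least r (n - i), and
   tau^(-r) and the n' - i applications of T each take off r. At i0 nothing is left over. *)
pose D i := iter (n' - i) T (tL k ^ (- r) * al i).
have lge_tz z x y : lge x z -> lge (tL k ^ y * x) (z + y).
  by move=> Hx m lt; rewrite lcoef_tzM Hx //; rewrite ltrBlDr.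
have Dz i : (i < n)%N -> r * (n - i)%N%:Z - r - r * (n' - i)%N%:Z = 0.
  by move=> lt; rewrite [(n - i)%N]subSn // intS; ring.
have D_lge i : (i < n)%N -> lge (D i) 0.
  move=> lt; rewrite -(Dz i lt); apply: (Tlge _ _ _ _).1.
  exact/lge_tz/al_lge.
have D_lead : exists2 i, (i < n)%N & lcoef (D i) 0 != 0.
  exists i0 => //; rewrite -(Dz i0 i0n); apply: (Tlge _ _ _ _).2.
    exact/lge_tz/al_lge.
  rewrite lcoef_tzM opprK subrK lcoef_ramify // -m0E modzMl eqxx mulzK //.
  by rewrite eqz_nat -lt0n.
have [y [gam [y0 gam0 Egam]]] := scalar_equation q'0 q'n D_lge D_lead.
pose f i := tL k ^ (- r) * al i * sg' gam.
(* In Phi w = y^-1 tau^r w the coefficient of Phi^i v gives g_i = y tau^(-r) (sigma' g_(i-1) + al_i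
   sigma' gam). The recursion is consistent when its last value is gam, which is the scalar equation
   just solved. *)
pose g := fix g i := if i is j.+1 then constL y * (T (g j) + f j.+1) else constL y * f 0%N.
have T_const i c x : iter i T (constL c * x) = constL c * iter i T x.
  by elim: i => // i IH; rewrite !iterS IH /T /sg' sigma_constM // mulrCA.
have gE i : g i = \sum_(j < i.+1) constL (y ^+ (i.+1 - j)) * iter (i - j) T (f j).
  elim: i => [|i IH]; first by rewrite big_ord_recl big_ord0 addr0 expr1.
  rewrite big_ord_recr /= subSnn subnn expr1 mulrDr IH; congr (_ + _).
  have -> x : T x = iter 1 T x by [].
  rewrite (big_morph _ (TD 1%N) (_ : iter 1 T 0 = 0)); last by rewrite /= /T /sg' sigma0 // mulr0.
  rewrite mulr_sumr; apply: eq_bigr => j _.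
  have lej : (j <= i)%N by rewrite -ltnS.
  by rewrite T_const -iterD mulrA -rmorphM -exprS !subSn // leqW.
have gn : g n' = gam.
  rewrite gE [RHS]Egam; apply: eq_bigr => j _.
  have lej : (j <= n')%N by rewrite -ltnS.
  rewrite TM -mulrA; congr (_ * (_ * _)).
  by rewrite -iterSr -subSn // iter_sigma.
(* The tau^j-coordinate of sum_i g_i Phi^i v. Modulo X', Phi maps it to a multiple of [w (j - r)];
   after s steps the index has moved by r s, which is multiplication by t^r. *)
pose w j := \sum_(i < n) rproj s j (g i) *: iter i Phi v.
have sgE j x : rproj s j (sg' x) = constL (q' ^ j) * sigma_q q (rproj s j x).
  by rewrite rproj_sigma // q's.
have tK x : tL k ^ r * (tL k ^ (- r) * x) = x.
  by rewrite mulrA -expfzDr ?tL_neq0 // subrr mul1r.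
have fE j i : rproj s j (tL k ^ r * f i) = a i * (constL (q' ^ j) * sigma_q q (rproj s j gam)).
  by rewrite /f -mulrA tK rproj_ramifyM // sgE.
have pE j x : rproj s (j - r) x = rproj s j (tL k ^ r * x) by rewrite rproj_tzM.
pose C j := y^-1 * q' ^ (- j).
have C0 j : C j != 0 by rewrite mulf_neq0 ?invr_neq0 ?expfz_neq0.
have Cy j : C j * y * q' ^ j = 1.
  by rewrite /C -invr_expz; field; rewrite y0 expfz_neq0.
have CE j x : constL (C j) * (constL y * (constL (q' ^ j) * x)) = x.
  by rewrite !mulrA -!rmorphM Cy rmorph1 mul1r.
have g0 : g 0%N = constL y * f 0%N by [].
have gS i : g i.+1 = constL y * (T (g i) + f i.+1) by [].
have g0E j : constL (C j) * rproj s (j - r) (g 0%N) = a 0%N * sigma_q q (rproj s j gam).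
  rewrite pE g0 mulrCA rproj_constM // (fE j 0%N) (mulrCA (a 0%N)); exact: CE.
have gSE j i : constL (C j) * rproj s (j - r) (g i.+1) =
    sigma_q q (rproj s j (g i)) + a i.+1 * sigma_q q (rproj s j gam).
  rewrite pE gS mulrCA rproj_constM // (mulrDr (tL k ^ r)) rprojD // (fE j i.+1) /T tK sgE.
  by rewrite (mulrCA (a _)) -(mulrDr (constL (q' ^ j))); exact: CE.
have Phiw j : Phi (w j) - constL (C j) *: w (j - r) \in X'.
  have -> : Phi (w j) - constL (C j) *: w (j - r) = sigma_q q (rproj s j gam) *:
      (iter n Phi v - \sum_(i < n) a i *: iter i Phi v); last exact: memvZ.
  set s0' := sigma_q q (rproj s j gam).
  have -> : Phi (w j) = \sum_(i < n') sigma_q q (rproj s j (g i)) *: iter i.+1 Phi v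
      + s0' *: iter n Phi v.
    rewrite (semilin_sum Phi_lin) big_ord_recr /= gn (semilinZ Phi_lin).
    by congr (_ + _); apply: eq_bigr => i _; rewrite (semilinZ Phi_lin).
  have -> : constL (C j) *: w (j - r) = (s0' * a 0%N) *: v +
      (\sum_(i < n') sigma_q q (rproj s j (g i)) *: iter i.+1 Phi v +
       \sum_(i < n') (s0' * a i.+1) *: iter i.+1 Phi v).
    rewrite /w big_ord_recl scalerDr scalerA g0E [a _ * _]mulrC; congr (_ + _).
    rewrite scaler_sumr -big_split /=; apply: eq_bigr => i _.
    by rewrite scalerA gSE scalerDl [a _ * _]mulrC.
  have -> : \sum_(i < n) a i *: iter i Phi v =
      a 0%N *: v + \sum_(i < n') a i.+1 *: iter i.+1 Phi v by rewrite big_ord_recl.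
  rewrite scalerBr scalerDr scalerA scaler_sumr.
  rewrite (eq_bigr (fun i : 'I_n' => s0' *: (a i.+1 *: iter i.+1 Phi v)) (F1 := fun i : 'I_n' => (s0' * a i.+1) *: iter i.+1 Phi v)); last first.
    by move=> i _; rewrite scalerA.
  by rewrite (addrCA ((s0' * _) *: v)) opprD addrA (addrC (\sum_(i < n') _)) addrK.
have itw m j : exists2 c, c != 0 & iter m Phi (w j) - constL c *: w (j - r * m%:Z) \in X'.
  elim: m => [|m [c c0 IH]].
    by exists 1; rewrite ?oner_neq0 // mulr0 subr0 rmorph1 scale1r subrr mem0v.
  exists (c * C (j - r * m%:Z)); first by rewrite mulf_neq0.
  have := memvD (sX' _ IH) (memvZ (constL c) (Phiw (j - r * m%:Z))).
  rewrite (semilinB Phi_lin) (semilin_const q_neq0 Phi_lin) scalerBr addrA subrK.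
  by rewrite scalerA -rmorphM intS mulrDr mulr1 opprD addrA addrAC.
(* The last coefficient of [w p] is then nonzero, which keeps [w p] outside X'. *)
have [p Hp] : exists p, rproj s p gam != 0.
  have [p [_ Hp]] := lval_ex gam0; exists p; apply: contra_neq Hp => H.
  by have := congr1 (fun x => lcoef x 0) H; rewrite lcoef_rproj // mulr0 addr0 lcoef0.
have [lam lam0 Hlam] := itw s p.
exists r, s, lam, (w p); split=> //; split.
- apply: memv_suml => i _; apply: memvZ; exact: iter_mem.
- apply/negP => /(Hind (fun i => rproj s p (g i)))/(_ n' (leqnn _)).
  by rewrite gn; apply/eqP.
have wE : w (p - r * s%:Z) = tL k ^ r *: w p.
  rewrite scaler_sumr; apply: eq_bigr => i _.
  by rewrite scalerA mulrC rproj_period // mulrC.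
rewrite /Nop /Nhat; set cf := _ * _.
have Ew : w p = cf *: (constL lam *: (tL k ^ r *: w p)).
  rewrite !scalerA /cf [_ * constL lam]mulrAC -rmorphM mulVf // rmorph1 mul1r.
  by rewrite -expfzDr ?tL_neq0 // addNr scale1r.
by rewrite [X in _ - X]Ew -wE -scalerBr memvZ.
Qed.

End Eigenvector.

(** * Decomposition under N *)

Section ConstantLinear.
Variables (k : closedFieldType) (V : vectType (laurent k)).
Implicit Types (u v : V) (f g : V -> V).

(** N is a semilinear map minus the identity, so linearity over the constants is all that
    survives. *)
Definition klin f := (forall u v, f (u + v) = f u + f v) /\
  (forall c v, f (constL c *: v) = constL c *: f v).

Section Basics.
Variable f : V -> V.
Hypothesis Hf : klin f.
Lemma klinD u v : f (u + v) = f u + f v. Proof. exact: Hf.1. Qed.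
Lemma klinZ c v : f (constL c *: v) = constL c *: f v. Proof. exact: Hf.2. Qed.
Lemma klin0 : f 0 = 0.
Proof. by apply: (addrI (f 0)); rewrite -klinD !addr0. Qed.
Lemma klinN u : f (- u) = - f u.
Proof. by apply: (addrI (f u)); rewrite -klinD !subrr klin0. Qed.
Lemma klinB u v : f (u - v) = f u - f v.
Proof. by rewrite klinD klinN. Qed.
Lemma klin_sum I (r : seq I) (P : pred I) (F : I -> V) :
  f (\sum_(i <- r | P i) F i) = \sum_(i <- r | P i) f (F i).
Proof. exact: (big_morph _ klinD klin0). Qed.
Lemma klin_iter n : klin (iter n f).
Proof.
elim: n => [|n [ID IZ]]; first by split.
by split=> [u v|c v] /=; rewrite ?ID ?IZ ?klinD ?klinZ.
Qed.
Lemma klin_iter_stop m n u : (m <= n)%N -> iter m f u = 0 -> iter n f u = 0.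
Proof.
move=> le H; rewrite -(subnK le) iterD H.
by elim: (n - m)%N => //= i ->; apply: klin0.
Qed.
End Basics.

Lemma semilin_klin e f : e != 0 -> semilin e f -> klin f.
Proof.
by move=> e0 Hf; split=> *; rewrite ?(semilinD Hf) ?(semilin_const e0 Hf).
Qed.
End ConstantLinear.

Section Operators.
Variables (k : closedFieldType) (q : k) (V : vectType (laurent k)) (Phi : V -> V).
Hypotheses (q_neq0 : q != 0) (Phi_lin : semilin q Phi).
Implicit Types (u v w : V) (X : {vspace V}) (r : int) (s : nat) (lam : k).

Lemma iterPhi_lin n : semilin (q ^+ n) (iter n Phi).
Proof. exact: semilin_iter. Qed.

Lemma Nhat_lin r s lam : semilin (q ^+ s) (Nhat Phi r s lam).
Proof. by apply: semilin_scale; apply: iterPhi_lin. Qed.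

Lemma Nhat_klin r s lam : klin (Nhat Phi r s lam).
Proof. exact: semilin_klin (expf_neq0 _ q_neq0) (Nhat_lin r s lam). Qed.

Lemma Nop_klin r s lam : klin (Nop Phi r s lam).
Proof.
have H := Nhat_klin r s lam; split=> [u v|c v]; rewrite /Nop.
  by rewrite (klinD H) opprD addrACA.
by rewrite (klinZ H) scalerBr.
Qed.

Lemma Nhat_mem X r s lam u : stable Phi X -> u \in X -> Nhat Phi r s lam u \in X.
Proof. by move=> sX Xu; apply/memvZ/iter_mem. Qed.

Lemma Nop_mem X r s lam u : stable Phi X -> u \in X -> Nop Phi r s lam u \in X.
Proof. by move=> sX Xu; rewrite memvB // Nhat_mem. Qed.

Lemma NhatE r s lam u : Nhat Phi r s lam u = u + Nop Phi r s lam u.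
Proof. by rewrite /Nop addrC subrK. Qed.

Lemma iterNhat_sub r s lam m u :
  iter m (Nhat Phi r s lam) u - u =
  Nop Phi r s lam (\sum_(i < m) iter i (Nhat Phi r s lam) u).
Proof.
have H := Nop_klin r s lam.
elim: m => [|m IH]; first by rewrite big_ord0 (klin0 H) subrr.
by rewrite big_ord_recr (klinD H) -IH /Nop /= [RHS]addrC addrA subrK.
Qed.

Lemma iterNhat r s lam m : lam != 0 -> exists2 c : k, c != 0 &
  forall u, iter m (Nhat Phi r s lam) u = (constL c * tL k ^ (- r * m%:Z)) *: iter (s * m) Phi u.
Proof.
move=> lam0; elim: m => [|m [c c0 IH]].
  by exists 1; rewrite ?oner_neq0 // => u; rewrite muln0 mulr0 rmorph1 mulr1 scale1r.
exists (lam^-1 * (c * (q ^+ s) ^ (- r * m%:Z))).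
  by rewrite !mulf_neq0 ?invr_neq0 ?expfz_neq0 ?expf_neq0.
move=> u; rewrite iterS IH {1}/Nhat (semilinZ (iterPhi_lin s)) scalerA -iterD mulnS.
congr (_ *: _); rewrite sigmaM ?expf_neq0 // sigma_const ?expf_neq0 // sigma_tz ?expf_neq0 //.
have -> : - r * m.+1%:Z = - r + - r * m%:Z by rewrite intS mulrDr mulr1.
rewrite (expfzDr _ _ (tL_neq0 k)) 2!constLM.
set A := constL _; set B := tL k ^ _; set C := constL _; set D := constL _; set E := tL k ^ _.
by rewrite -!mulrA; congr (_ * _); rewrite mulrCA; congr (_ * _); rewrite mulrCA.
Qed.

End Operators.

Section Fitting.
Variables (k : closedFieldType) (q : k) (V : vectType (laurent k)) (Phi : V -> V).
Hypotheses (k_char0 : [pchar k] =i pred0).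
Hypotheses (q_neq0 : q != 0) (q_nroot : forall n : nat, (0 < n)%N -> q ^+ n != 1).
Hypotheses (Phi_lin : semilin q Phi) (Phi_inj : injective Phi).
Variables (r : int) (s : nat) (lam : k).
Hypotheses (s_gt0 : (0 < s)%N) (lam_neq0 : lam != 0).
Implicit Types (u v w : V) (X : {vspace V}).
Local Notation N := (Nop Phi r s lam).
Local Notation M := (Nhat Phi r s lam).

(** X = N X + ker N^oo, with n depending on z. The sum is not direct in general: N w lies in both
    parts when w is a generalized eigenvector. *)
Definition fitting X := forall z, z \in X ->
  exists x e n, [/\ x \in X, e \in X, iter n N e = 0 & z = N x + e].

Lemma fitting_iter X n y : stable Phi X -> fitting X -> y \in X ->
  exists x e m, [/\ x \in X, e \in X, iter m N e = 0 & y = iter n N x + e].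
Proof.
move=> sX fX; have HN := Nop_klin q_neq0 Phi_lin r s lam.
elim: n y => [|n IH] y Xy.
  by exists y, 0, 0%N; rewrite mem0v addr0.
have [x1 [e1 [m1 [Xx1 Xe1 He1 ->]]]] := fX y Xy.
have [x2 [e2 [m2 [Xx2 Xe2 He2 ->]]]] := IH x1 Xx1.
exists x2, (N e2 + e1), (m1 + m2)%N; split=> //.
- by rewrite memvD // Nop_mem.
- rewrite (klinD (klin_iter HN _)) (klin_iter_stop HN (leq_addr _ _) He1) addr0 -iterSr.
  apply: (klin_iter_stop HN (m := m2) _ He2); lia.
by rewrite iterS (klinD HN) -addrA.
Qed.

Lemma iterPhi_eigen_mod X r' s' lam' v i : stable Phi X -> lam' != 0 ->
  iter s' Phi v - (constL lam' * tL k ^ r') *: v \in X ->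
  exists2 c, c != 0 &
    iter s' Phi (iter i Phi v) - (constL c * tL k ^ r') *: iter i Phi v \in X.
Proof.
move=> sX l0 Hv; have HI := iterPhi_lin q_neq0 Phi_lin i.
exists (lam' * (q ^+ i) ^ r'); first by rewrite mulf_neq0 ?expfz_neq0 ?expf_neq0.
have := iter_mem i sX Hv; rewrite (semilinB HI) (semilinZ HI).
rewrite -!iterD addnC sigmaM ?expf_neq0 // sigma_const ?expf_neq0 //.
by rewrite sigma_tz ?expf_neq0 // constLM mulrA.
Qed.

Lemma iter_eigen_mod X r' s' lam' v m : stable Phi X -> lam' != 0 ->
  iter s' Phi v - (constL lam' * tL k ^ r') *: v \in X ->
  exists2 c, c != 0 &
    iter (s' * m) Phi v - (constL c * tL k ^ (r' * m%:Z)) *: v \in X.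
Proof.
move=> sX l0 Hv; elim: m => [|m [c c0 IH]].
  by exists 1; rewrite ?oner_neq0 // muln0 mulr0 constL1 mulr1 scale1r subrr mem0v.
have HI := iterPhi_lin q_neq0 Phi_lin s'.
exists (c * (q ^+ s') ^ (r' * m%:Z) * lam').
  by rewrite !mulf_neq0 ?expfz_neq0 ?expf_neq0.
pose a := constL (c * (q ^+ s') ^ (r' * m%:Z)) * tL k ^ (r' * m%:Z).
have := memvD (iter_mem s' sX IH) (memvZ a Hv).
rewrite (semilinB HI) (semilinZ HI) -iterD -mulnS sigmaM ?expf_neq0 //.
rewrite sigma_const ?expf_neq0 // sigma_tz ?expf_neq0 // mulrA -constLM -/a.
rewrite scalerBr addrA subrK scalerA /a.
have -> : r' * m.+1%:Z = r' * m%:Z + r' by rewrite intS mulrDr mulr1 addrC.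
rewrite (expfzDr _ _ (tL_neq0 k)) (constLM _ lam').
by rewrite -!mulrA (mulrCA (tL k ^ (r' * _))).
Qed.

Section Extension.
Variables (X' X : {vspace V}).
Hypotheses (sX' : stable Phi X') (sX : stable Phi X).

(** The decomposition of a single z modulo X'. It is additive in z, so it can be verified on the
    multiples of generators of X over X'. *)
Definition fitting_mod z := exists x e n,
  [/\ x \in X, e \in X, iter n N e \in X' & z - N x - e \in X'].

Lemma fitting_modD y z : fitting_mod y -> fitting_mod z -> fitting_mod (y + z).
Proof.
have HN := Nop_klin q_neq0 Phi_lin r s lam.
have HNX i u : u \in X' -> iter i N u \in X'.
  by apply: iter_mem => w; apply: Nop_mem.
move=> [x1 [e1 [m1 [Xx1 Xe1 He1 E1]]]] [x2 [e2 [m2 [Xx2 Xe2 He2 E2]]]].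
exists (x1 + x2), (e1 + e2), (m1 + m2)%N; split; try exact: memvD.
  rewrite (klinD (klin_iter HN _)) memvD //; last by rewrite iterD HNX.
  by rewrite addnC iterD HNX.
have -> : y + z - N (x1 + x2) - (e1 + e2) = (y - N x1 - e1) + (z - N x2 - e2).
  rewrite (klinD HN); move: (N x1) (N x2) => n1 n2.
  by rewrite !opprD (addrACA y z) (addrACA (y - n1)).
exact: memvD.
Qed.

Lemma natconst_neq0 n : (0 < n)%N -> n%:R != 0 :> k.
Proof. by have /pcharf0P H := k_char0; rewrite H lt0n. Qed.

(* With P = T^s' - 1 = (T - 1) Q and Q(1) = s' invertible, ker P splits as
   ker (T - 1) plus a part on which T - 1 is onto. *)
Lemma fitting_mod_eigen r' s' lam' e a : (0 < s')%N -> lam' != 0 -> e \in X ->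
  iter s' Phi e - (constL lam' * tL k ^ r') *: e \in X' -> fitting_mod (a *: e).
Proof.
move=> s'0 l'0 Xe He; have HN := Nop_klin q_neq0 Phi_lin r s lam.
have HM := Nhat_klin q_neq0 Phi_lin r s lam.
have [c c0 Hc] := iterNhat q_neq0 Phi_lin r s s' lam_neq0.
have [c' c'0 Hc'] := iter_eigen_mod s sX' l'0 He.
pose Q := q ^+ (s * s').
have Q0 : Q != 0 by rewrite expf_neq0.
(* Both M^s' and s iterations of the eigenvector relation involve Phi^(s s'). Hence M^s' acts on the
   multiples a e modulo X' by the scalar operator a |-> c c' t^m sigma_Q a, to which [scalar_split]
   applies. *)
pose m := - r * s'%:Z + r' * s%:Z.
have MQ b : iter s' M (b *: e) - (constL (c * c') * tL k ^ m * sigma_q Q b) *: e \in X'.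
  have HI := iterPhi_lin q_neq0 Phi_lin (s * s').
  rewrite Hc (semilinZ HI) scalerA -/Q.
  have -> : constL (c * c') * tL k ^ m * sigma_q Q b =
     constL c * tL k ^ (- r * s'%:Z) * sigma_q Q b * (constL c' * tL k ^ (r' * s%:Z)).
    rewrite /m (expfzDr _ _ (tL_neq0 k)) constLM [RHS]mulrAC.
    by congr (_ * _); apply: mulrACA.
  by rewrite -[X in _ - X]scalerA -scalerBr memvZ // mulnC.
have [y [g [Ea Eg]]] := scalar_split Q0 m a (mulf_neq0 c0 c'0).
have Xit i u : u \in X -> iter i M u \in X.
  by apply: iter_mem => w; apply: Nhat_mem.
have -> : a *: e = ((constL (c * c') * tL k ^ m * sigma_q Q y) *: e - y *: e) + g *: e.
  by rewrite {1}Ea scalerDl scalerBl.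
apply: fitting_modD.
  (* M^s' - 1 is N times a geometric sum in M. *)
  exists (\sum_(i < s') iter i M (y *: e)), 0, 0%N.
  rewrite -(iterNhat_sub q_neq0 Phi_lin) !mem0v subr0; split=> //.
    by apply: memv_suml => i _; apply/Xit/memvZ.
  by rewrite opprB addrA subrK -memvN opprB; apply: MQ.
pose h := g *: e; have Xh : h \in X by apply: memvZ.
have Hh : iter s' M h - h \in X' by have := MQ g; rewrite Eg.
have s'n : constL (s'%:R : k) != 0 by rewrite constL_eq0 natconst_neq0.
(* Modulo X', M^s' fixes h. The average S / s' is then killed by N, and h minus this average is N x,
   since every M^i h - h lies in the image of N. *)
pose S := \sum_(i < s') iter i M h.
have SE : \sum_(i < s') (iter i M h - h) = S - constL (s'%:R) *: h.
  rewrite big_split /= sumr_const card_ord -/S; congr (_ + _).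
  by rewrite rmorph_nat scaler_nat mulNrn.
pose x := constL (- (s'%:R)^-1) *: \sum_(i < s') \sum_(j < i) iter j M h.
pose e' := constL (s'%:R^-1) *: S.
have Xsum n : \sum_(i < n) iter i M h \in X.
  by apply: memv_suml => i _; apply/Xit.
exists x, e', 1%N; split.
- by apply/memvZ/memv_suml => i _; apply: Xsum.
- by apply: memvZ; apply: Xsum.
- by rewrite /= (klinZ HN) -(iterNhat_sub q_neq0 Phi_lin) memvZ.
rewrite /x (klinZ HN) (klin_sum HN).
rewrite (eq_bigr (fun i : 'I_s' => iter i M h - h)); last by move=> i _; rewrite (iterNhat_sub q_neq0 Phi_lin).
rewrite SE rmorphN scaleNr opprK scalerBr -/e' scalerA -constLM.
by rewrite mulVf ?natconst_neq0 // constL1 scale1r -/h subrKC subrr mem0v.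
Qed.

End Extension.

(** The vector e is killed by N^n only modulo X'. Writing N^n e = N^n x1 + e1 inside X', the
    difference e - x1 is killed by a power of N, and the leftover, which contains x1, lies in X',
    where the decomposition is known. *)
Lemma fitting_of_mod X' X : stable Phi X' -> stable Phi X -> (X' <= X)%VS ->
  fitting X' -> (forall z, z \in X -> fitting_mod X' X z) -> fitting X.
Proof.
move=> sX' sX leX fX' H z /H[x [e [n [Xx Xe He Hz]]]].
have HN := Nop_klin q_neq0 Phi_lin r s lam.
have [x1 [e1 [m1 [Xx1 Xe1 He1 E1]]]] := fitting_iter n sX' fX' He.
have Hx1 : z - N x - e + x1 \in X' by rewrite memvD.
have [x2 [e2 [m2 [Xx2 Xe2 He2 E2]]]] := fX' _ Hx1.
have Hee : iter (m1 + n) N (e - x1) = 0.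
  by rewrite iterD (klinB (klin_iter HN n)) E1 addrC addKr He1.
exists (x + x2), (e - x1 + e2), ((m1 + n) + m2)%N; split.
- by rewrite memvD // (subvP leX).
- by rewrite memvD ?memvB // (subvP leX).
- rewrite (klinD (klin_iter HN _)) (klin_iter_stop HN _ Hee) ?leq_addr //.
  by rewrite (klin_iter_stop HN _ He2) ?leq_addl // addr0.
rewrite (klinD HN); move: (N x) (N x2) E2 {Hx1 Hz} => n1 n2 E2.
have {1}-> : z = n1 + (z - n1 - e + x1) + (e - x1).
  by rewrite -(addrA n1) (addrA (z - n1 - e + x1)) (addrAC (z - n1 - e)) subrK addrK subrKC.
by rewrite E2 -!addrA (addrC e2) -!addrA.
Qed.

(** Induction on the codimension of a stable X' with the property: an eigenvector v of X/X' enlarges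
    X' by the lines of Phi^i v, i < s', and each of these is an eigenvector modulo X' of the same
    slope. *)
Lemma stable_fitting X : stable Phi X -> fitting X.
Proof.
move=> sX.
suff H m (X' : {vspace V}) : stable Phi X' -> fitting X' -> (X' <= X)%VS ->
    (\dim X - \dim X' <= m)%N -> fitting X.
  apply: (H (\dim X) 0%VS); rewrite ?sub0v ?leq_subr //.
    by move=> u; rewrite memv0 => /eqP ->; rewrite (semilin0 Phi_lin) mem0v.
  move=> z; rewrite memv0 => /eqP ->; exists 0, 0, 0%N.
  by rewrite mem0v addr0 (klin0 (Nop_klin q_neq0 Phi_lin r s lam)).
elim: m X' => [|m IH] X' sX' fX' leX dX.
  have /eqP <- // : X' == X by rewrite eqEdim leX -subn_eq0 -leqn0.
have [<- //|neX] := eqVneq X' X.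
have [r' [s' [lam' [v [[s'0 cop l'0] [Xv X'v Nv]]]]]] :=
  quotient_eigenvector q_neq0 q_nroot Phi_lin Phi_inj sX' sX leX neX.
have cf0 : constL lam' * tL k ^ r' != 0 by rewrite mulf_neq0 ?constL_eq0 ?tLz_neq0.
have Hv : iter s' Phi v - (constL lam' * tL k ^ r') *: v \in X'.
  have := memvZ (constL lam' * tL k ^ r') Nv; rewrite /Nop /Nhat scalerBr scalerA.
  have -> : constL lam' * tL k ^ r' * (constL lam'^-1 * tL k ^ (- r')) = 1.
    rewrite mulrACA -constLM mulfV // constL1 mul1r.
    by rewrite -expfzDr ?tL_neq0 // subrr.
  by rewrite scale1r.
pose X'' := (X' + \sum_(i < s') <[iter i Phi v]>)%VS.
have leX'' : (X'' <= X)%VS.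
  rewrite subv_add leX; apply/subv_sumP => i _; rewrite -memvE; exact: iter_mem.
have X'X'' : (X' <= X'')%VS by apply: addvSl.
have Xi i : (i < s')%N -> iter i Phi v \in X''.
  move=> lt; rewrite memvE (subv_trans _ (addvSr _ _)) //.
  exact: (sumv_sup (Ordinal lt)).
have ind z : z \in X'' -> exists y (c : nat -> laurent k), y \in X' /\ z = y + \sum_(i < s') c i *: iter i Phi v.
  move=> /memv_add_lines[c Hc]; exists (z - \sum_(i < s') c i *: iter i Phi v), c.
  by rewrite subrK.
have sX'' : stable Phi X''.
  move=> z /ind[y [c [Xy ->]]].
  rewrite (semilinD Phi_lin) memvD //; first by rewrite (subvP X'X'') ?sX'.
  rewrite (semilin_sum Phi_lin); apply: memv_suml => i _.
  rewrite (semilinZ Phi_lin) memvZ // -iterS.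
  have := ltn_ord i; rewrite leq_eqVlt => /orP[/eqP ->|]; last exact: Xi.
  rewrite -(subrK ((constL lam' * tL k ^ r') *: v) (iter s' Phi v)) memvD //.
    exact: (subvP X'X'').
  by rewrite memvZ // (Xi 0%N).
apply: (IH X'') => //.
  apply: (fitting_of_mod sX' sX'') => // z /ind[y [c [Xy ->]]].
  apply: fitting_modD => //.
    exists 0, 0, 0%N; rewrite !mem0v (klin0 (Nop_klin q_neq0 Phi_lin r s lam)).
    by rewrite !subr0.
  have HE i : (i < s')%N -> fitting_mod X' X'' (c i *: iter i Phi v).
    move=> lt; have [c' c'0 Hc'] := iterPhi_eigen_mod i sX' l'0 Hv.
    exact: (fitting_mod_eigen sX' sX'' _ s'0 c'0 (Xi i lt) Hc').
  suff HS j : (j <= s')%N -> fitting_mod X' X'' (\sum_(i < j) c i *: iter i Phi v).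
    exact: HS.
  elim: j => [_|j IHj lt].
    rewrite big_ord0; exists 0, 0, 0%N.
    by rewrite !mem0v (klin0 (Nop_klin q_neq0 Phi_lin r s lam)) !subr0 mem0v.
  rewrite big_ord_recr /=; apply: fitting_modD => //; last exact: HE.
  by apply: IHj; apply: ltnW.
have : (\dim X' < \dim X'')%N.
  rewrite ltn_neqAle dimvS // andbT; apply: contra X'v => E.
  have /eqP -> : X' == X'' by rewrite eqEdim X'X'' (eqP E) leqnn.
  exact: (Xi 0%N).
move: dX (dimvS leX''); move: (\dim X) (\dim X') (\dim X'').
by clear=> a b c; lia.
Qed.

End Fitting.

(** * Duality of generalized eigenvectors *)

(* Keeps unification from unfolding Laurent series down to fractions of power series. *)
#[local] Opaque sigma_q constL tL.

Section ConstantPart.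
Variables (k : closedFieldType) (Q : k).
Hypotheses (Q_neq0 : Q != 0) (Q_nroot : forall n : nat, (0 < n)%N -> Q ^+ n != 1).

(** In degree m the equation involves the factor Q^m - 1, which vanishes only for m = 0. *)
Lemma sigma_fixed_const (z : laurent k) (c : k) :
  sigma_q Q z = z + constL c -> c = 0 /\ exists c', z = constL c'.
Proof.
move=> H.
have E m : Q ^ m * lcoef z m = lcoef z m + (if m == 0 then c else 0).
  by rewrite -lcoef_sigma // H lcoefD lcoef_const.
split; first by apply: (addrI (lcoef z 0)); rewrite -(E 0) expr0z mul1r addr0.
exists (lcoef z 0); apply: lcoef_ext => m; rewrite lcoef_const; case: eqP => [-> //|/eqP m0].
move: (E m); rewrite (negbTE m0) addr0 => /eqP.
rewrite -{2}[lcoef z m]mul1r -subr_eq0 -mulrBl mulf_eq0 subr_eq0.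
by rewrite expfz_eq1 // (negbTE m0) => /eqP.
Qed.
End ConstantPart.

Section Antitriangular.
Variables (R : pzRingType) (beta : nat -> nat -> R) (d : nat).
Hypothesis rel : forall i j, beta i.+1 j + beta i j.+1 + beta i.+1 j.+1 = 0.
Hypothesis zero : forall i j, (d <= i)%N -> beta i j = 0.

(** For beta i j = <N^i u, N'^j v>, [rel] is invariance under (1 + N) x (1 + N'). It trades a step
    in j for steps in i, until i reaches d. *)
Lemma antitriangular0 i j : (d <= i + j)%N -> beta i j = 0.
Proof.
move: {2}(d - i)%N (leqnn (d - i)) => m; elim: m i j => [|m IH] i j le leij.
  by apply: zero; rewrite -subn_eq0 -leqn0.
have [/zero //|lt] := leqP d i.
case: j leij => [|j] leij; first by rewrite addn0 leqNgt lt in leij.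
have := rel i j; rewrite !(IH i.+1) ?add0r ?addr0 //; lia.
Qed.

(** On the antidiagonal i + j = d - 1 the third term of [rel] vanishes, so neighbouring entries are
    opposite. *)
Lemma antitriangular_lead i j : (i + j).+1 = d -> beta i j = (-1) ^+ j * beta (i + j)%N 0%N.
Proof.
elim: j i => [|j IH] i E; first by rewrite expr0 mul1r addn0.
have := rel i j; rewrite (antitriangular0 (i := i.+1) (j := j.+1)) ?addr0; last by lia.
rewrite (IH i.+1); last by rewrite addSnnS.
rewrite addSnnS => /eqP; rewrite addrC addr_eq0 => /eqP ->.
by rewrite exprS mulN1r mulNr.
Qed.
End Antitriangular.

Lemma linear_lfun (F : fieldType) (U W : vectType F) (f : U -> W) :
  linear f -> exists g : 'Hom(U, W), g =1 f.
Proof.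
move=> Hf; pose L := GRing.isLinear.Build _ _ _ _ f Hf.
pose l : {linear U -> W} := HB.pack f L.
by exists (linfun l) => x; rewrite lfunE.
Qed.

Section Pairing.
Variables (k : closedFieldType) (q : k) (V : vectType (laurent k)) (Phi : V -> V).
Variable b : V -> V -> laurent k.
Hypotheses (k_char0 : [pchar k] =i pred0).
Hypotheses (q_neq0 : q != 0) (q_nroot : forall n : nat, (0 < n)%N -> q ^+ n != 1).
Hypotheses (Phi_lin : semilin q Phi) (Phi_inj : injective Phi).
Hypothesis b_bil : bilinear_form b.
Hypothesis b_Phi : forall u w, b (Phi u) (Phi w) = sigma_q q (b u w).
Implicit Types (u v w : V) (X : {vspace V}) (r : int) (s : nat) (lam : k).
Local Notation N r s lam := (Nop Phi r s lam).
Local Notation M r s lam := (Nhat Phi r s lam).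

Lemma bDl u v w : b (u + v) w = b u w + b v w.
Proof. by have := b_bil.1 1 u v w; rewrite scale1r mul1r. Qed.
Lemma bDr u v w : b u (v + w) = b u v + b u w.
Proof. by have := b_bil.2 1 u v w; rewrite scale1r mul1r. Qed.
Lemma b0l w : b 0 w = 0.
Proof. by apply: (addrI (b 0 w)); rewrite -bDl !addr0. Qed.
Lemma b0r w : b w 0 = 0.
Proof. by apply: (addrI (b w 0)); rewrite -bDr !addr0. Qed.
Lemma bZl a u w : b (a *: u) w = a * b u w.
Proof. by have := b_bil.1 a u 0 w; rewrite b0l !addr0. Qed.
Lemma bZr a u w : b u (a *: w) = a * b u w.
Proof. by have := b_bil.2 a u w 0; rewrite b0r !addr0. Qed.
Lemma bNl u w : b (- u) w = - b u w.
Proof. by apply: (addrI (b u w)); rewrite -bDl !subrr b0l. Qed.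
Lemma b_suml I (r : seq I) (P : pred I) (F : I -> V) w :
  b (\sum_(i <- r | P i) F i) w = \sum_(i <- r | P i) b (F i) w.
Proof. exact: (big_morph (b^~ w) (fun u v => bDl u v w) (b0l w)). Qed.
Lemma b_sumr I (r : seq I) (P : pred I) (F : I -> V) w :
  b w (\sum_(i <- r | P i) F i) = \sum_(i <- r | P i) b w (F i).
Proof. exact: (big_morph (b w) (bDr w) (b0r w)). Qed.

Lemma b_iterPhi n u w : b (iter n Phi u) (iter n Phi w) = sigma_q (q ^+ n) (b u w).
Proof.
elim: n => [|n IH]; first by rewrite sigma_id.
by rewrite !iterS b_Phi IH sigma_comp ?expf_neq0 // exprS.
Qed.

Lemma orth_family n (y : nat -> V) : exists Z : {vspace V},
  forall x, x \in Z <-> forall i, (i < n)%N -> b (y i) x = 0.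
Proof.
have H i : exists g : 'Hom(V, (laurent k)^o), g =1 b (y i).
  apply: linear_lfun => a u v; exact: b_bil.2.
elim: n => [|n [Z HZ]]; first by exists fullv => x; rewrite memvf.
have [g Hg] := H n; exists (Z :&: lker g)%VS => x; rewrite memv_cap memv_ker Hg.
split=> [/andP[/HZ Zx /eqP gx] i|Hx].
  by rewrite ltnS leq_eqVlt => /orP[/eqP ->|/Zx].
by rewrite (Hx n) // eqxx andbT; apply/HZ => i lt; apply: Hx; apply: ltnW.
Qed.

Lemma orth_space (Y : {vspace V}) : exists Z : {vspace V},
  forall x, x \in Z <-> forall y, y \in Y -> b y x = 0.
Proof.
have [Z HZ] := orth_family (\dim Y) (nth 0 (vbasis Y)); exists Z => x.
rewrite HZ; split=> H y; last first.
  by move=> lt; apply: H; apply/vbasis_mem/mem_nth; rewrite size_tuple.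
move=> /coord_vbasis ->; rewrite b_suml big1 // => i _.
by rewrite bZl H ?mulr0.
Qed.

Lemma Nop_NhatC r s lam u : N r s lam (M r s lam u) = M r s lam (N r s lam u).
Proof. by rewrite [in RHS]/Nop (klinB (Nhat_klin q_neq0 Phi_lin r s lam)). Qed.

Lemma iter_Nop_sum r s lam n m u : iter n (N r s lam) u = 0 ->
  iter n (N r s lam) (\sum_(i < m) iter i (M r s lam) u) = 0.
Proof.
move=> Hu; have HN := klin_iter (Nop_klin q_neq0 Phi_lin r s lam) n.
rewrite (klin_sum HN) big1 // => i _.
elim: {i}(i : nat) => //= i IH.
have HM := Nhat_klin q_neq0 Phi_lin r s lam.
suff -> w : iter n (N r s lam) (M r s lam w) = M r s lam (iter n (N r s lam) w).
  by rewrite IH (klin0 HM).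
by elim: n {Hu IH HN} => // n IH; rewrite !iterS IH Nop_NhatC.
Qed.

(** If the conclusion fails, then by induction on n + n' pairings involving N u or N' v vanish, so b
    u v is unchanged when iterates of 1 + N and 1 + N' are applied to u and v. With s' and s
    iterates both sides carry Phi^(s s'), and [scalar_fixed] gives r s' + r' s = 0, whence s = s'
    and r' = -r by coprimality. One iterate on each side then yields the condition on lam lam'. *)
Lemma pair_types r s lam n u r' s' lam' n' v :
  (0 < s)%N -> (0 < s')%N -> coprime `|r| s -> coprime `|r'| s' ->
  lam != 0 -> lam' != 0 ->
  iter n (N r s lam) u = 0 -> iter n' (N r' s' lam') v = 0 -> b u v != 0 ->
  [/\ s = s', r' = - r & exists z : int, lam * lam' = (q ^+ s) ^ z].
Proof.
move=> s0 s'0 cop cop' l0 l'0; move: {2}(n + n')%N (leqnn (n + n')) => m.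
elim: m n n' u v => [|m IH] n n' u v le Hu Hv Huv.
  by move: Hu Huv; case: n le => // _ /= ->; rewrite b0l eqxx.
apply: NNPP => HC.
have low n0 n0' u0 v0 : (n0 + n0' <= m)%N -> iter n0 (N r s lam) u0 = 0 ->
    iter n0' (N r' s' lam') v0 = 0 -> b u0 v0 = 0.
  move=> le0 Hu0 Hv0; apply/eqP/negPn/negP => H0; apply: HC; exact: IH le0 Hu0 Hv0 H0.
case: n Hu le => [Hu|n Hu le]; first by move: Huv; rewrite [u]Hu b0l eqxx.
case: n' Hv le => [Hv|n' Hv le]; first by move: Huv; rewrite [v]Hv b0r eqxx.
have inv i j : b (iter i (M r s lam) u) (iter j (M r' s' lam') v) = b u v.
  have E := iterNhat_sub q_neq0 Phi_lin r s lam i u.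
  have E' := iterNhat_sub q_neq0 Phi_lin r' s' lam' j v.
  have := iter_Nop_sum i Hu; have := iter_Nop_sum j Hv; move: E E'.
  set us := \sum_(l < i) _; set vs := \sum_(l < j) _ => E E' Hvs Hus.
  rewrite -[X in b X _](subrK u) -[X in b _ X](subrK v) E E'.
  rewrite (bDl _ u) (bDr (N r s lam us) _ v) (bDr u _ v).
  rewrite iterSr in Hus; rewrite iterSr in Hvs.
  have le1 : (n + n'.+1 <= m)%N by move: le; clear; lia.
  have le2 : (n.+1 + n' <= m)%N by move: le; clear; lia.
  have le3 : (n + n' <= m)%N by move: le; clear; lia.
  by rewrite (low _ _ _ _ le3 Hus Hvs) (low _ _ _ _ le1 Hus Hv) (low _ _ _ _ le2 Hu Hvs) !add0r.
have [c c0 Hc] := iterNhat q_neq0 Phi_lin r s s' l0.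
have [c' c'0 Hc'] := iterNhat q_neq0 Phi_lin r' s' s l'0.
have Q0 i : q ^+ i != 0 by rewrite expf_neq0.
have := inv s' s; rewrite Hc Hc' bZl bZr [(s' * s)%N]mulnC b_iterPhi => E.
have [E0 _] : - r * s'%:Z + - r' * s%:Z = 0 /\ exists j : int, (c * c') * (q ^+ (s * s')) ^ j = 1.
  apply: (scalar_fixed (Q0 _) Huv (mulf_neq0 c0 c'0)).
  by rewrite -{1}E mulrA (expfzDr _ _ (tL_neq0 k)) constLM; congr (_ * _); apply: mulrACA.
have Ers : r * s'%:Z = - r' * s%:Z by move/eqP: E0; rewrite !mulNr -opprD oppr_eq0 addr_eq0 => /eqP.
have Es : s = s'.
  have Ers' : (`|r| * s' = `|r'| * s)%N by move/(congr1 absz): Ers; rewrite !abszM abszN.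
  apply/eqP; rewrite eqn_dvd; apply/andP; split.
    by rewrite -(@Gauss_dvdr s `|r| s') ?Ers' ?dvdn_mull // coprime_sym.
  by rewrite -(@Gauss_dvdr s' `|r'| s) -?Ers' ?dvdn_mull // coprime_sym.
have Er : r' = - r by move: Ers s0; rewrite Es; clear; nia.
apply: HC; split=> //.
have := inv 1%N 1%N; rewrite /= /Nhat bZl bZr -Es b_iterPhi Er opprK => E1.
have [_ [j Hj]] : 0 = 0 :> int /\ exists j : int, (lam^-1 * lam'^-1) * (q ^+ s) ^ j = 1.
  apply: (scalar_fixed (Q0 _) Huv (mulf_neq0 (invr_neq0 l0) (invr_neq0 l'0))).
  rewrite -{1}E1 mulrA constLM expr0z mulr1; congr (_ * _).
  by rewrite mulrACA -(expfzDr _ _ (tL_neq0 k)) addNr mulr1.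
exists j; rewrite -[RHS]mul1r -[in RHS](mulfV (mulf_neq0 l0 l'0)) -mulrA invfM.
by rewrite Hj mulr1.
Qed.


Lemma b_Nhat r s lam u v : lam != 0 ->
  b (M r s lam u) (M (- r) s lam^-1 v) = sigma_q (q ^+ s) (b u v).
Proof.
move=> l0; rewrite /Nhat bZl bZr b_iterPhi mulrA monomM mulfV ?invr_neq0 // subrr.
by rewrite constL1 expr0z !mul1r.
Qed.

Lemma b_Nop_expand r s lam u v : lam != 0 ->
  sigma_q (q ^+ s) (b u v) = b u v + (b (N r s lam u) v + b u (N (- r) s lam^-1 v)
    + b (N r s lam u) (N (- r) s lam^-1 v)).
Proof.
move=> l0; rewrite -(b_Nhat r s _ _ l0) !NhatE.
move: (N r s lam u) (N (- r) s lam^-1 v) => x y.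
by rewrite bDl !bDr -!addrA; congr (_ + _); rewrite addrCA.
Qed.

(** By induction the correction terms in [b_Nop_expand] are constants, so sigma (b u v) differs from
    b u v by a constant, and [sigma_fixed_const] applies. *)
Lemma pair_const r s lam n n' u v : (0 < s)%N -> lam != 0 ->
  iter n (N r s lam) u = 0 -> iter n' (N (- r) s lam^-1) v = 0 ->
  exists c, b u v = constL c.
Proof.
move=> s0 l0; move: {2}(n + n')%N (leqnn (n + n')) => m.
elim: m n n' u v => [|m IH] n n' u v le Hu Hv.
  by exists 0; move: Hu; case: n le => // _ /= ->; rewrite b0l rmorph0.
case: n Hu le => [Hu _|n Hu le]; first by exists 0; rewrite [u]Hu b0l rmorph0.
case: n' Hv le => [Hv _|n' Hv le]; first by exists 0; rewrite [v]Hv b0r rmorph0.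
have le1 : (n + n'.+1 <= m)%N by move: le; clear; lia.
have le2 : (n.+1 + n' <= m)%N by move: le; clear; lia.
have le3 : (n + n' <= m)%N by move: le; clear; lia.
have Hu' := Hu; have Hv' := Hv; rewrite iterSr in Hu'; rewrite iterSr in Hv'.
have [c1 E1] := IH _ _ _ _ le1 Hu' Hv; have [c2 E2] := IH _ _ _ _ le2 Hu Hv'.
have [c3 E3] := IH _ _ _ _ le3 Hu' Hv'.
have := b_Nop_expand r s u v l0; rewrite E1 E2 E3 -!rmorphD => H.
have Q0 : q ^+ s != 0 by rewrite expf_neq0.
by have [] := sigma_fixed_const Q0 (nroot_exp q_nroot s0) H.
Qed.

Lemma pair_rel r s lam n n' u v : (0 < s)%N -> lam != 0 ->
  iter n (N r s lam) u = 0 -> iter n' (N (- r) s lam^-1) v = 0 ->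
  b (N r s lam u) v + b u (N (- r) s lam^-1 v) + b (N r s lam u) (N (- r) s lam^-1 v) = 0.
Proof.
move=> s0 l0 Hu Hv; have [c Hc] := pair_const s0 l0 Hu Hv.
have := b_Nop_expand r s u v l0; rewrite Hc sigma_const ?expf_neq0 // => /eqP.
by rewrite -{1}[constL c]addr0 (inj_eq (addrI _)) eq_sym => /eqP.
Qed.

Lemma iter_conj (f g h : V -> V) n u : (forall w, g (f w) = f (h w)) ->
  iter n g (f u) = f (iter n h u).
Proof. by move=> H; elim: n => // n /= ->. Qed.

(** Phi changes the eigenvalue lam by q^r, and t^m changes it by q^(s m) ([Nop_tz]); these are the
    two ways of moving lam within its class modulo powers of q. *)
Lemma Nop_Phi r s lam u : lam != 0 -> N r s (lam * q ^ r) (Phi u) = Phi (N r s lam u).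
Proof.
move=> l0; rewrite /Nop /Nhat (semilinB Phi_lin) (semilinZ Phi_lin); congr (_ - _).
rewrite -iterS -iterSr sigmaM // sigma_const // sigma_tz // mulrA -constLM.
by rewrite invfM invr_expz.
Qed.

Lemma Nop_tz r s lam m u : lam != 0 ->
  N r s (lam * (q ^+ s) ^ m) (tL k ^ m *: u) = tL k ^ m *: N r s lam u.
Proof.
move=> l0; have Qm : (q ^+ s) ^ m != 0 by rewrite expfz_neq0 ?expf_neq0.
rewrite /Nop /Nhat scalerBr (semilinZ (iterPhi_lin q_neq0 Phi_lin s)) !scalerA.
congr (_ *: _ - _); rewrite sigma_tz ?expf_neq0 // monomM.
by rewrite invfM -mulrA mulVf // mulr1 addrC mulrCA -(expfzDr _ _ (tL_neq0 k)).
Qed.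

Lemma GE_iterPhi r s lam i n u : lam != 0 -> iter n (N r s lam) u = 0 ->
  iter n (N r s (lam * (q ^ r) ^+ i)) (iter i Phi u) = 0.
Proof.
move=> l0 Hu; have qr : q ^ r != 0 by rewrite expfz_neq0.
rewrite (iter_conj (f := iter i Phi) (h := N r s lam)) => [|w].
  by rewrite Hu (semilin0 (iterPhi_lin q_neq0 Phi_lin i)).
elim: i => [|i IH]; first by rewrite mulr1.
by rewrite exprSr mulrA iterS Nop_Phi ?mulf_neq0 ?expf_neq0 // IH.
Qed.

Lemma GE_tz r s lam m n u : lam != 0 -> iter n (N r s lam) u = 0 ->
  iter n (N r s (lam * (q ^+ s) ^ m)) (tL k ^ m *: u) = 0.
Proof.
move=> l0 Hu; rewrite (iter_conj (f := fun w => tL k ^ m *: w) (h := N r s lam)).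
  by rewrite Hu scaler0.
by move=> w; apply: Nop_tz.
Qed.

(** Let X' be the orthogonal in X of the span of the Phi^i u. An eigenvector of X/X' lifts to a
    generalized eigenvector outside X', which pairs nontrivially with some Phi^i u; [pair_types]
    then identifies its type. *)
Lemma dual_vector X r s lam u : stable Phi X -> nondeg_on b X ->
  (0 < s)%N -> coprime `|r| s -> lam != 0 -> u \in X -> u != 0 -> N r s lam u = 0 ->
  exists v n, [/\ v \in X, iter n (N (- r) s lam^-1) v = 0 & b u v != 0].
Proof.
move=> sX ndX s0 cop l0 Xu u0 Nu.
have Phisu : iter s Phi u = (constL lam * tL k ^ r) *: u.
  move/eqP: Nu; rewrite subr_eq0 => /eqP {2}<-; rewrite /Nhat scalerA monomM.
  by rewrite mulfV // subrr constL1 mulr1 scale1r.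
have [Z HZ] := orth_family s (fun i => iter i Phi u).
pose X' := (X :&: Z)%VS.
have X'P x : x \in X' <-> x \in X /\ forall i, (i < s)%N -> b (iter i Phi u) x = 0.
  by rewrite memv_cap; split=> [/andP[-> /HZ]|[-> /HZ]].
have sX' : stable Phi X'.
  move=> x /X'P[Xx Hx]; apply/X'P; split=> [|[|i] lt]; first exact: sX.
    have Hs : b (iter s Phi u) (Phi x) = 0.
      by rewrite -(prednK s0) iterS b_Phi Hx ?sigma0 // prednK.
    move/eqP: Hs; rewrite Phisu bZl mulf_eq0 mulf_eq0 constL_eq0 (negbTE l0).
    by rewrite (negbTE (tLz_neq0 k r)) => /eqP.
  by rewrite iterS b_Phi Hx ?sigma0 // ltnW.
have leX' : (X' <= X)%VS by apply: capvSl.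
have neX' : X' != X.
  apply: contra u0 => /eqP E; apply/eqP; apply: ndX => // w.
  by rewrite -E => /X'P[_ /(_ 0%N s0)].
have [r1 [s1 [l1 [v [[s10 cop1 l10] [Xv X'v Nv]]]]]] :=
  quotient_eigenvector q_neq0 q_nroot Phi_lin Phi_inj sX' sX leX' neX'.
(* N v lies in X' and equals N x + e there; so v - x is killed by a power of N and is still outside
   X'. *)
have [x [e [n [X'x X'e He E]]]] :=
  stable_fitting k_char0 q_neq0 q_nroot Phi_lin Phi_inj r1 s10 l10 sX' Nv.
have HN1 := Nop_klin q_neq0 Phi_lin r1 s1 l1.
pose v1 := v - x.
have Nv1 : iter n.+1 (N r1 s1 l1) v1 = 0.
  by rewrite iterSr /v1 (klinB HN1) E addrC addKr.
have Xv1 : v1 \in X by rewrite memvB // (subvP leX').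
have X'v1 : v1 \notin X'.
  by apply: contra X'v => H; rewrite -[v](subrK x) memvD.
have [i lt bi] : exists2 i, (i < s)%N & b (iter i Phi u) v1 != 0.
  apply: NNPP => H; case/negP: X'v1; apply/X'P; split=> // i lt.
  by apply/eqP/negPn/negP => Hi; apply: H; exists i.
(* Applying Phi^(s-i) to both sides moves the pairing to Phi^s u, a nonzero multiple of u. *)
pose j := (s - i)%N; pose v2 := iter j Phi v1.
have b2 : b u v2 != 0.
  have : b (iter s Phi u) v2 != 0.
    rewrite -(subnK (ltnW lt)) iterD /v2 b_iterPhi.
    by rewrite -(sigma0 (expf_neq0 j q_neq0)) (inj_eq (sigma_inj (expf_neq0 j q_neq0))).
  by rewrite Phisu bZl mulf_eq0 negb_or => /andP[].
have l20 : l1 * (q ^ r1) ^+ j != 0 by rewrite mulf_neq0 ?expf_neq0 ?expfz_neq0.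
have Nv2 := GE_iterPhi j l10 Nv1.
have Nu1 : iter 1 (N r s lam) u = 0 by [].
have [Es Er [z Hz]] := pair_types s0 s10 cop cop1 l0 l20 Nu1 Nv2 b2.
(* The power of t brings the eigenvalue from its class to lam^-1 exactly. *)
exists (tL k ^ (- z) *: v2), n.+1; split.
- by apply/memvZ/iter_mem.
- have := GE_tz (- z) l20 Nv2; rewrite -Es Er.
  have -> : l1 * (q ^ (- r)) ^+ j * (q ^+ s) ^ (- z) = lam^-1; last by [].
  by rewrite -(invr_expz _ z) -Hz invfM mulrCA -Er mulfV ?mulr1.
by rewrite bZr mulf_neq0 ?tLz_neq0.
Qed.

End Pairing.

(** * The models *)

Section UnipotentRoot.
Variable k : closedFieldType.
Hypothesis k_char0 : [pchar k] =i pred0.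
Implicit Types (P R : {poly k}).

Lemma exprD_first_order (a c : {poly k}) s :
  exists S, (a + c) ^+ s = a ^+ s + a ^+ s.-1 * c *+ s + c ^+ 2 * S.
Proof.
elim: s => [|s [S IH]]; first by exists 0; rewrite !expr0 mulr0n mulr0 !addr0.
exists (a ^+ s.-1 *+ s + (a + c) * S); rewrite exprS IH /=.
case: s {IH} => [|s]; first by rewrite !expr0 !mulr0n !mul1r expr1; ring.
by rewrite [_ *+ s.+2]mulrS !(exprS a) [s.+1.-1]/=; ring.
Qed.

(** 1 + X h is the binomial series (1 + X)^(1/s) up to order d, lifted one degree at a time.
    Starting at order 2 ensures that corrections leave h_0 = 1/s untouched. *)
Lemma root_mod d s : (0 < s)%N -> exists h R : {poly k},
  h`_0 != 0 /\ (1 + 'X * h) ^+ s = 1 + 'X + 'X^d * R.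
Proof.
move=> s0; have sn : s%:R != 0 :> k by have /pcharf0P H := k_char0; rewrite H -lt0n.
suff H e : exists h R : {poly k},
    h`_0 = s%:R^-1 /\ (1 + 'X * h) ^+ s = 1 + 'X + 'X^(e.+2) * R.
  have [h [R [h0 E]]] := H d; exists h, ('X^2 * R).
  by rewrite h0 invr_eq0 sn E mulrA -exprD addn2.
elim: e => [|e [h [R [h0 E]]]].
  have [S HS] := exprD_first_order 1 ('X * (s%:R^-1)%:P) s.
  exists (s%:R^-1)%:P, ((s%:R^-1)%:P ^+ 2 * S); rewrite coefC eqxx; split=> //.
  rewrite HS !expr1n mul1r exprMn -!mulrA; congr (_ + _ + _).
  by rewrite -mulr_natr -mulrA -polyC_natr -polyCM mulVf // mulr1.
(* To first order the correction adds s c to the coefficient R_0 of X^(e+2), and c cancels it. *)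
pose c := - R`_0 / s%:R.
have [S HS] := exprD_first_order (1 + 'X * h) (c *: 'X^(e.+2)) s.
have [R' HR'] : exists R' : {poly k}, R + (1 + 'X * h) ^+ s.-1 * c%:P *+ s = 'X * R'.
  have : root (R + (1 + 'X * h) ^+ s.-1 * c%:P *+ s) 0.
    rewrite rootE hornerD hornerMn hornerM horner_exp !hornerE /= expr1n mul1r horner_coef0.
    by rewrite /c -[X in _ + X]mulr_natr divfK // subrr.
  by move=> /factor_theorem[R' ->]; exists R'; rewrite subr0 mulrC.
exists (h + c *: 'X^(e.+1)), (R' + 'X^(e.+1) * (c ^+ 2)%:P * S); split.
  by rewrite coefD coefZ coefXn mulr0 addr0.
have -> : 1 + 'X * (h + c *: 'X^(e.+1)) = 1 + 'X * h + c *: 'X^(e.+2).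
  by rewrite mulrDr -scalerAr -exprS addrA.
rewrite HS E -!mul_polyC.
have -> : 'X^(e.+3) * (R' + 'X^(e.+1) * (c ^+ 2)%:P * S) =
    'X^(e.+2) * ('X * R') + (c%:P * 'X^(e.+2)) ^+ 2 * S.
  by rewrite polyC_exp !exprS; ring.
by rewrite -HR'; ring.
Qed.

(* [P a c] plays the role of (1+p)^(-c) p^a, where p is the nilpotent with (1+p)^s = 1 + 'X. *)
Lemma unipotent_root d s : (0 < s)%N -> exists P : nat -> nat -> {poly k},
  [/\ forall a c, exists P1, P a c = 'X^a * P1 /\ P1`_0 != 0,
      forall a c, exists R, P a c = P a c.+1 + P a.+1 c.+1 + 'X^d * R
    & forall a, exists R, (1 + 'X) * P a s = P a 0%N + 'X^d * R].
Proof.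
move=> s0; have [h [R [h0 E]]] := root_mod d s0.
(* H is the geometric series inverting 1 + p modulo X^d. *)
pose p := 'X * h; pose H := \sum_(i < d) (- p) ^+ i.
have pd : p ^+ d = 'X^d * h ^+ d by rewrite exprMn.
have HH : H * (1 + p) = 1 + 'X^d * (- (- h) ^+ d).
  have := subrX1 (- p) d; rewrite -/H => E1.
  have -> : H * (1 + p) = - ((- p) ^+ d - 1) by rewrite E1 mulrC -mulNr opprB opprK.
  by rewrite /p -mulrN exprMn opprB mulrN.
(* For d = 0 the congruences are void and H is an empty sum, so powers of X are taken instead. *)
have [->|d0] := posnP d.
  exists (fun a _ => 'X^a); split=> [a _|a _|a].
  - by exists 1; rewrite mulr1 coef1 oner_neq0.
  - by exists (- 'X^(a.+1)); rewrite expr0 mul1r addrK.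
  by exists 'X^(a.+1); rewrite expr0 mul1r mulrDl mul1r exprS.
have H0 : H`_0 != 0.
  have := congr1 (fun P : {poly k} => P`_0) HH.
  rewrite /= coef0M coefD coef1 coefXM addr0 mulr1 coefD coef1 coefXnM d0 addr0 => ->.
  exact: oner_neq0.
exists (fun a c => H ^+ c * p ^+ a); split.
- move=> a c; exists (H ^+ c * h ^+ a); rewrite exprMn mulrCA; split=> //.
  by rewrite -horner_coef0 hornerM !horner_exp !horner_coef0 mulf_neq0 ?expf_neq0.
- move=> a c; exists ((- h) ^+ d * H ^+ c * p ^+ a).
  have -> : H ^+ c.+1 * p ^+ a + H ^+ c.+1 * p ^+ a.+1 = H * (1 + p) * (H ^+ c * p ^+ a).
    by rewrite !exprS; ring.
  by rewrite HH; ring.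
move=> a; have -> : 1 + 'X = (1 + p) ^+ s - 'X^d * R by rewrite E addrK.
have [R2 HR2] : exists R2, (1 + p) ^+ s * H ^+ s = 1 + 'X^d * R2.
  rewrite -exprMn mulrC HH.
  have [S ->] := exprD_first_order 1 ('X^d * (- (- h) ^+ d)) s.
  exists ((- (- h) ^+ d) *+ s + 'X^d * (- (- h) ^+ d) ^+ 2 * S).
  by rewrite !expr1n mul1r exprMn; ring.
exists (R2 * p ^+ a - R * H ^+ s * p ^+ a).
by rewrite mulrBl (mulrA ((1 + p) ^+ s)) HR2 expr0 mul1r; ring.
Qed.

End UnipotentRoot.

Section PolynomialAction.
Variables (k : closedFieldType) (V : vectType (laurent k)) (f : V -> V).
Hypothesis Hf : klin f.
Implicit Types (P R : {poly k}) (v : V).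

(** P(f) v, for k[X] acting through the k-linear map f. *)
Definition pact P v := \sum_(i < size P) constL P`_i *: iter i f v.

Lemma pactE n P v : (size P <= n)%N -> pact P v = \sum_(i < n) constL P`_i *: iter i f v.
Proof.
move=> le; rewrite /pact (big_ord_widen n (fun i => constL P`_i *: iter i f v)) //.
rewrite big_mkcond; apply: eq_bigr => i _; case: ltnP => // le2.
by rewrite nth_default // rmorph0 scale0r.
Qed.

Lemma pactD P R v : pact (P + R) v = pact P v + pact R v.
Proof.
have leD := size_polyD P R.
rewrite (pactE _ leD) (pactE v (leq_maxl (size P) (size R))) (pactE v (leq_maxr (size P) (size R))).
by rewrite -big_split; apply: eq_bigr => i _; rewrite coefD rmorphD scalerDl.
Qed.

Lemma pactX P v : pact ('X * P) v = f (pact P v).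
Proof.
have leX : (size ('X * P)%R <= (size P).+1)%N.
  by rewrite mulrC (leq_trans (size_polyMleq _ _)) // size_polyX addn2.
rewrite (pactE _ leX) big_ord_recl coefXM rmorph0 scale0r add0r (klin_sum Hf).
by apply: eq_bigr => i _; rewrite coefXM /= (klinZ Hf).
Qed.

Lemma pactXn n P v : pact ('X^n * P) v = iter n f (pact P v).
Proof.
by elim: n => [|n IH]; rewrite ?mul1r // exprS -mulrA pactX IH.
Qed.

Lemma pact_commute P v : f (pact P v) = pact P (f v).
Proof.
rewrite /pact (klin_sum Hf); apply: eq_bigr => i _.
by rewrite (klinZ Hf) -iterS iterSr.
Qed.

Lemma pact_iter n P v : iter n f (pact P v) = pact P (iter n f v).
Proof. by elim: n => //= n ->; rewrite pact_commute. Qed.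

Lemma pact_0 P : pact P 0 = 0.
Proof. by rewrite /pact big1 // => i _; rewrite (klin0 (klin_iter Hf i)) scaler0. Qed.

Lemma pact_mod d P R v : iter d f v = 0 -> pact (P + 'X^d * R) v = pact P v.
Proof. by move=> Hv; rewrite pactD pactXn pact_iter Hv pact_0 addr0. Qed.

End PolynomialAction.

Section FamilyMap.
Variables (k : closedFieldType) (V : vectType (laurent k)) (d s : nat).

Definition family_map (x : nat -> nat -> V) (X : 'M[laurent k]_(d, s)) : V :=
  \sum_(a < d) \sum_(c < s) X a c *: x a c.

Lemma family_map_linear x : linear (family_map x).
Proof.
move=> e X Y; rewrite /family_map scaler_sumr -big_split; apply: eq_bigr => a _.
rewrite scaler_sumr -big_split; apply: eq_bigr => c _.
by rewrite !mxE scalerDl scalerA.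
Qed.
End FamilyMap.

Section Model.
Variables (k : closedFieldType) (q : k) (V : vectType (laurent k)) (Phi : V -> V).
Hypotheses (q_neq0 : q != 0) (Phi_lin : semilin q Phi).
Variables (d s : nat) (r : int) (lam : k) (P : nat -> nat -> {poly k}).
Hypotheses (s_gt0 : (0 < s)%N) (lam_neq0 : lam != 0).
Hypothesis P_X : forall a c, exists P1, P a c = 'X^a * P1 /\ P1`_0 != 0.
Hypothesis P_step : forall a c, exists R, P a c = P a c.+1 + P a.+1 c.+1 + 'X^d * R.
Hypothesis P_wrap : forall a, exists R, (1 + 'X) * P a s = P a 0%N + 'X^d * R.
Local Notation N := (Nop Phi r s lam).
Local Notation K := (laurent k).

(** The image of x_a (x) y_c when w is that of x_0 (x) y_0. With Phi = (1 + p) (x) T, this tensor is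
    Phi^c (1 + p)^(-c) p^a applied to x_0 (x) y_0, and p is a polynomial in N because (1 + p)^s = 1
    + N. *)
Definition model_vec w a c : V := iter c Phi (pact N (P a c) w).

Definition model_map w (X : 'M[K]_(d, s)) : V := family_map (model_vec w) X.

Lemma model_map_mem (U : {vspace V}) w X : stable Phi U -> w \in U -> model_map w X \in U.
Proof.
move=> sU Uw; apply: memv_suml => a _; apply: memv_suml => c _.
apply/memvZ/iter_mem => //; apply: memv_suml => i _; apply/memvZ/iter_mem => // u.
exact: Nop_mem.
Qed.

Section Nilpotent.
Variable w : V.
Hypothesis Nw : iter d N w = 0.
Let HN : klin N := Nop_klin q_neq0 Phi_lin r s lam.

Lemma model_vec_step a c :
  Phi (model_vec w a c) = model_vec w a c.+1 + model_vec w a.+1 c.+1.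
Proof.
have [R E] := P_step a c.
rewrite /model_vec E (pact_mod HN _ _ Nw) pactD.
rewrite (semilinD (iterPhi_lin q_neq0 Phi_lin c)) (semilinD Phi_lin).
by rewrite -!iterS.
Qed.

Lemma model_vec_wrap a :
  model_vec w a s = (constL lam * tL k ^ r) *: model_vec w a 0.
Proof.
have [R E] := P_wrap a.
have Hs y : iter s Phi y = (constL lam * tL k ^ r) *: (y + N y).
  by rewrite -NhatE /Nhat scalerA monomM mulfV // subrr constL1 mulr1 scale1r.
rewrite /model_vec Hs /= -[P a 0%N as X in pact _ X _](addrK ('X^d * R)) -E.
congr (_ *: _); rewrite -[RHS](pact_mod HN _ R Nw) subrK mulrDl mul1r pactD.
by rewrite (pactX HN).
Qed.

Lemma model_vec_top a c : (d <= a)%N -> model_vec w a c = 0.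
Proof.
move=> le; have [P1 [E _]] := P_X a c.
rewrite /model_vec E (pactXn HN) (pact_iter HN) (klin_iter_stop HN le Nw).
by rewrite (pact_0 HN) (semilin0 (iterPhi_lin q_neq0 Phi_lin c)).
Qed.

Lemma model_col a (c : 'I_s) :
  \sum_(c' < s) Vmx r s lam c c' *: model_vec w a c' = model_vec w a c.+1.
Proof.
case: (eqVneq c.+1 s) => [E|ne].
  rewrite (bigD1 (Ordinal s_gt0)) //= mxE E !eqxx big1 ?addr0 => [|c' ne'].
    by rewrite model_vec_wrap.
  rewrite mxE E eqxx; case: eqP => [H|]; last by rewrite scale0r.
  by case/eqP: ne'; apply: val_inj.
have lt : (c.+1 < s)%N by rewrite ltn_neqAle ne ltn_ord.
rewrite (bigD1 (Ordinal lt)) //= mxE (negbTE ne) eqxx big1 ?addr0 ?scale1r // => c' ne'.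
rewrite mxE (negbTE ne); case: eqP => [H|]; last by rewrite scale0r.
by case/eqP: ne'; apply: val_inj.
Qed.

Lemma model_row (i : 'I_d) c :
  \sum_(a < d) Jmx k d i a *: model_vec w a c = model_vec w i c + model_vec w i.+1 c.
Proof.
rewrite (bigD1 i) //= mxE eqxx scale1r; congr (_ + _).
have [lt|ge] := ltnP i.+1 d; last first.
  rewrite (model_vec_top c ge) big1 // => a ne; rewrite mxE.
  case: eqP => [H|_]; first by case/eqP: ne; apply: val_inj.
  case: eqP => [H|_]; last by rewrite scale0r.
  by have := ltn_ord a; rewrite H ltnNge ge.
rewrite (bigD1 (Ordinal lt)) /=; last by rewrite -val_eqE /= gtn_eqF.
rewrite mxE /= eqxx orbT scale1r big1 ?addr0 // => a /andP[ne ne']; rewrite mxE.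
case: eqP => [H|_]; first by case/eqP: ne; apply: val_inj.
case: eqP => [H|_]; last by rewrite scale0r.
by case/eqP: ne'; apply: val_inj.
Qed.

Lemma model_map_Phi X : model_map w (PhiModel q d s r lam X) = Phi (model_map w X).
Proof.
transitivity (\sum_(i < d) \sum_(c < s) sigma_q q (X i c) *: Phi (model_vec w i c)); last first.
  rewrite /model_map /family_map (semilin_sum Phi_lin); apply: eq_bigr => i _.
  rewrite (semilin_sum Phi_lin); apply: eq_bigr => c _.
  by rewrite (semilinZ Phi_lin).
have E (i : 'I_d) (c : 'I_s) : Phi (model_vec w i c) =
    \sum_(a < d) \sum_(c' < s) (Jmx k d i a * Vmx r s lam c c') *: model_vec w a c'.
  rewrite model_vec_step -model_row; apply: eq_bigr => a _.
  rewrite -model_col scaler_sumr; apply: eq_bigr => c' _; exact: scalerA.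
rewrite /model_map /family_map.
transitivity (\sum_(a < d) \sum_(c' < s) \sum_(i < d) \sum_(c < s)
    (sigma_q q (X i c) * (Jmx k d i a * Vmx r s lam c c')) *: model_vec w a c').
  apply: eq_bigr => a _; apply: eq_bigr => c' _.
  rewrite /PhiModel mxE exchange_big /= scaler_suml; apply: eq_bigr => c _.
  rewrite mxE mulr_suml scaler_suml; apply: eq_bigr => i _.
  rewrite [_^T _ _]mxE [map_mx _ _ _ _]mxE; congr (_ *: _).
  by rewrite -mulrA; apply: mulrCA.
rewrite (eq_bigr _ (fun a _ => exchange_big _ _ _ _ _ _)) exchange_big /=.
apply: eq_bigr => i _; rewrite (eq_bigr _ (fun a _ => exchange_big _ _ _ _ _ _)) exchange_big /=.
apply: eq_bigr => c _; rewrite E scaler_sumr; apply: eq_bigr => a _.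
by rewrite scaler_sumr; apply: eq_bigr => c' _; rewrite scalerA.
Qed.

Lemma model_space : exists A : {vspace V}, [/\ stable Phi A,
  forall v, v \in A <-> exists X, model_map w X = v
  & forall U : {vspace V}, stable Phi U -> w \in U -> (A <= U)%VS].
Proof.
have [g Hg] := linear_lfun (family_map_linear (d := d) (s := s) (model_vec w)).
have AP v : v \in limg g <-> exists X, model_map w X = v.
  split=> [/memv_imgP[X _ ->]|[X <-]]; first by exists X; rewrite Hg.
  by rewrite /model_map -Hg memv_img // memvf.
exists (limg g); split=> //.
  by move=> v /AP[X <-]; apply/AP; exists (PhiModel q d s r lam X); apply: model_map_Phi.
by move=> U sU Uw; apply/subvP => v /AP[X <-]; apply: model_map_mem.
Qed.

End Nilpotent.
End Model.

(** * Gram matrices and dual pairs *)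

Section Gram.
Variables (k : closedFieldType) (V : vectType (laurent k)) (b : V -> V -> laurent k).
Hypothesis b_bil : bilinear_form b.
Local Notation K := (laurent k).

Lemma family_map_delta d s x (a : 'I_d) (c : 'I_s) :
  family_map x (delta_mx a c) = x a c :> V.
Proof.
rewrite /family_map (bigD1 a) //= (bigD1 c) //= mxE !eqxx scale1r.
rewrite big1 => [|c' ne]; last by rewrite mxE (negbTE ne) andbF scale0r.
rewrite addr0 big1 ?addr0 // => a' ne; rewrite big1 // => c' _.
by rewrite mxE (negbTE ne) scale0r.
Qed.

Lemma b_family_map d s (x : nat -> nat -> V) (X : 'M[K]_(d, s)) v :
  b (family_map x X) v = \sum_(a < d) \sum_(c < s) X a c * b (x a c) v.
Proof.
rewrite (b_suml b_bil); apply: eq_bigr => a _; rewrite (b_suml b_bil).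
by apply: eq_bigr => c _; apply: bZl.
Qed.

(** Take the lowest row i with a nonzero entry in some column c. Against y_(d-1-i) of that column,
    higher rows and other columns vanish, and only the antidiagonal entry remains. *)
Lemma gram_left d s (x y : nat -> nat -> V) :
  (forall a c a' c', (c < s)%N -> (c' < s)%N -> c != c' \/ (d <= a + a')%N ->
     b (x a c) (y a' c') = 0) ->
  (forall a c a', (c < s)%N -> (a + a').+1 = d -> b (x a c) (y a' c) != 0) ->
  forall X : 'M[K]_(d, s), X != 0 -> exists Y : 'M[K]_(d, s), b (family_map x X) (family_map y Y) != 0.
Proof.
move=> h0 h1 X X0.
have [a [c Xac]] : exists a c, X a c != 0.
  apply: NNPP => H; case/eqP: X0; apply/matrixP => a c; rewrite mxE.
  by apply/eqP/negPn/negP => Xac; apply: H; exists a, c.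
case: (arg_minnP (P := fun i => X i c != 0) (fun i : 'I_d => i : nat) Xac) => i Xic imin.
have lt : (d - i.+1 < d)%N by have := ltn_ord i; lia.
exists (delta_mx (Ordinal lt) c); rewrite family_map_delta b_family_map.
have z i' c' : i' != i \/ c' != c -> X i' c' * b (x i' c') (y (d - i.+1)%N c) = 0.
  move=> H; have [Ec|nec] := eqVneq c' c; last by rewrite h0 ?mulr0 //; left.
  have ne : i' != i by case: H => //; rewrite Ec eqxx.
  have [X0'|X0'] := eqVneq (X i' c) 0; first by rewrite Ec X0' mul0r.
  rewrite h0 ?mulr0 //; right; move: (imin i' X0') (ltn_ord i) ne.
  by rewrite -val_eqE /=; clear; lia.
have -> : \sum_(i' < d) \sum_(c' < s) X i' c' * b (x i' c') (y (d - i.+1)%N c) =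
    X i c * b (x i c) (y (d - i.+1)%N c).
  rewrite (bigD1 i isT) (bigD1 c isT) big1 => [|c' ne]; last by apply: z; right.
  rewrite big1 => [|i' ne]; first exact: (etrans (addr0 _) (addr0 _)).
  by rewrite big1 // => c' _; apply: z; left.
apply: mulf_neq0; first exact: Xic.
by apply: h1 => //; have := ltn_ord i; clear; lia.
Qed.

(** The form embeds B into the dual of A and A into the dual of B, so the dimensions agree and the
    embeddings are onto. *)
Lemma dual_of_nondeg (A B : {vspace V}) :
  (forall u, u \in A -> (forall w, w \in B -> b w u = 0) -> u = 0) ->
  (forall w, w \in B -> (forall u, u \in A -> b w u = 0) -> w = 0) ->
  form_dual b A B.
Proof.
move=> HA HB.
have embed (b' : V -> V -> K) (A' B' : {vspace V}) : bilinear_form b' ->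
  (forall w, w \in B' -> (forall u, u \in A' -> b' w u = 0) -> w = 0) ->
  exists L : 'Hom(subvs_of B', 'Hom(subvs_of A', K^o)),
    (forall w a, L w a = b' (vsval w) (vsval a)) /\ lker L = 0%VS.
  move=> [bl br] H.
  have Hg (w : subvs_of B') : exists g : 'Hom(subvs_of A', K^o),
      g =1 (fun a => b' (vsval w) (vsval a)).
    by apply: linear_lfun => e u v; rewrite linearP br.
  pose l (w : subvs_of B') := epsilon (inhabits 0) (fun g : 'Hom(subvs_of A', K^o) =>
    g =1 (fun a => b' (vsval w) (vsval a))).
  have lE w a : l w a = b' (vsval w) (vsval a).
    exact: (epsilon_spec (inhabits 0) _ (Hg w)).
  have [L HL] : exists L : 'Hom(subvs_of B', 'Hom(subvs_of A', K^o)), L =1 l.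
    apply: linear_lfun => e u v; apply/lfunP => a.
    by rewrite add_lfunE scale_lfunE !lE linearP bl.
  exists L; split=> [w a|]; first by rewrite HL lE.
  apply/eqP; rewrite -subv0; apply/subvP => w; rewrite memv_ker memv0 => /eqP Lw.
  apply/eqP/val_inj; apply: H; first exact: subvsP.
  by move=> u Au; have := congr1 (fun g : 'Hom(_, _) => g (Subvs Au)) Lw; rewrite HL lE lfunE.
have [L [LE Lk]] := embed b A B b_bil HB.
have bil' : bilinear_form (fun u v => b v u) by case: b_bil.
have [L' [LE' Lk']] := embed (fun u v => b v u) B A bil' HA.
have dimH (A' : {vspace V}) : \dim {: 'Hom(subvs_of A', K^o)} = \dim A'.
  by rewrite dimvf /dim /= muln1.
have dimE (A' B' : {vspace V}) (l : 'Hom(subvs_of B', 'Hom(subvs_of A', K^o))) :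
    lker l = 0%VS -> \dim (limg l) = \dim B' /\ (\dim (limg l) <= \dim A')%N.
  move=> lk; have := limg_dim_eq (f := l) (U := fullv); rewrite lk capv0 => /(_ erefl) E.
  split; first by rewrite E dimvf.
  by rewrite -dimH dimvS // subvf.
move=> phi.
have Lfull : limg L = fullv.
  apply/eqP; rewrite eqEdim subvf /= (dimE _ _ _ Lk).1 dimH.
  by have [<- le] := dimE _ _ _ Lk'.
have := memvf phi; rewrite -Lfull => /memv_imgP[w _ Ew].
exists (vsval w); split; first by split=> [|a]; [exact: subvsP|rewrite -LE Ew].
move=> w' [Bw' Hw']; apply/eqP; rewrite -subr_eq0; apply/eqP; apply: HB.
  by rewrite memvB // subvsP.
move=> u Au; rewrite (bDl b_bil) (bNl b_bil) -[u]/(vsval (Subvs Au)) -LE -Ew Hw'.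
by rewrite subrr.
Qed.

End Gram.

(** * Self-dual chains *)

(** It reduces the vanishing of all <N^i w, N^j w> with i >= D to the column j = 0. *)
Lemma antitriangular_col (R : pzRingType) (beta : nat -> nat -> R) (d D : nat) :
  (forall i j, beta i.+1 j + beta i j.+1 + beta i.+1 j.+1 = 0) ->
  (forall i j, (d <= i)%N -> beta i j = 0) ->
  (forall i, (D <= i)%N -> beta i 0%N = 0) -> forall j i, (D <= i)%N -> beta i j = 0.
Proof.
move=> rel zero col; elim=> [|j IH] i leD; first exact: col.
move: {2}(d - i)%N (leqnn (d - i)) => m; elim: m i leD => [|m IHm] i leD le.
  by apply: zero; rewrite -subn_eq0 -leqn0.
have := rel i j; rewrite (IH i.+1 (leqW leD)) (IHm i.+1 (leqW leD)) ?add0r ?addr0 //.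
by move: le; clear; lia.
Qed.

Section SelfPairing.
Variables (k : closedFieldType) (V : vectType (laurent k)) (b : V -> V -> laurent k).
Hypotheses (k_char0 : [pchar k] =i pred0) (b_bil : bilinear_form b).
Variables (eps : k) (f : V -> V) (d : nat) (z : int) (X : {vspace V}).
Hypotheses (eps_sqr : eps ^+ 2 = 1) (b_sym : forall u v, b v u = constL eps * b u v).
Hypotheses (d_gt0 : (0 < d)%N) (Hf : klin f) (fX : forall u, u \in X -> f u \in X).
Let G u := u \in X /\ iter d f u = 0.
Hypothesis b_const : forall u v, G u -> G v -> exists c, b u v = tL k ^ z * constL c.
Hypothesis b_rel : forall u v, G u -> G v -> b (f u) v + b u (f v) + b (f u) (f v) = 0.
Implicit Types (u v w : V).

Lemma G_iter i u : G u -> G (iter i f u).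
Proof.
move=> [Xu Hu]; split; first exact: iter_mem.
by rewrite -iterD addnC iterD Hu (klin0 (klin_iter Hf i)).
Qed.

Lemma G_add u v c : G u -> G v -> G (u + constL c *: v).
Proof.
move=> [Xu Hu] [Xv Hv]; split; first by rewrite memvD ?memvZ.
by rewrite (klinD (klin_iter Hf d)) (klinZ (klin_iter Hf d)) Hu Hv scaler0 addr0.
Qed.

Lemma G_zero u v i j : G u -> (d <= i)%N -> b (iter i f u) (iter j f v) = 0.
Proof. by move=> [_ Hu] le; rewrite (klin_iter_stop Hf le Hu) (b0l b_bil). Qed.

Lemma self_rel u v i j : G u -> G v -> b (iter i.+1 f u) (iter j f v) +
  b (iter i f u) (iter j.+1 f v) + b (iter i.+1 f u) (iter j.+1 f v) = 0.
Proof. by move=> Gu Gv; apply: b_rel; apply: G_iter. Qed.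

Lemma self_zero u v i j : G u -> G v -> (d <= i + j)%N -> b (iter i f u) (iter j f v) = 0.
Proof.
move=> Gu Gv le.
apply: (antitriangular0 (d := d) (beta := fun i j => b (iter i f u) (iter j f v))) => //.
  by move=> i' j'; apply: self_rel.
by move=> i' j' le'; apply: G_zero.
Qed.

Lemma self_lead u v i j : G u -> G v -> (i + j).+1 = d ->
  b (iter i f u) (iter j f v) = (-1) ^+ j * b (iter (i + j) f u) v.
Proof.
move=> Gu Gv E.
apply: (antitriangular_lead (d := d) (beta := fun i j => b (iter i f u) (iter j f v))) => //.
  by move=> i' j'; apply: self_rel.
by move=> i' j' le'; apply: G_zero.
Qed.

(** Moving N^(d-1) across the pairing costs (-1)^(d-1), exchanging the arguments costs eps. The
    product of the signs decides between types (ii) and (iii). *)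
Lemma self_sym u v : G u -> G v ->
  b (iter d.-1 f v) u = constL (eps * (-1) ^+ d.-1) * b (iter d.-1 f u) v.
Proof.
move=> Gu Gv; rewrite b_sym constLM -mulrA; congr (_ * _).
have -> : constL ((-1) ^+ d.-1) = (-1) ^+ d.-1 :> laurent k by rewrite rmorphXn rmorphN1.
by rewrite -[RHS](self_lead (i := 0) Gu Gv) // prednK.
Qed.

Lemma two_neq0 : (2 : k) != 0.
Proof. by have /pcharf0P H := k_char0; rewrite H. Qed.

(** Polarization: if u and v are both isotropic for the symmetric form <N^(d-1) u, v>, then u + v is
    not, as 2 is invertible. *)
Lemma self_anisotropic u v : eps * (-1) ^+ d.-1 = 1 -> G u -> G v ->
  b (iter d.-1 f u) v != 0 -> exists2 w, G w & b (iter d.-1 f w) w != 0.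
Proof.
move=> E Gu Gv Huv.
have [Hu|Hu] := eqVneq (b (iter d.-1 f u) u) 0; last by exists u.
have [Hv|Hv] := eqVneq (b (iter d.-1 f v) v) 0; last by exists v.
exists (u + constL 1 *: v); first exact: G_add.
have Hvu := self_sym Gu Gv; rewrite E constL1 mul1r in Hvu.
have Hd := klin_iter Hf d.-1.
rewrite constL1 scale1r (klinD Hd) (bDl b_bil) !(bDr b_bil) Hu Hv Hvu add0r addr0.
rewrite -mulr2n -mulr_natl mulf_eq0 (negbTE Huv) orbF.
have -> : 2%:R = constL 2 :> laurent k by rewrite rmorph_nat.
by rewrite constL_eq0 two_neq0.
Qed.

(* The numbers <N^i w, w> vanish for parity reasons or are cancelled, for decreasing i, by adding
   to w a multiple of N^(d-1-i) v. *)
Lemma self_isotropic_adjust u v : eps * (-1) ^+ d.-1 = -1 -> G u -> G v ->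
  b (iter d.-1 f u) v != 0 ->
  exists w, [/\ G w, b (iter d.-1 f w) v != 0 & forall i j, b (iter i f w) (iter j f w) = 0].
Proof.
move=> E Gu Gv Huv.
suff H m : (m <= d)%N -> exists w, [/\ G w, b (iter d.-1 f w) v != 0 &
    forall i j, (d - m <= i)%N -> b (iter i f w) (iter j f w) = 0].
  have [w [Gw Hw Hi]] := H d (leqnn d).
  by exists w; split=> // i j; apply: Hi; rewrite subnn.
elim: m => [_|m IH lem].
  by exists u; split=> // i j; rewrite subn0 => le; apply: G_zero.
have [w [Gw Hw Hi]] := IH (ltnW lem).
pose n := (d - m.+1)%N.
have dmn : (d - m)%N = n.+1 by rewrite /n; move: lem; clear; lia.
have colP w1 : G w1 -> (forall i, (n <= i)%N -> b (iter i f w1) w1 = 0) ->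
    forall i j, (n <= i)%N -> b (iter i f w1) (iter j f w1) = 0.
  move=> Gw1 H i j; move: j i.
  apply: (antitriangular_col (d := d) (beta := fun i j => b (iter i f w1) (iter j f w1))) => //.
    by move=> i' j'; apply: self_rel.
  by move=> i' j' le'; apply: G_zero.
have lead : b w (iter n f w) = (-1) ^+ n * b (iter n f w) w.
  apply: (antitriangular_lead (d := n.+1) (beta := fun i j => b (iter i f w) (iter j f w)) _ _ (i := 0)) => //.
    by move=> i' j'; apply: self_rel.
  by move=> i' j' le'; apply: Hi; rewrite dmn.
have sgnL i : constL ((-1) ^+ i) = (-1) ^+ i :> laurent k by rewrite rmorphXn rmorphN1.
(* By [lead] and the symmetry of b, <N^n w, w> is multiplied by eps (-1)^n when its arguments are
   exchanged twice over; it vanishes unless eps = (-1)^n. *)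
have [En|En] := eqVneq eps ((-1) ^+ n); last first.
  exists w; split=> //; apply: colP => // i; rewrite leq_eqVlt => /orP[/eqP <-|lt].
    move: lead; rewrite b_sym -sgnL => /eqP; rewrite -subr_eq0 -mulrBl -rmorphB.
    by rewrite mulf_eq0 constL_eq0 subr_eq0 (negbTE En) => /eqP.
  by apply: (Hi i 0%N); rewrite dmn.
have mE : (n + m)%N = d.-1 by rewrite /n; move: lem; clear; lia.
(* So m is odd, hence positive: adding a multiple of N^m v leaves the top pairing with v unchanged,
   and the term quadratic in c vanishes. *)
have sm : (-1) ^+ m = -1 :> k.
  by rewrite -[RHS]E -mE exprD mulrA -En -expr2 eps_sqr mul1r.
have m0 : (0 < m)%N.
  rewrite lt0n; apply: contra_eq_neq sm => ->; rewrite expr0 -subr_eq0 opprK.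
  exact: two_neq0.
have [c1 H1] := b_const (G_iter n Gw) Gw.
have [c2 H2] := b_const (G_iter d.-1 Gw) Gv.
have c20 : c2 != 0 by apply: contraNneq Hw => c20; rewrite H2 c20 rmorph0 mulr0.
(* Both cross terms of <N^n w', w'> equal -c c2 t^z, so the condition on c is c1 - 2 c c2 = 0. *)
pose c := c1 / (2 * c2).
pose w' := w + constL c *: iter m f v.
have Gw' : G w' by apply: G_add => //; apply: G_iter.
have itw i : iter i f w' = iter i f w + constL c *: iter (i + m) f v.
  by rewrite (klinD (klin_iter Hf i)) (klinZ (klin_iter Hf i)) iterD.
exists w'; split; first exact: Gw'.
  have le : (d <= d.-1 + m)%N by move: m0 d_gt0; clear; lia.
  by rewrite itw (bDl b_bil) (bZl b_bil) (G_zero v 0 Gv le) mulr0 addr0.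
apply: colP => // i lei.
have Z1 : b (iter (i + m) f v) (iter m f v) = 0.
  by apply: self_zero => //; move: lei m0 mE d_gt0; clear; lia.
rewrite itw (bDl b_bil) /w' !(bDr b_bil) !(bZl b_bil) !(bZr b_bil) Z1 !mulr0 addr0.
move: lei; rewrite leq_eqVlt => /orP[/eqP <-|lt]; last first.
  have le : (d <= i + m)%N by move: lt mE d_gt0; clear; lia.
  have Z2 : b (iter (i + m) f v) w = 0 := G_zero w 0 Gv le.
  rewrite (self_zero Gw Gv le) Z2 mulr0 addr0 addr0.
  by apply: (Hi i 0%N); rewrite dmn.
have nmd : (n + m).+1 = d by rewrite mE prednK.
rewrite (self_lead Gw Gv nmd) mE (self_sym Gw Gv) E H1 H2 -sgnL sm.
have -> : constL (- 1) = -1 :> laurent k by rewrite rmorphN1.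
rewrite !mulN1r !mulrN -addrA -opprD (mulrCA (constL c)) -mulrDr -mulrBr -rmorphM -rmorphD -rmorphB.
by rewrite /c (_ : _ - _ = 0) ?rmorph0 ?mulr0 //; field; rewrite c20 two_neq0.
Qed.

End SelfPairing.

(** * Nondegenerate pieces *)

Lemma classical_max (Q : nat -> Prop) B : Q 0%N -> (forall n, Q n -> (n <= B)%N) ->
  exists m, Q m /\ forall n, Q n -> (n <= m)%N.
Proof.
move=> Q0 QB; pose D n : bool := if excluded_middle_informative (Q n) then true else false.
have DP n : D n <-> Q n by rewrite /D; case: excluded_middle_informative.
have exD : exists n, D n by exists 0%N; apply/DP.
have leD n : D n -> (n <= B)%N by move=> /DP/QB.
by case: (ex_maxnP exD leD) => m /DP Qm mmax; exists m; split=> // n /DP/mmax.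
Qed.

Section Pieces.
Variables (k : closedFieldType) (q : k) (V : vectType (laurent k)) (Phi : V -> V).
Variable b : V -> V -> laurent k.
Hypotheses (k_char0 : [pchar k] =i pred0).
Hypotheses (q_neq0 : q != 0) (q_nroot : forall n : nat, (0 < n)%N -> q ^+ n != 1).
Hypotheses (Phi_lin : semilin q Phi) (Phi_inj : injective Phi).
Hypothesis b_bil : bilinear_form b.
Hypothesis b_Phi : forall u w, b (Phi u) (Phi w) = sigma_q q (b u w).
Variable eps : k.
Hypothesis eps_sqr : eps ^+ 2 = 1.
Hypothesis b_sym : forall u v, b v u = constL eps * b u v.
Implicit Types (u v w : V) (X A B : {vspace V}) (r : int) (s : nat) (lam : k).
Local Notation N r s lam := (Nop Phi r s lam).

Lemma eps_neq0 : eps != 0.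
Proof. by have := oner_neq0 k; rewrite -eps_sqr expf_eq0. Qed.

Lemma b_sym_eq0 u v : (b v u == 0) = (b u v == 0).
Proof. by rewrite b_sym mulf_eq0 constL_eq0 (negbTE eps_neq0). Qed.

Section FamilyPair.
Variables (d s : nat) (x y : nat -> nat -> V) (A B : {vspace V}).
Hypothesis h0 : forall a c a' c', (c < s)%N -> (c' < s)%N -> c != c' \/ (d <= a + a')%N ->
     b (x a c) (y a' c') = 0.
Hypothesis h1 : forall a c a', (c < s)%N -> (a + a').+1 = d -> b (x a c) (y a' c) != 0.
Hypothesis xA : forall v, v \in A <-> exists X : 'M_(d, s), family_map x X = v.
Hypothesis yB : forall v, v \in B <-> exists X : 'M_(d, s), family_map y X = v.

Lemma family_left (X : 'M_(d, s)) : X != 0 -> exists2 w, w \in B & b (family_map x X) w != 0.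
Proof.
by move=> /(gram_left b_bil h0 h1)[Y HY]; exists (family_map y Y) => //; apply/yB; exists Y.
Qed.

Lemma family_right (X : 'M_(d, s)) : X != 0 -> exists2 w, w \in A & b w (family_map y X) != 0.
Proof.
have bil' : bilinear_form (fun u v => b v u) by case: b_bil.
move=> /(gram_left (x := y) (y := x) bil')[||Y HY].
- move=> a c a' c' lt lt' H; apply: h0 => //.
  by case: H => H; [left; rewrite eq_sym|right; rewrite addnC].
- by move=> a c a' lt E; apply: h1 => //; rewrite addnC.
by exists (family_map x Y) => //; apply/xA; exists Y.
Qed.

Lemma family_nondeg_left u : u \in A -> (forall w, w \in B -> b w u = 0) -> u = 0.
Proof.
move=> /xA[X <-] H; have [->|X0] := eqVneq X 0.
  by rewrite /family_map big1 // => a _; rewrite big1 // => c _; rewrite mxE scale0r.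
have [w Bw] := family_left X0; by rewrite -b_sym_eq0 H ?eqxx.
Qed.

Lemma family_nondeg_right w : w \in B -> (forall u, u \in A -> b w u = 0) -> w = 0.
Proof.
move=> /yB[X <-] H; have [->|X0] := eqVneq X 0.
  by rewrite /family_map big1 // => a _; rewrite big1 // => c _; rewrite mxE scale0r.
have [u Au] := family_right X0; by rewrite -b_sym_eq0 H ?eqxx.
Qed.

Lemma family_inj_left : injective (family_map x : 'M_(d, s) -> V).
Proof.
move=> X Y E; apply/eqP; rewrite -subr_eq0; apply/negPn/negP => /family_left[w _].
have -> : X - Y = -1 *: Y + X by rewrite scaleN1r addrC.
by rewrite family_map_linear E scaleN1r addNr (b0l b_bil) eqxx.
Qed.

Lemma family_inj_right : injective (family_map y : 'M_(d, s) -> V).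
Proof.
move=> X Y E; apply/eqP; rewrite -subr_eq0; apply/negPn/negP => /family_right[w _].
have -> : X - Y = -1 *: Y + X by rewrite scaleN1r addrC.
by rewrite family_map_linear E scaleN1r addNr (b0r b_bil) eqxx.
Qed.

Lemma family_isotropic (z : nat -> nat -> V) (C : {vspace V}) :
  (forall a c a' c', (c < s)%N -> (c' < s)%N -> b (z a c) (z a' c') = 0) ->
  (forall v, v \in C <-> exists X : 'M_(d, s), family_map z X = v) -> isotropic b C.
Proof.
move=> H HC u w /HC[X <-] /HC[Y <-].
rewrite (b_family_map b_bil) big1 // => a _; rewrite big1 // => c _.
rewrite (b_sumr b_bil) big1 ?mulr0 // => a' _; rewrite (b_sumr b_bil) big1 // => c' _.
by rewrite (bZr b_bil) H // mulr0.
Qed.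

Lemma hyperbolic_piece : isotropic b A -> isotropic b B ->
  [/\ directv (A + B), nondeg_on b (A + B) & form_dual b A B].
Proof.
move=> iA iB; split.
- apply/directv_addP/eqP; rewrite -subv0; apply/subvP => u; rewrite memv_cap memv0.
  case/andP => Au Bu; apply/eqP/(family_nondeg_left Au) => w Bw; exact: iB.
- move=> _ /memv_addP[u Au [v Bv ->]] H.
  have -> : u = 0.
    apply: (family_nondeg_left Au) => w Bw.
    have Hw : w \in (A + B)%VS by rewrite -[w]add0r memv_add ?mem0v.
    have := H w Hw; rewrite (bDl b_bil) (iB v w) // addr0 => /eqP.
    by rewrite -b_sym_eq0 => /eqP.
  rewrite add0r; apply: (family_nondeg_right Bv) => w Aw.
  have Hw : w \in (A + B)%VS by rewrite -[w]addr0 memv_add ?mem0v.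
  by have := H w Hw; rewrite (bDl b_bil) (iA u w) // add0r.
by apply: (dual_of_nondeg b_bil); [exact: family_nondeg_left|exact: family_nondeg_right].
Qed.
End FamilyPair.

Section ModelGram.
Variables (d s : nat) (r : int) (lam : k) (P : nat -> nat -> {poly k}).
Hypotheses (d_gt0 : (0 < d)%N) (s_gt0 : (0 < s)%N) (cop : coprime `|r| s) (lam_neq0 : lam != 0).
Hypothesis P_X : forall a c, exists P1, P a c = 'X^a * P1 /\ P1`_0 != 0.
Variables w w' : V.
Hypotheses (Nw : iter d (N r s lam) w = 0) (Nw' : iter d (N (- r) s lam^-1) w' = 0).
Hypothesis top : b (iter d.-1 (N r s lam) w) w' != 0.
Local Notation x := (model_vec Phi s r lam P w).
Local Notation y := (model_vec Phi s (- r) lam^-1 P w').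
Let HN := Nop_klin q_neq0 Phi_lin r s lam.
Let HN' := Nop_klin q_neq0 Phi_lin (- r) s lam^-1.

Lemma pact_kill f (Hf : klin f) n Q (u : V) : iter n f u = 0 -> iter n f (pact f Q u) = 0.
Proof. by move=> Hu; rewrite (pact_iter Hf) Hu (pact_0 Hf). Qed.

Lemma chain_rel n n' u u' i j : iter n (N r s lam) u = 0 ->
  iter n' (N (- r) s lam^-1) u' = 0 ->
  b (iter i.+1 (N r s lam) u) (iter j (N (- r) s lam^-1) u') +
  b (iter i (N r s lam) u) (iter j.+1 (N (- r) s lam^-1) u') +
  b (iter i.+1 (N r s lam) u) (iter j.+1 (N (- r) s lam^-1) u') = 0.
Proof.
move=> Hu Hu'.
have Hi : iter n (N r s lam) (iter i (N r s lam) u) = 0.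
  by rewrite -iterD; apply: (klin_iter_stop HN _ Hu); rewrite leq_addr.
have Hj : iter n' (N (- r) s lam^-1) (iter j (N (- r) s lam^-1) u') = 0.
  by rewrite -iterD; apply: (klin_iter_stop HN' _ Hu'); rewrite leq_addr.
exact: (pair_rel q_neq0 q_nroot b_bil b_Phi s_gt0 lam_neq0 Hi Hj).
Qed.

Lemma chain_zero n u u' i j : (d <= i + j)%N -> iter d (N r s lam) u = 0 ->
  iter n (N (- r) s lam^-1) u' = 0 ->
  b (iter i (N r s lam) u) (iter j (N (- r) s lam^-1) u') = 0.
Proof.
move=> le Hu Hu'.
apply: (antitriangular0 (d := d) (beta := fun i j => b (iter i (N r s lam) u) (iter j (N (- r) s lam^-1) u'))) => //.
  by move=> i' j'; apply: chain_rel Hu Hu'.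
by move=> i' j' le'; rewrite (klin_iter_stop HN le' Hu) (b0l b_bil).
Qed.

Lemma chain_lead n u u' i j : (i + j).+1 = d -> iter d (N r s lam) u = 0 ->
  iter n (N (- r) s lam^-1) u' = 0 ->
  b (iter i (N r s lam) u) (iter j (N (- r) s lam^-1) u') =
  (-1) ^+ j * b (iter (i + j) (N r s lam) u) u'.
Proof.
move=> E Hu Hu'.
apply: (antitriangular_lead (d := d) (beta := fun i j => b (iter i (N r s lam) u) (iter j (N (- r) s lam^-1) u'))) => //.
  by move=> i' j'; apply: chain_rel Hu Hu'.
by move=> i' j' le'; rewrite (klin_iter_stop HN le' Hu) (b0l b_bil).
Qed.

(** After cancelling the common power of Phi, the eigenvalues multiply to a power of q with exponent
    plus or minus r (c - c'). By [pair_types] a nonzero pairing makes s divide r (c - c'),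
    impossible for 0 < |c - c'| < s with r prime to s. *)
Lemma model_gram_off a c a' c' : (c < s)%N -> (c' < s)%N -> c != c' -> b (x a c) (y a' c') = 0.
Proof.
move=> lt lt' ne; apply/eqP/negPn/negP; rewrite /model_vec.
set u := pact _ _ w; set u' := pact _ _ w'.
have Hu : iter d (N r s lam) u = 0 by apply: (pact_kill HN).
have Hu' : iter d (N (- r) s lam^-1) u' = 0 by apply: (pact_kill HN').
have copN : coprime `|- r| s by rewrite abszN.
have lV0 : lam^-1 != 0 by rewrite invr_neq0.
have qr e : q ^ e != 0 by rewrite expfz_neq0.
have no_dvd j (z : int) : (0 < j < s)%N -> r * j%:Z = s%:Z * z -> False.
  move=> /andP[j0 js] E; have : (s %| `|r| * j)%N.
    by rewrite -[X in (_ %| _ * X)%N]/`|j%:Z|%N -abszM E abszM dvdn_mulr.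
  by rewrite Gauss_dvdr 1?coprime_sym // => /(dvdn_leq j0); rewrite leqNgt js.
have qE j z : q ^ (r * j%:Z) = (q ^+ s) ^ z -> r * j%:Z = s%:Z * z.
  by rewrite exprnP exprz_exp => /(expfz_inj q_neq0 q_nroot).
case: (ltngtP c c') ne => // ltc _ H.
- have : b u (iter (c' - c) Phi u') != 0.
    apply: contra H => /eqP H.
    by rewrite -(subnKC (ltnW ltc)) iterD (b_iterPhi q_neq0 b_Phi) H sigma0 ?expf_neq0.
  have Hv := GE_iterPhi q_neq0 Phi_lin (c' - c) lV0 Hu'.
  have l20 : lam^-1 * (q ^ (- r)) ^+ (c' - c) != 0 by rewrite mulf_neq0 ?expf_neq0.
  move=> /(pair_types q_neq0 Phi_lin b_bil b_Phi s_gt0 s_gt0 cop copN lam_neq0 l20 Hu Hv).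
  case=> _ _ [z]; rewrite mulrA mulfV // mul1r exprnP exprz_exp => E.
  apply: (no_dvd (c' - c)%N (- z)); first by lia.
  apply: qE; rewrite -[RHS]invr_expz -E invr_expz; congr (_ ^ _); lia.
have : b (iter (c - c') Phi u) u' != 0.
  apply: contra H => /eqP H.
  by rewrite -(subnKC (ltnW ltc)) iterD (b_iterPhi q_neq0 b_Phi) H sigma0 ?expf_neq0.
have Hv := GE_iterPhi q_neq0 Phi_lin (c - c') lam_neq0 Hu.
have l20 : lam * (q ^ r) ^+ (c - c') != 0 by rewrite mulf_neq0 ?expf_neq0.
move=> /(pair_types q_neq0 Phi_lin b_bil b_Phi s_gt0 s_gt0 cop copN l20 lV0 Hv Hu').
case=> _ _ [z]; rewrite mulrAC mulfV // mul1r exprnP exprz_exp => E.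
apply: (no_dvd (c - c')%N z); first by lia.
exact: qE.
Qed.

Lemma poly_head (Q : {poly k}) : exists R, Q = (Q`_0)%:P + 'X * R.
Proof.
have : root (Q - (Q`_0)%:P) 0 by rewrite rootE !hornerE horner_coef0 subrr.
by move=> /factor_theorem[R E]; exists R; rewrite -[LHS](subrK (Q`_0)%:P) E subr0 addrC mulrC.
Qed.

Lemma pact_const f c v : pact f c%:P v = constL c *: v.
Proof. by rewrite (pactE f v (size_polyC_leq1 c)) big_ord_recl big_ord0 addr0 coefC. Qed.

Lemma model_gram_same a a' c P1 P1' : P a c = 'X^a * P1 -> P a' c = 'X^a' * P1' ->
  b (x a c) (y a' c) = sigma_q (q ^+ c)
    (b (iter a (N r s lam) (pact (N r s lam) P1 w))
       (iter a' (N (- r) s lam^-1) (pact (N (- r) s lam^-1) P1' w'))).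
Proof.
move=> E E'; rewrite /model_vec (b_iterPhi q_neq0 b_Phi) E E'.
by rewrite (pactXn HN) (pactXn HN').
Qed.

Lemma model_gram0 a c a' c' : (c < s)%N -> (c' < s)%N -> c != c' \/ (d <= a + a')%N ->
  b (x a c) (y a' c') = 0.
Proof.
move=> lt lt' H; have [Ec|ne] := eqVneq c c'; last exact: model_gram_off.
case: H => [|le]; first by rewrite Ec eqxx.
have [P1 [E _]] := P_X a c; have [P1' [E' _]] := P_X a' c.
rewrite -Ec (model_gram_same E E') (chain_zero le (n := d)) ?sigma0 ?expf_neq0 //.
  exact: (pact_kill HN).
exact: (pact_kill HN').
Qed.

(** On the antidiagonal only the constant terms of P1 and P1' contribute, so the entry is a nonzero
    multiple of [top] twisted by sigma. *)
Lemma model_gram1 a c a' : (c < s)%N -> (a + a').+1 = d -> b (x a c) (y a' c) != 0.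
Proof.
move=> lt Ed; have [P1 [E P10]] := P_X a c; have [P1' [E' P1'0]] := P_X a' c.
have Ed' : (a + a')%N = d.-1 by rewrite -Ed.
have Qc : q ^+ c != 0 by rewrite expf_neq0.
rewrite (model_gram_same E E') -(sigma0 Qc) (inj_eq (sigma_inj Qc)).
have Hu := pact_kill HN P1 Nw; have Hu' := pact_kill HN' P1' Nw'.
rewrite (chain_lead Ed Hu Hu') Ed'; apply: mulf_neq0; first by rewrite signr_eq0.
have [R ER] := poly_head P1; have [R' ER'] := poly_head P1'.
have -> : iter d.-1 (N r s lam) (pact (N r s lam) P1 w) = constL P1`_0 *: iter d.-1 (N r s lam) w.
  rewrite [in LHS]ER pactD pact_const (pactX HN) (klinD (klin_iter HN _)) (klinZ (klin_iter HN _)).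
  by rewrite -iterSr prednK // (pact_kill HN) // addr0.
rewrite (bZl b_bil); apply: mulf_neq0; first by rewrite constL_eq0.
rewrite ER' pactD pact_const (pactX HN').
rewrite (bDr b_bil) (bZr b_bil).
have -> : b (iter d.-1 (N r s lam) w) (N (- r) s lam^-1 (pact (N (- r) s lam^-1) R' w')) = 0.
  apply: (chain_zero (n := d) (i := d.-1) (j := 1) (u' := pact (N (- r) s lam^-1) R' w')) => //.
    by rewrite addn1 prednK.
  exact: (pact_kill HN').
by rewrite addr0; apply: mulf_neq0; first by rewrite constL_eq0.
Qed.

End ModelGram.

(** * Chains of maximal length and their duals *)

Section Chains.
Variables (X : {vspace V}) (s : nat).
Hypotheses (sX : stable Phi X) (ndX : nondeg_on b X) (s_gt0 : (0 < s)%N).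

Lemma first_kill r lam n i u : iter n (N r s lam) u = 0 -> iter i (N r s lam) u != 0 ->
  exists e, [/\ (i < e)%N, iter e (N r s lam) u = 0 & iter e.-1 (N r s lam) u != 0].
Proof.
move=> Hu Hi; have HN := Nop_klin q_neq0 Phi_lin r s lam.
have ex : exists n, iter n (N r s lam) u == 0 by exists n; rewrite Hu.
case: (ex_minnP ex) => e /eqP He emin.
have lt : (i < e)%N.
  by rewrite ltnNge; apply: contra Hi => le; rewrite (klin_iter_stop HN le He).
exists e; split=> //; apply/negP => /emin; case: e lt {He emin} => //= e _.
by rewrite ltnn.
Qed.

Lemma chain_dual r lam e w : coprime `|r| s -> lam != 0 -> w \in X ->
  (0 < e)%N -> iter e (N r s lam) w = 0 -> iter e.-1 (N r s lam) w != 0 ->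
  exists w' n, [/\ w' \in X, iter n (N (- r) s lam^-1) w' = 0
    & b (iter e.-1 (N r s lam) w) w' != 0].
Proof.
move=> cop l0 Xw e0 He He1; apply: (dual_vector k_char0 q_neq0 q_nroot Phi_lin Phi_inj b_bil b_Phi) => //.
  by apply: iter_mem => // u; apply: Nop_mem.
by rewrite -iterS prednK.
Qed.

(** The Gram matrix of the chain against the dual chain is antitriangular, so the chain is free over
    k((t)) and no longer than the dimension of V. *)
Lemma chain_bound r lam n i w : coprime `|r| s -> lam != 0 -> w \in X ->
  iter n (N r s lam) w = 0 -> iter i (N r s lam) w != 0 -> (i <= \dim {:V})%N.
Proof.
move=> cop l0 Xw Hn Hi; have [e [lt He He1]] := first_kill Hn Hi.
have e0 : (0 < e)%N by apply: leq_ltn_trans lt.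
have [w' [n' [Xw' Hw' Hb]]] := chain_dual cop l0 Xw e0 He He1.
pose x (a c : nat) := iter a (N r s lam) w.
pose y (a c : nat) := iter a (N (- r) s lam^-1) w'.
have h0 a c a' c' : (c < 1)%N -> (c' < 1)%N -> c != c' \/ (e <= a + a')%N -> b (x a c) (y a' c') = 0.
  rewrite !ltnS !leqn0 => /eqP -> /eqP ->; case=> [|le]; first by rewrite eqxx.
  exact: (chain_zero s_gt0 l0 le He Hw').
have h1 a c a' : (c < 1)%N -> (a + a').+1 = e -> b (x a c) (y a' c) != 0.
  move=> _ E; rewrite /x /y (chain_lead s_gt0 l0 E He Hw').
  have -> : (a + a')%N = e.-1 by rewrite -E.
  by apply: mulf_neq0; first by rewrite signr_eq0.
have finj : forall Y : 'M_(e, 1), family_map x Y = 0 -> Y = 0.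
  move=> Y HY; apply/eqP/negPn/negP => /(gram_left b_bil h0 h1)[Z].
  by rewrite HY (b0l b_bil) eqxx.
have [g Hg] := linear_lfun (family_map_linear (d := e) (s := 1) x).
have lk : lker g = 0%VS.
  apply/eqP; rewrite -subv0; apply/subvP => Y; rewrite memv_ker memv0 Hg => /eqP HY.
  exact/eqP/finj.
have := limg_dim_eq (f := g) (U := fullv); rewrite lk capv0 => /(_ erefl) E.
have := dimvS (subvf (limg g)); rewrite E dimvf /dim /= muln1 => le.
exact: ltnW (leq_trans lt le).
Qed.

(** The maximal d for N also bounds the chains of N': if N'^(e-1) w1 is nonzero with e > d, a dual
    vector v has <w1, N^(e-1) v> nonzero up to sign, although N^d v = 0. *)
Lemma chain_max r lam u : coprime `|r| s -> lam != 0 -> u \in X -> u != 0 -> N r s lam u = 0 ->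
  exists d w, [/\ (0 < d)%N, w \in X,
    iter d (N r s lam) w = 0 /\ iter d.-1 (N r s lam) w != 0,
    forall w1 n, w1 \in X -> iter n (N r s lam) w1 = 0 -> iter d (N r s lam) w1 = 0
  & forall w1 n, w1 \in X -> iter n (N (- r) s lam^-1) w1 = 0 -> iter d (N (- r) s lam^-1) w1 = 0].
Proof.
move=> cop l0 Xu u0 Nu.
pose Q i := exists w n, [/\ w \in X, iter n (N r s lam) w = 0 & iter i (N r s lam) w != 0].
have Q0 : Q 0%N by exists u, 1%N.
have QB i : Q i -> (i <= \dim {:V})%N.
  by move=> [w [n [Xw Hn Hi]]]; apply: chain_bound Hn Hi.
have [m [[w [n [Xw Hn Hm]]] mmax]] := classical_max Q0 QB.
have kill w1 n1 : w1 \in X -> iter n1 (N r s lam) w1 = 0 -> iter m.+1 (N r s lam) w1 = 0.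
  move=> Xw1 Hw1; apply/eqP/negPn/negP => H.
  have /mmax : Q m.+1 by exists w1, n1.
  by rewrite ltnn.
exists m.+1, w; split=> //; first by split=> //; apply: kill Hn.
move=> w1 n1 Xw1 Hw1; apply/eqP/negPn/negP => H.
have [e [lt He He1]] := first_kill Hw1 H.
have e0 : (0 < e)%N by apply: leq_ltn_trans lt.
have lV0 : lam^-1 != 0 by rewrite invr_neq0.
have copN : coprime `|- r| s by rewrite abszN.
have [v [n' [Xv Hv Hb]]] := chain_dual copN lV0 Xw1 e0 He He1.
have E : (0 + e.-1).+1 = e by rewrite add0n prednK.
have := chain_lead s_gt0 lV0 E He Hv; rewrite add0n /=.
have Hv' := Hv; rewrite opprK invrK in Hv'.
have -> : iter e.-1 (N (- - r) s lam^-1^-1) v = 0.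
  rewrite opprK invrK; apply: (klin_iter_stop (Nop_klin q_neq0 Phi_lin r s lam) _ (kill v n' Xv Hv')).
  by rewrite -ltnS prednK.
rewrite (b0r b_bil) => /esym/eqP; rewrite mulf_eq0 signr_eq0 /=.
by rewrite (negbTE Hb).
Qed.

End Chains.

Lemma stable_submodule U : stable Phi U -> Dq_submodule Phi U.
Proof. by move=> sU; split=> //; apply: semilin_surj_on q_neq0 Phi_lin Phi_inj sU. Qed.

Lemma stable_add A B : stable Phi A -> stable Phi B -> stable Phi (A + B).
Proof.
move=> sA sB _ /memv_addP[u Au [v Bv ->]].
by rewrite (semilinD Phi_lin) memv_add ?sA ?sB.
Qed.

(** * Existence of one nondegenerate piece *)

Section PieceTypes.
Variables (X : {vspace V}) (symp : bool).
Hypotheses (sX : stable Phi X) (ndX : nondeg_on b X).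
Hypothesis epsE : eps = if symp then -1 else 1.

Definition piece U := [/\ (U <= X)%VS, U != 0%VS, stable Phi U, nondeg_on b U
  & type_i q Phi b U \/ type_ii q symp Phi b U \/ type_iii q symp Phi U].

Section FixedShape.
Variables (d s : nat) (P : nat -> nat -> {poly k}).
Hypotheses (d_gt0 : (0 < d)%N) (s_gt0 : (0 < s)%N).
Hypothesis P_X : forall a c, exists P1, P a c = 'X^a * P1 /\ P1`_0 != 0.
Hypothesis P_step : forall a c, exists R, P a c = P a c.+1 + P a.+1 c.+1 + 'X^d * R.
Hypothesis P_wrap : forall a, exists R, (1 + 'X) * P a s = P a 0%N + 'X^d * R.

Lemma model_exists r lam w : lam != 0 -> w \in X -> iter d (N r s lam) w = 0 ->
  exists A : {vspace V}, [/\ stable Phi A, (A <= X)%VS,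
    forall v, v \in A <-> exists Y : 'M_(d, s), family_map (model_vec Phi s r lam P w) Y = v
  & injective (family_map (model_vec Phi s r lam P w) : 'M_(d, s) -> V) ->
    Dq_iso_model q Phi A d s r lam].
Proof.
move=> l0 Xw Hw.
have [A [sA HA leA]] := model_space q_neq0 Phi_lin s_gt0 l0 P_X P_step P_wrap Hw.
exists A; split=> //; first exact: leA.
move=> inj; exists (model_map Phi r lam P w); split=> //.
  exact: family_map_linear.
exact: (model_map_Phi q_neq0 Phi_lin s_gt0 l0 P_X P_step P_wrap Hw).
Qed.

Lemma model_vec_GE r lam w a c : lam != 0 -> iter d (N r s lam) w = 0 ->
  iter d (N r s (lam * (q ^ r) ^+ c)) (model_vec Phi s r lam P w a c) = 0.
Proof.
move=> l0 Hw; apply: (GE_iterPhi q_neq0 Phi_lin _ l0).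
exact: (pact_kill (Nop_klin q_neq0 Phi_lin r s lam)).
Qed.

(** A model that is not isotropic pairs with itself, so [pair_types] gives r = -r and lam^2 in
    q^Z. *)
Lemma self_types r lam w a c a' c' : coprime `|r| s -> lam != 0 ->
  iter d (N r s lam) w = 0 -> (c < s)%N -> (c' < s)%N ->
  b (model_vec Phi s r lam P w a c) (model_vec Phi s r lam P w a' c') != 0 ->
  r = 0 /\ in_Eq2 q lam.
Proof.
move=> cop l0 Hw lt lt' Hb.
have l0' i : lam * (q ^ r) ^+ i != 0 by rewrite mulf_neq0 ?expf_neq0 ?expfz_neq0.
have [_ Er [z Hz]] := pair_types q_neq0 Phi_lin b_bil b_Phi s_gt0 s_gt0 cop cop
  (l0' c) (l0' c') (model_vec_GE a c l0 Hw) (model_vec_GE a' c' l0 Hw) Hb.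
have r0 : r = 0 by move: Er; clear; lia.
split=> //; exists (s%:Z * z); move: Hz.
by rewrite r0 expr0z !expr1n !mulr1 exprnP exprz_exp -expr2.
Qed.

Lemma in_Eq2_inv lam : in_Eq2 q lam^-1 -> in_Eq2 q lam.
Proof. by move=> [z Hz]; exists (- z); rewrite -invr_expz -Hz exprVn invrK. Qed.

Lemma nonzero_space (x : nat -> nat -> V) A (y : V) :
  (forall v, v \in A <-> exists Y : 'M_(d, s), family_map x Y = v) ->
  b (x 0%N 0%N) y != 0 -> A != 0%VS.
Proof.
move=> HA Hb; apply: contraNneq Hb => A0.
have : x 0%N 0%N \in A.
  apply/HA; exists (delta_mx (Ordinal d_gt0) (Ordinal s_gt0)).
  by rewrite family_map_delta.
by rewrite A0 memv0 => /eqP ->; rewrite (b0l b_bil).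
Qed.

Lemma piece_of_pair r lam w w' : coprime `|r| s -> lam != 0 -> w \in X -> w' \in X ->
  iter d (N r s lam) w = 0 -> iter d (N (- r) s lam^-1) w' = 0 ->
  b (iter d.-1 (N r s lam) w) w' != 0 -> ~ in_Eq2 q lam \/ r != 0 ->
  exists U, piece U.
Proof.
move=> cop l0 Xw Xw' Hw Hw' Hb nE.
have lV0 : lam^-1 != 0 by rewrite invr_neq0.
have copN : coprime `|- r| s by rewrite abszN.
have [A [sA AX AP isoA]] := model_exists l0 Xw Hw.
have [B [sB BX BP isoB]] := model_exists lV0 Xw' Hw'.
have h0 := model_gram0 d_gt0 s_gt0 cop l0 P_X Hw Hw' Hb.
have h1 := model_gram1 d_gt0 s_gt0 l0 P_X Hw Hw' Hb.
have isoAB : isotropic b A /\ isotropic b B.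
  split.
    apply: (family_isotropic _ AP) => a c a' c' lt lt'.
    apply/eqP/negPn/negP => /(self_types cop l0 Hw lt lt')[r0 E2].
    by case: nE => //; rewrite r0 eqxx.
  apply: (family_isotropic _ BP) => a c a' c' lt lt'.
  apply/eqP/negPn/negP => /(self_types copN lV0 Hw' lt lt')[/eqP r0 /in_Eq2_inv E2].
  by rewrite oppr_eq0 in r0; case: nE => //; rewrite r0.
have [dirAB ndAB dual] := hyperbolic_piece h0 h1 AP BP isoAB.1 isoAB.2.
exists (A + B)%VS; split=> //.
- by rewrite subv_add AX BX.
- have E : (0 + d.-1).+1 = d by rewrite add0n prednK.
  have := nonzero_space AP (h1 0%N 0%N d.-1 s_gt0 E).
  by apply: contraNneq => AB0; rewrite -subv0 -AB0 addvSl.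
- exact: stable_add.
left; exists d, s, r, lam, A, B; split; first by split.
split; first by split=> //; apply: stable_submodule.
split=> //; split=> //.
  exact/isoA/(family_inj_left h0 h1 BP).
exact/isoB/(family_inj_right h0 h1 AP).
Qed.

End FixedShape.

Section SelfDual.
Variables (d : nat) (lam : k) (z : int) (P : nat -> nat -> {poly k}).
Hypotheses (d_gt0 : (0 < d)%N) (lam_neq0 : lam != 0) (lam_sqr : lam ^+ 2 = q ^ z).
Hypothesis P_X : forall a c, exists P1, P a c = 'X^a * P1 /\ P1`_0 != 0.
Hypothesis P_step : forall a c, exists R, P a c = P a c.+1 + P a.+1 c.+1 + 'X^d * R.
Hypothesis P_wrap : forall a, exists R, (1 + 'X) * P a 1%N = P a 0%N + 'X^d * R.
Local Notation f := (Nop Phi 0 1 lam).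
Local Notation f' := (Nop Phi (- 0) 1 lam^-1).
Local Notation tz := (tL k ^ (- z)).
Let Hf : klin f := Nop_klin q_neq0 Phi_lin 0 1 lam.
Let G u := u \in X /\ iter d f u = 0.

(* As lam^2 = q^z, multiplication by t^(-z) carries the lam-chains to the lam^-1-chains. *)
Lemma twist u : f' (tz *: u) = tz *: f u.
Proof.
rewrite oppr0; have := Nop_tz q_neq0 Phi_lin 0 1 (- z) u lam_neq0.
have -> // : lam * (q ^+ 1) ^ (- z) = lam^-1.
by rewrite expr1 -invr_expz -lam_sqr invfM mulrA mulfV // mul1r.
Qed.

Lemma iter_twist n u : iter n f' (tz *: u) = tz *: iter n f u.
Proof. by apply: (iter_conj (f := fun w => tz *: w)) => w; apply: twist. Qed.

Lemma twist_kill u : iter d f u = 0 -> iter d f' (tz *: u) = 0.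
Proof. by move=> Hu; rewrite iter_twist Hu scaler0. Qed.

Lemma model_vec_twist u a : model_vec Phi 1 (- 0) lam^-1 P (tz *: u) a 0 =
  tz *: model_vec Phi 1 0 lam P u a 0.
Proof.
rewrite /model_vec /= /pact scaler_sumr; apply: eq_bigr => i _.
by rewrite iter_twist !scalerA [tz * _]mulrC.
Qed.

Lemma G_const u v : G u -> G v -> exists c, b u v = tL k ^ z * constL c.
Proof.
move=> [_ Hu] [_ Hv].
have [c Hc] := pair_const q_neq0 q_nroot b_bil b_Phi (ltn0Sn 0) lam_neq0 Hu (twist_kill Hv).
exists c; rewrite -Hc (bZr b_bil) mulrA -(expfzDr _ _ (tL_neq0 k)) subrr.
by rewrite expr0z mul1r.
Qed.

Lemma G_rel u v : G u -> G v -> b (f u) v + b u (f v) + b (f u) (f v) = 0.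
Proof.
move=> [_ Hu] [_ Hv].
have := pair_rel q_neq0 q_nroot b_bil b_Phi (ltn0Sn 0) lam_neq0 Hu (twist_kill Hv).
rewrite twist (bZr b_bil tz (f u) v) (bZr b_bil tz u (f v)) (bZr b_bil tz (f u) (f v)).
move: (b (f u) v) (b u (f v)) (b (f u) (f v)) => x1 x2 x3 E.
by apply: (mulfI (tLz_neq0 k (- z))); rewrite 2!mulrDr E mulr0.
Qed.

Lemma self_gram_twist u v a a' : b (model_vec Phi 1 0 lam P u a 0)
    (model_vec Phi 1 (- 0) lam^-1 P (tz *: v) a' 0) =
  tz * b (model_vec Phi 1 0 lam P u a 0) (model_vec Phi 1 0 lam P v a' 0).
Proof. by rewrite model_vec_twist (bZr b_bil). Qed.

Section Pair.
Variables u v : V.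
Hypotheses (Gu : G u) (Gv : G v) (top : b (iter d.-1 f u) v != 0).
Local Notation x := (model_vec Phi 1 0 lam P u).
Local Notation y := (model_vec Phi 1 0 lam P v).

Lemma twist_top : b (iter d.-1 f u) (tz *: v) != 0.
Proof. by rewrite (bZr b_bil) mulf_eq0 negb_or tLz_neq0. Qed.

Lemma self_gram0 a c a' c' : (c < 1)%N -> (c' < 1)%N -> c != c' \/ (d <= a + a')%N ->
  b (x a c) (y a' c') = 0.
Proof.
rewrite !ltnS !leqn0 => /eqP -> /eqP -> H.
have := model_gram0 d_gt0 (ltn0Sn 0) (coprimen1 _) lam_neq0 P_X Gu.2 (twist_kill Gv.2) twist_top
  (ltn0Sn 0) (ltn0Sn 0) H.
by rewrite self_gram_twist => /eqP; rewrite mulf_eq0 (negbTE (tLz_neq0 k _)) => /eqP.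
Qed.

Lemma self_gram1 a c a' : (c < 1)%N -> (a + a').+1 = d -> b (x a c) (y a' c) != 0.
Proof.
rewrite ltnS leqn0 => /eqP -> E.
have := model_gram1 d_gt0 (ltn0Sn 0) lam_neq0 P_X Gu.2 (twist_kill Gv.2) twist_top
  (ltn0Sn 0) E.
by rewrite self_gram_twist mulf_eq0 negb_or => /andP[].
Qed.
End Pair.

Lemma self_piece_iii u : G u -> b (iter d.-1 f u) u != 0 ->
  (if symp then ~~ odd d else odd d) -> exists U, piece U.
Proof.
move=> Gu Hu par.
have [A [sA AX AP isoA]] := model_exists (ltn0Sn 0) P_X P_step P_wrap lam_neq0 Gu.1 Gu.2.
have h0 := self_gram0 Gu Gu Hu; have h1 := self_gram1 Gu Gu Hu.
exists A; split=> //.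
- have E : (0 + d.-1).+1 = d by rewrite add0n prednK.
  exact: (nonzero_space d_gt0 (ltn0Sn 0) AP (h1 0%N 0%N d.-1 isT E)).
- move=> w Aw H; apply: (family_nondeg_left h0 h1 AP AP Aw) => w' Aw'.
  by apply/eqP; rewrite b_sym_eq0 H.
right; right; exists d, lam; split; first by split=> //; exists z.
exact/isoA/(family_inj_left h0 h1 AP).
Qed.

Lemma self_piece_ii u v : G u -> G v -> b (iter d.-1 f u) v != 0 ->
  (forall i j, b (iter i f u) (iter j f u) = 0) ->
  (forall i j, b (iter i f v) (iter j f v) = 0) ->
  (if symp then odd d else ~~ odd d) -> exists U, piece U.
Proof.
move=> Gu Gv Huv iu iv par.
have [A [sA AX AP isoA]] := model_exists (ltn0Sn 0) P_X P_step P_wrap lam_neq0 Gu.1 Gu.2.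
have [B [sB BX BP isoB]] := model_exists (ltn0Sn 0) P_X P_step P_wrap lam_neq0 Gv.1 Gv.2.
have h0 := self_gram0 Gu Gv Huv; have h1 := self_gram1 Gu Gv Huv.
have isow w (C : {vspace V}) : (forall i j, b (iter i f w) (iter j f w) = 0) ->
  (forall v, v \in C <-> exists Y : 'M_(d, 1), family_map (model_vec Phi 1 0 lam P w) Y = v) ->
  isotropic b C.
  move=> iw; apply: family_isotropic => a c a' c'; rewrite !ltnS !leqn0 => /eqP -> /eqP ->.
  rewrite /model_vec /= (b_suml b_bil) big1 // => i _; rewrite (bZl b_bil) (b_sumr b_bil).
  by rewrite big1 ?mulr0 // => j _; rewrite (bZr b_bil) iw mulr0.
have [dirAB ndAB dual] := hyperbolic_piece h0 h1 AP BP (isow _ _ iu AP) (isow _ _ iv BP).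
exists (A + B)%VS; split=> //.
- by rewrite subv_add AX BX.
- have E : (0 + d.-1).+1 = d by rewrite add0n prednK.
  have := nonzero_space d_gt0 (ltn0Sn 0) AP (h1 0%N 0%N d.-1 isT E).
  by apply: contraNneq => AB0; rewrite -subv0 -AB0 addvSl.
- exact: stable_add.
right; left; exists d, lam, A, B; split; first by split=> //; exists z.
split; first by split=> //; apply: stable_submodule.
split; first by split; [exact: isow iu AP|exact: isow iv BP].
split=> //; first exact/isoA/(family_inj_left h0 h1 BP).
exact/isoB/(family_inj_right h0 h1 AP).
Qed.

Lemma self_dual_piece w w' : G w -> w' \in X -> iter d f' w' = 0 ->
  b (iter d.-1 f w) w' != 0 -> exists U, piece U.
Proof.
move=> Gw Xw' Hw' top.
have [v Ev] : exists v, w' = tz *: v.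
  by exists ((tz)^-1 *: w'); rewrite scalerA mulfV ?tLz_neq0 // scale1r.
have Gv : G v.
  split; first by rewrite -[v](scalerK (tLz_neq0 k (- z))) -Ev memvZ.
  move: Hw'; rewrite Ev iter_twist => /eqP; rewrite scaler_eq0.
  by rewrite (negbTE (tLz_neq0 k _)) => /eqP.
have Hwv : b (iter d.-1 f w) v != 0.
  by move: top; rewrite Ev (bZr b_bil) mulf_eq0 negb_or => /andP[].
have fX u : u \in X -> f u \in X by apply: Nop_mem.
(* The sign is (-1)^d in the symplectic and (-1)^(d-1) in the orthogonal case; this is the origin of
   the parity conditions. *)
have sgn : (eps * (-1) ^+ d.-1 = 1 /\ (if symp then ~~ odd d else odd d)) \/
    (eps * (-1) ^+ d.-1 = -1 /\ (if symp then odd d else ~~ odd d)).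
  rewrite epsE -(prednK d_gt0) /= -signr_odd; case: symp; case: (odd _);
    rewrite ?expr1 ?expr0 ?mulrNN ?mulr1 ?mul1r; first [by left; split | by right; split].
case: sgn => [[E par]|[E par]].
  have [u Gu Hu] := self_anisotropic k_char0 b_bil b_sym d_gt0 Hf fX G_rel E Gw Gv Hwv.
  exact: self_piece_iii Gu Hu par.
have [u1 [Gu1 Hu1 iu1]] := self_isotropic_adjust k_char0 b_bil eps_sqr b_sym d_gt0 Hf fX
  G_const G_rel E Gw Gv Hwv.
have Hvu1 : b (iter d.-1 f v) u1 != 0.
  rewrite (self_sym b_bil b_sym d_gt0 Hf fX G_rel Gu1 Gv) E rmorphN rmorph1 mulN1r.
  by rewrite oppr_eq0.
(* The adjustment changes only its first vector, so v is corrected against u1 while u1 stays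
   isotropic. *)
have [u2 [Gu2 Hu2 iu2]] := self_isotropic_adjust k_char0 b_bil eps_sqr b_sym d_gt0 Hf fX
  G_const G_rel E Gv Gu1 Hvu1.
exact: self_piece_ii Gu2 Gu1 Hu2 iu2 iu1 par.
Qed.

End SelfDual.

Lemma exists_piece : X != 0%VS -> exists U, piece U.
Proof.
move=> X0.
have s0 : stable Phi 0%VS.
  by move=> u; rewrite memv0 => /eqP ->; rewrite (semilin0 Phi_lin) mem0v.
have X0' : 0%VS != X by rewrite eq_sym.
have [r [s [lam [u [[s_gt0 cop l0] [Xu u0 Nu]]]]]] :=
  quotient_eigenvector q_neq0 q_nroot Phi_lin Phi_inj s0 sX (sub0v X) X0'.
rewrite memv0 in u0; move: Nu; rewrite memv0 => /eqP Nu.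
have [d [w [d_gt0 Xw [Hw Hw1] _ kill']]] := chain_max sX ndX s_gt0 cop l0 Xu u0 Nu.
have [w' [n [Xw' Hn Hb]]] := chain_dual sX ndX s_gt0 cop l0 Xw d_gt0 Hw Hw1.
have Hw' := kill' w' n Xw' Hn.
have [P [P_X P_step P_wrap]] := unipotent_root k_char0 d s_gt0.
case: (classic (~ in_Eq2 q lam \/ r != 0)) => [nE|E].
  exact: (piece_of_pair d_gt0 s_gt0 P_X P_step P_wrap cop l0 Xw Xw' Hw Hw' Hb nE).
have r0 : r = 0 by apply/eqP/negPn/negP => r0; apply: E; right.
have s1 : s = 1%N by move: cop; rewrite r0 /coprime gcd0n => /eqP.
have [z Hz] : in_Eq2 q lam by apply: NNPP => nE; apply: E; left.
move: Hw Hw' Hb P_wrap; rewrite r0 s1 => Hw Hw' Hb P_wrap.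
exact: (self_dual_piece d_gt0 l0 Hz P_X P_step P_wrap (conj Xw Hw) Xw' Hw' Hb).
Qed.

End PieceTypes.

(** * Orthogonal complements and induction *)

Lemma orth_complement X U : stable Phi X -> nondeg_on b X -> (U <= X)%VS ->
  stable Phi U -> nondeg_on b U -> exists Z : {vspace V},
  [/\ stable Phi Z, nondeg_on b Z, (Z <= X)%VS, (U + Z)%VS = X
    & forall u z, u \in U -> z \in Z -> b u z = 0].
Proof.
move=> sX ndX UX sU ndU; have [Z0 HZ0] := orth_space b_bil U.
pose Z := (X :&: Z0)%VS.
have ZP x : x \in Z <-> x \in X /\ forall y, y \in U -> b y x = 0.
  by rewrite memv_cap; split=> [/andP[-> /HZ0]|[-> /HZ0]].
have bC u v : b u v = 0 -> b v u = 0 by move/eqP; rewrite -b_sym_eq0 => /eqP.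
have ndU' u : u \in U -> (forall w, w \in U -> b w u = 0) -> u = 0.
  by move=> Uu H; apply: ndU => // w Uw; apply/bC/H.
have dual := dual_of_nondeg b_bil ndU' ndU.
have sumX : (U + Z)%VS = X.
  apply/eqP; rewrite eqEsubv subv_add UX capvSl /=; apply/subvP => x Xx.
  have [phi Hphi] : exists phi : 'Hom(subvs_of U, (laurent k)^o), phi =1 (fun a => b x (vsval a)).
    by apply: linear_lfun => e u v; rewrite linearP b_bil.2.
  have [w [[Uw Hw] _]] := dual phi.
  rewrite -[x](subrKC w) memv_add //; apply/ZP; split.
    by rewrite memvB // (subvP UX).
  move=> y Uy; apply: bC; rewrite (bDl b_bil) (bNl b_bil).
  by have := Hw (Subvs Uy); rewrite Hphi /= => ->; rewrite subrr.
exists Z; split=> //; last first.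
- by move=> u z Uu /ZP[_]; apply.
- exact: capvSl.
- move=> z Zz H; have /ZP[Xz Hz] := Zz; apply: ndX => // x.
  rewrite -sumX => /memv_addP[u Uu [z' Zz' ->]].
  by rewrite (bDr b_bil) (H z' Zz') (bC _ _ (Hz u Uu)) addr0.
move=> x /ZP[Xx Hx]; apply/ZP; split; first exact: sX.
move=> y Uy; have [y' Uy' <-] := semilin_surj_on q_neq0 Phi_lin Phi_inj sU Uy.
by rewrite b_Phi Hx // sigma0.
Qed.

Definition good_piece symp U := [/\ stable Phi U, nondeg_on b U
  & type_i q Phi b U \/ type_ii q symp Phi b U \/ type_iii q symp Phi U].

Lemma decomposition symp X : eps = (if symp then -1 else 1) ->
  stable Phi X -> nondeg_on b X -> exists (m : nat) (U : nat -> {vspace V}),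
  [/\ (\sum_(j < m) U j)%VS = X,
      forall i j, (i < m)%N -> (j < m)%N -> i != j ->
        forall u w, u \in U i -> w \in U j -> b u w = 0
    & forall j, (j < m)%N -> good_piece symp (U j)].
Proof.
move=> epsE; move: {2}(\dim X) (leqnn (\dim X)) => n.
elim: n X => [|n IH] X dX sX ndX.
  exists 0%N, (fun=> 0%VS); split=> //; rewrite big_ord0; apply/esym/eqP.
  by rewrite -dimv_eq0 -leqn0.
have [X0|X0] := eqVneq X 0%VS.
  by exists 0%N, (fun=> 0%VS); split=> //; rewrite big_ord0 X0.
have [U [UX U0 sU ndU typeU]] := exists_piece sX ndX epsE X0.
have [Z [sZ ndZ ZX sumX orth]] := orth_complement sX ndX UX sU ndU.
have dZ : (\dim Z <= n)%N.
  rewrite -ltnS (leq_trans _ dX) // ltn_neqAle dimvS // andbT.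
  apply: contra U0 => /eqP dE; have /eqP ZE : Z == X by rewrite eqEdim ZX dE leqnn.
  rewrite -subv0; apply/subvP => u Uu; rewrite memv0; apply/eqP/ndU => // w Uw.
  by apply: orth; rewrite ?ZE ?(subvP UX).
have [m [W [sumW orthW goodW]]] := IH Z dZ sZ ndZ.
have WZ i w : (i < m)%N -> w \in W i -> w \in Z.
  by move=> lt; apply: subvP; rewrite -sumW (sumv_sup (Ordinal lt)).
exists m.+1, (fun i => if i is j.+1 then W j else U); split.
- by rewrite big_ord_recl /= sumW.
- move=> [|i] [|j] //= lti ltj ne u w.
  + by move=> Uu Ww; apply: orth => //; apply: WZ Ww.
  + move=> Wu Uw; apply/eqP; rewrite b_sym_eq0; apply/eqP; apply: orth => //.
    exact: WZ Wu.
  by apply: orthW.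
by case=> [|j] lt //=; apply: goodW.
Qed.

End Pieces.

(* symp = true : symplectic D_q-module; symp = false : orthogonal D_q-module *)
Theorem mainTheorem13 (k : closedFieldType) (k_char0 : [pchar k] =i pred0)
    (q : k) (q_neq0 : q != 0)
    (q_not_root1 : forall n : nat, (0 < n)%N -> q ^+ n != 1)
    (symp : bool) (V : vectType (laurent k)) (Phi : V -> V)
    (b : V -> V -> laurent k) (HV : Dq_form q symp Phi b) :
  exists (m : nat) (U : 'I_m -> {vspace V}),
    [/\ (\sum_(j < m) U j)%VS = fullv,
        directv (\sum_(j < m) U j),
        forall i j : 'I_m, i != j ->
          forall u w, u \in U i -> w \in U j -> b u w = 0
      & forall j : 'I_m,
          [/\ Dq_submodule Phi (U j), nondeg_on b (U j)
            & type_i q Phi b (U j) \/ type_ii q symp Phi b (U j)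
              \/ type_iii q symp Phi (U j)]].
Proof.
case: HV => [[PhiD PhiZ Phi_bij] b_bil b_nd b_kind b_Phi].
have Phi_lin : semilin q Phi by split.
have Phi_inj : injective Phi := bij_inj Phi_bij.
(* Both kinds of form are handled together through <v, u> = eps <u, v>. *)
pose eps : k := if symp then -1 else 1.
have eps_sqr : eps ^+ 2 = 1 by rewrite /eps; case: (symp); rewrite ?sqrrN expr1n.
have b_sym u v : b v u = constL eps * b u v.
  rewrite /eps; move: b_kind; rewrite /form_kind; case: (symp) => /= H; last first.
    by rewrite constL1 mul1r.
  have -> : constL (- 1) = -1 :> laurent k by rewrite rmorphN1.
  rewrite mulN1r; apply/eqP; rewrite -addr_eq0.
  have := H (v + u).
  by rewrite (bDl b_bil) !(bDr b_bil) !H add0r addr0 => ->.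
have full_stable : stable Phi fullv by move=> u _; apply: memvf.
have full_nd : nondeg_on b fullv.
  by move=> u _ H; apply: b_nd => w; apply: H; apply: memvf.
have [m [U [sumU orthU goodU]]] := decomposition k_char0 q_neq0 q_not_root1 Phi_lin Phi_inj
  b_bil b_Phi eps_sqr b_sym (erefl eps) full_stable full_nd.
exists m, (fun j : 'I_m => U j); split=> //.
(* If a sum of vectors of the pieces is 0, orthogonality makes each summand orthogonal to its own
   nondegenerate piece. *)
- apply/directv_sum_independent => us Hus sum0 i _.
  have [_ ndU _] := goodU i (ltn_ord i); apply: ndU; first exact: Hus.
  move=> w Uw; have := b0l b_bil w; rewrite -sum0 (b_suml b_bil) (bigD1 i) //=.
  by rewrite big1 ?addr0 // => j ne; apply: (orthU j i) => //; apply: Hus.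
- by move=> i j ne; apply: orthU.
move=> j; have [sU ndU typeU] := goodU j (ltn_ord j); split=> //.
exact: stable_submodule Phi_lin Phi_inj _ sU.
Qed.
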